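(* Let $2 \leq n \in \mathbb{Z}$ and let $E$ be a smooth compact hypersurface in $\mathbb{R}^n$ with constant relative nullity $\nu$, where $0 \leq \nu \leq n-2$. If $p\in\mathbb{R}$ satisfies $p > \frac{2(n -\nu)}{n - \nu +1}$, then $E$ is not a set of $p$-restriction.
   Context: Constant relative nullity: let $U$ be an open set in $\mathbb{R}^{n-1}$ and let $F = \{ (x, \phi(x)) \mid x \in U \}$ be a smooth hypersurface in $\mathbb{R}^n$. If the Hessian matrix $\left( \frac{\partial^2 \phi}{\partial x_i \partial x_j}\right)$ has constant rank $n-1-\nu$ on $U$, where $0\le\nu\le n-1$, then $\phi$ (and $F$) is said to have constant relative nullity $\nu$. A smooth hypersurface $E$ of $\mathbb{R}^n$ has constant relative nullity $\nu$ if every localization $F$ of $E$ (i.e. every local piece of $E$ represented as such a graph in suitable Euclidean coordinates) has constant relative nullity $\nu$. Restriction: $\mathcal{S}(\mathbb{R}^n)$ is the Schwartz space and $\hat f(\xi)=\int_{\mathbb{R}^n} e^{-2\pi i x\cdot \xi} f(x)\,dx$. Let $d\sigma$ be the measure induced on $E$ by Lebesgue measure (surface measure) and $L^1(E)=L^1(E,d\sigma)$. The restriction operator is $\mathcal{R}_E(f)=\hat f|_E$, $f\in\mathcal{S}(\mathbb{R}^n)$. $E$ is a set of $p$-restriction if $\mathcal{R}_E$ extends to a continuous operator from $L^p(\mathbb{R}^n)$ to $L^1(E)$, equivalently if there is a constant $C$ with $\Vert \hat f|_E\Vert_{L^1(E)}\le C\Vert f\Vert_{L^p}$ for all $f\in\mathcal{S}(\mathbb{R}^n)$.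 *)

(* Defs.v *)
From HB Require Import structures.
From mathcomp Require Import all_boot all_order all_algebra.
From mathcomp Require Import all_classical all_reals all_analysis.
From mathcomp Require Import complex.

Set Implicit Arguments.
Unset Strict Implicit.
Unset Printing Implicit Defensive.

Import Order.TTheory GRing.Theory Num.Theory.
Import numFieldNormedType.Exports.
Import ComplexField.

Local Open Scope classical_set_scope.
Local Open Scope ring_scope.

(* The sigma-algebra on matrices is generated by the coordinates, as for
   [n.-tuple T]; over the reals it is the Borel sigma-algebra. *)
Definition measure_matrix_display : measure_display.
Proof. exact: default_measure_display. Qed.

Section measurable_matrix.
Variables (R : realType) (m n : nat).

Definition matrix_measurable : set (set 'M[R]_(m, n)) :=
  <<s \bigcup_(ij in [set: 'I_m * 'I_n])
        preimage_set_system setT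
          (fun M : 'M[R]_(m, n) => M ij.1 ij.2 : measurableTypeR R)
          measurable >>.

Let matrix_set0 : matrix_measurable set0.
Proof. exact: sigma_algebra0. Qed.

Let matrix_setC A : matrix_measurable A -> matrix_measurable (~` A).
Proof. exact: sigma_algebraC. Qed.

Let matrix_bigcup (F : (set 'M[R]_(m, n))^nat) :
  (forall i, matrix_measurable (F i)) -> matrix_measurable (\bigcup_i F i).
Proof. exact: sigma_algebra_bigcup. Qed.

HB.instance Definition _ := @isMeasurable.Build measure_matrix_display
  'M[R]_(m, n) matrix_measurable matrix_set0 matrix_setC matrix_bigcup.

End measurable_matrix.

Section lebesgue_rV.
Variable R : realType.
Local Open Scope ereal_scope.

Definition cons_rV n (p : measurableTypeR R * 'rV[R]_n) : 'rV[R]_n.+1 :=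
  row_mx (p.1%:M : 'rV[R]_1) p.2.

Definition uncons_rV n (v : 'rV[R]_n.+1) : measurableTypeR R * 'rV[R]_n :=
  (v ord0 ord0, rsubmx (v : 'rV[R]_(1 + n))).

Fixpoint lebesgue_rV (n : nat) : set 'rV[R]_n -> \bar R :=
  match n with
  | 0 => \d_(0%R : 'rV[R]_0)
  | n.+1 => pushforward (@lebesgue_measure R \x @lebesgue_rV n) (@cons_rV n)
  end.

Lemma cons_rVK n : cancel (@cons_rV n) (@uncons_rV n).
Proof.
move=> [x v]; rewrite /uncons_rV /cons_rV /= row_mxKr; congr pair.
transitivity ((x%:M : 'M[R]_1) ord0 ord0); last by rewrite mxE eqxx mulr1n.
have E : lshift n (ord0 : 'I_1) = ord0 by exact/val_inj.
by rewrite -(row_mxEl (x%:M : 'M[R]_1) v) E.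
Qed.

Lemma measurable_matrix_fun d (T : measurableType d) m n (f : T -> 'M[R]_(m, n)) :
  (forall i j, measurable_fun setT (fun x => f x i j : measurableTypeR R)) ->
  measurable_fun setT f.
Proof.
move=> mf; apply: (@measurability _ _ _ _ _ _
  (\bigcup_(ij in [set: 'I_m * 'I_n])
        preimage_set_system setT
          (fun M : 'M[R]_(m, n) => M ij.1 ij.2 : measurableTypeR R)
          measurable)) => //.
move=> _ [_ [[i j] _ [A mA <-]] <-]; rewrite !setTI.
by have := mf i j measurableT A mA; rewrite setTI.
Qed.

Lemma measurable_coord m n i j :
  measurable_fun setT (fun M : 'M[R]_(m, n) => M i j : measurableTypeR R).
Proof.
move=> _ A mA; apply: sub_sigma_algebra; exists (i, j) => //.
by exists A => //; rewrite setTI.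
Qed.

Lemma measurable_cons_rV n : measurable_fun setT (@cons_rV n).
Proof.
apply: measurable_matrix_fun => i j.
case: (split_ordP (j : 'I_(1 + n))) => k ->.
- apply: (eq_measurable_fun (fst : measurableTypeR R * 'rV[R]_n -> _)).
    move=> x _; transitivity ((x.1%:M : 'M[R]_1) i k).
      by rewrite !ord1 mxE eqxx mulr1n.
    exact/esym/(row_mxEl (x.1%:M : 'M[R]_1) x.2).
  exact: measurable_fst.
- apply: (eq_measurable_fun
    ((fun v : 'rV[R]_n => v i k : measurableTypeR R) \o snd)).
    move=> x _; exact/esym/(row_mxEr (x.1%:M : 'M[R]_1) x.2).
  by apply: measurableT_comp; [exact: measurable_coord|exact: measurable_snd].
Qed.

Lemma measurable_uncons_rV n : measurable_fun setT (@uncons_rV n).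
Proof.
apply/measurable_fun_pairP; split; first exact: measurable_coord.
apply: measurable_matrix_fun => i j.
apply: (eq_measurable_fun
    (fun v : 'rV[R]_n.+1 => v i (rshift 1 j) : measurableTypeR R)).
  by move=> x _; rewrite /= mxE.
exact: measurable_coord.
Qed.

Lemma lebesgue_rV_sigma_finite_measure n :
  exists mu : {sigma_finite_measure set 'rV[R]_n -> \bar R},
    @lebesgue_rV n = mu.
Proof.
elim: n => [|n [mu IH]] /=.
  exists (\d_(0%R : 'rV[R]_0) : {sigma_finite_measure set _ -> \bar R}).
  by [].
pose nu : {measure set _ -> \bar R} := @lebesgue_measure R \x mu.
pose pf : {measure set 'rV[R]_n.+1 -> \bar R} :=
  measure_function.measure_function_pushforward__canonical__measure_function_Measure
    nu (@measurable_cons_rV n).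
have pf_sf : sigma_finite setT pf.
  have /sigma_finiteP[F [FT ndF Foo]] := sigma_finiteT (@lebesgue_measure R).
  have /sigma_finiteP[G [GT ndG Goo]] := sigma_finiteT mu.
  exists (fun k => @uncons_rV n @^-1` (F k `*` G k)).
    apply/seteqP; split => // v _.
    have [i _ Fi] : (\bigcup_i F i) (uncons_rV v).1 by rewrite -FT.
    have [j _ Gj] : (\bigcup_i G i) (uncons_rV v).2 by rewrite -GT.
    exists (maxn i j) => //; split.
    - by move: Fi; apply/subsetPset/ndF/leq_maxl.
    - by move: Gj; apply/subsetPset/ndG/leq_maxr.
  move=> k; have [mF Fk] := Foo k; have [mG Gk] := Goo k; split.
    rewrite -[X in measurable X]setTI.
    by apply: measurable_uncons_rV => //; exact: measurableX.
  rewrite /= /pushforward -comp_preimage.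
  rewrite (_ : _ @^-1` _ = F k `*` G k); last first.
    by apply/funext => x; exact: (congr1 (F k `*` G k) (cons_rVK x)).
  by rewrite product_measure1E// lte_mul_pinfty// ge0_fin_numE.
pose sf : {sigma_finite_measure set _ -> \bar R} := HB.pack (Measure.sort pf)
  (Measure.on pf) (@Measure_isSigmaFinite.Build _ _ _ pf pf_sf).
by exists sf; rewrite IH.
Qed.

Let lebesgue_rV0 n : @lebesgue_rV n set0 = 0.
Proof. by have [mu ->] := lebesgue_rV_sigma_finite_measure n. Qed.

Let lebesgue_rV_ge0 n A : 0 <= @lebesgue_rV n A.
Proof. by have [mu ->] := lebesgue_rV_sigma_finite_measure n. Qed.

Let lebesgue_rV_semi_sigma_additive n : semi_sigma_additive (@lebesgue_rV n).
Proof.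
have [mu ->] := lebesgue_rV_sigma_finite_measure n.
exact: measure_semi_sigma_additive.
Qed.

HB.instance Definition _ n := isMeasure.Build _ _ _ (@lebesgue_rV n)
  (lebesgue_rV0 n) (@lebesgue_rV_ge0 n) (@lebesgue_rV_semi_sigma_additive n).

Let lebesgue_rV_sigma_finite n : sigma_finite setT (@lebesgue_rV n).
Proof.
by have [mu ->] := lebesgue_rV_sigma_finite_measure n; exact: sigma_finiteT.
Qed.

HB.instance Definition _ n := @Measure_isSigmaFinite.Build _ _ _
  (@lebesgue_rV n) (@lebesgue_rV_sigma_finite n).

End lebesgue_rV.
Arguments lebesgue_rV {R} n.

Section smooth.
Variable R : realType.

(* [partials [:: i1; ...; ik] f] is the iterated partial derivative
   d_{i1} ... d_{ik} f *)
Definition partials n (s : seq 'I_n) (f : 'rV[R]_n -> R) : 'rV[R]_n -> R :=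
  foldr (fun i g => 'D_(delta_mx 0 i) g) f s.

Definition smooth_on n (U : set 'rV[R]_n) (f : 'rV[R]_n -> R) : Prop :=
  forall (s : seq 'I_n) (x : 'rV[R]_n), U x ->
    {for x, continuous (partials s f)} /\
    forall i : 'I_n, derivable (partials s f) x (delta_mx 0 i).

Definition hessian n (f : 'rV[R]_n -> R) (x : 'rV[R]_n) : 'M[R]_n :=
  \matrix_(i, j) partials [:: i; j] f x.

End smooth.

Section hypersurface.
Variables (R : realType) (n : nat).

(* Euclidean coordinates of R^n: [b] is the origin, the rows of [V] followed by
   [w] form the orthonormal basis. *)
Record euclidean_coordinates := EuclideanCoordinates {
  ec_b : 'rV[R]_n;
  ec_V : 'M[R]_(n.-1, n);
  ec_w : 'rV[R]_n;
  ec_VV : ec_V *m ec_V^T = 1%:M;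
  ec_ww : ec_w *m ec_w^T = 1%:M;
  ec_Vw : ec_V *m ec_w^T = 0 }.

(* the point with coordinates (x, phi x) *)
Definition graph_pt (c : euclidean_coordinates) (phi : 'rV[R]_n.-1 -> R)
    (x : 'rV[R]_n.-1) : 'rV[R]_n :=
  ec_b c + x *m ec_V c + phi x *: ec_w c.

(* A smooth hypersurface, possibly with boundary: around each of its points, E
   is in suitable coordinates the graph of a smooth function over an open set
   of R^{n-1}, or over the part [0 <= rho] of such an open set, where 0 is a
   regular value of the smooth function rho (interior points: rho = 1). *)
Definition smooth_hypersurface (E : set 'rV[R]_n) : Prop :=
  forall y, E y ->
  exists (c : euclidean_coordinates) (W : set 'rV[R]_n) (U : set 'rV[R]_n.-1)
         (phi rho : 'rV[R]_n.-1 -> R),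
    [/\ open W /\ W y,
        open U,
        smooth_on U phi /\ smooth_on U rho,
        (forall x, U x -> rho x = 0 ->
           exists i : 'I_n.-1, partials [:: i] rho x != 0) &
        E `&` W = graph_pt c phi @` [set x | U x /\ 0 <= rho x]].

Definition localization (E : set 'rV[R]_n) (c : euclidean_coordinates)
    (U : set 'rV[R]_n.-1) (phi : 'rV[R]_n.-1 -> R) : Prop :=
  [/\ open U, smooth_on U phi &
      exists2 W : set 'rV[R]_n, open W & E `&` W = graph_pt c phi @` U].

Definition constant_relative_nullity (E : set 'rV[R]_n) (nu : nat) : Prop :=
  forall c U phi, localization E c U phi ->
  forall x, U x -> \rank (hessian phi x) = (n.-1 - nu)%N.

(* sigma is carried by E and has density sqrt (1 + |grad phi|^2) in every graph
   parametrization; this determines sigma when E is a smooth hypersurface. *)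
Definition is_surface_measure (E : set 'rV[R]_n)
    (sigma : {measure set 'rV[R]_n -> \bar R}) : Prop :=
  sigma (~` E) = 0%E /\
  forall (c : euclidean_coordinates) (U : set 'rV[R]_n.-1)
         (phi : 'rV[R]_n.-1 -> R) (B : set 'rV[R]_n),
    open U -> smooth_on U phi ->
    measurable B -> B `<=` E `&` (graph_pt c phi @` U) ->
    sigma B = (\int[lebesgue_rV n.-1]_(x in U `&` graph_pt c phi @^-1` B)
      (Num.sqrt (1 + \sum_(i < n.-1) partials [:: i] phi x ^+ 2))%:E)%E.

End hypersurface.

Section restriction.
Variables (R : realType) (n : nat).

Definition schwartz_real (u : 'rV[R]_n -> R) : Prop :=
  smooth_on setT u /\
  forall (alpha : 'I_n -> nat) (s : seq 'I_n), exists C : R,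
    forall x : 'rV[R]_n, `|(\prod_(i < n) x ord0 i ^+ alpha i) * partials s u x| <= C.

Definition schwartz (f : 'rV[R]_n -> R[i]) : Prop :=
  schwartz_real (fun x => complex.Re (f x)) /\
  schwartz_real (fun x => complex.Im (f x)).

Definition expi (t : R) : R[i] := Complex (cos t) (sin t).

Definition dotmul (x y : 'rV[R]_n) : R := \sum_(i < n) x ord0 i * y ord0 i.

Definition fourier (f : 'rV[R]_n -> R[i]) (xi : 'rV[R]_n) : R[i] :=
  let g x := expi (- (2 * pi * dotmul x xi)) * f x in
  Complex (\int[lebesgue_rV n]_x complex.Re (g x))
          (\int[lebesgue_rV n]_x complex.Im (g x)).

Definition p_restriction (E : set 'rV[R]_n)
    (sigma : {measure set 'rV[R]_n -> \bar R}) (p : R) : Prop :=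
  exists C : R, forall f : 'rV[R]_n -> R[i], schwartz f ->
    (\int[sigma]_(xi in E) (Normc.normc (fourier f xi))%:E <=
     C%:E * Lnorm (lebesgue_rV n) p%:E (fun x => (Normc.normc (f x))%:E))%E.

End restriction.

(* Main.v *)
Require Import Defs.
From mathcomp Require Import all_boot all_order all_algebra.
From mathcomp Require Import all_classical all_reals all_analysis.
From mathcomp Require Import complex measurable_realfun ring lra.
Import Order.TTheory GRing.Theory Num.Theory.
Import numFieldNormedType.Exports.
Local Open Scope classical_set_scope.
Local Open Scope ring_scope.

Set Implicit Arguments.
Unset Strict Implicit.
Unset Printing Implicit Defensive.

(** Put k for the rank of the Hessian, so that n - nu = k + 1. A patch of the
    hypersurface is ruled: since the rank of the Hessian is constant, the
    gradient of phi is constant along segments in null directions, and the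
    graph contains flat pieces of dimension n - 1 - k. In the k remaining
    directions a graph is curved at most quadratically. Hence for every K the
    patch is covered by about K ^ k caps, each contained in a parallelepiped of
    unit size in the flat directions, size K^-1 in k directions and thickness
    K^-2, of volume a constant times K ^ -(k + 2) (cap_cover).

    Each cap carries a wave packet, a modulated Gaussian whose Fourier transform
    is a bump of height one on that parallelepiped. Superpose the packets with
    independent signs and test the restriction inequality on all sign patterns.
    On the Fourier side every point of the patch is seen by at least one packet,
    and by orthogonality of the signs the mean of |hat f| is bounded below there
    (sum_sg_norm_ge): the left side stays above a positive constant. On the
    space side the packets all overlap, around the origin, and have amplitude a
    of order K ^ -(k + 2); the random signs bound the mean of |f| ^ q by the sum of the
    q-th powers, for q = min p 2 (sum_sg_powR), and the integral of this sum is
    of order K ^ k * a ^ (q - 1). Since |f| <= 1, p-th powers are smaller than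
    q-th powers. The resulting exponent k - (k + 2) * (q - 1) of K is negative
    exactly when q > 2 * (k + 1) / (k + 2), so the right side tends to 0
    (p_restriction_packets, knapp_numbers, cap_not_restriction).

    The ruling rests on two facts. Near a point the Hessian H factors as
    H *m Y *m H (null_projector), which makes the derivative of H vanish as a
    quadratic form on null vectors (dhessian_null); and the derivative of w *m H
    along w is then controlled by w *m H itself, which therefore stays zero when
    it starts at zero (null_segment). Only the part of the hypersurface away
    from its boundary enters (interior_localization). *)

(** * Norms of matrices *)

Section matrix_norm.
Variable R : realType.

Lemma mx_norm_le m n (A : 'M[R]_(m, n)) (M : R) : 0 <= M ->
  (forall i j, `|A i j| <= M) -> `|A| <= M.
Proof.
move=> M0 H; rewrite /Num.norm /= mx_normrE; exact: bigmax_le.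
Qed.

Lemma mx_coord_le m n (A : 'M[R]_(m, n)) i j : `|A i j| <= `|A|.
Proof.
rewrite [leRHS]mx_normrE; exact: (le_bigmax _ (fun ij => `|A ij.1 ij.2|) (i, j)).
Qed.

Lemma mulmx_norm_le m n p (A : 'M[R]_(m, n)) (B : 'M[R]_(n, p)) :
  `|A *m B| <= n%:R * (`|A| * `|B|).
Proof.
apply: mx_norm_le => [|i j]; first by rewrite !mulr_ge0.
rewrite mxE (le_trans (ler_norm_sum _ _ _))//.
rewrite -[X in X%:R]card_ord -sumr_const mulr_suml ler_sum// => l _.
by rewrite mul1r normrM ler_pM// mx_coord_le.
Qed.

(** Neumann series bound for the inverse of a matrix close to the identity. *)
Lemma unitmx_near1 m (A : 'M[R]_m) : m%:R * `|1%:M - A| <= 2^-1 ->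
  A \in unitmx /\ `|invmx A| <= 2.
Proof.
move=> h.
have small n (B : 'M[R]_(n, m)) : `|B *m (1%:M - A)| <= 2^-1 * `|B|.
  rewrite (le_trans (mulmx_norm_le _ _))// mulrCA mulrC ler_wpM2r//.
have small' n (B : 'M[R]_(m, n)) : `|(1%:M - A) *m B| <= 2^-1 * `|B|.
  by rewrite (le_trans (mulmx_norm_le _ _))// mulrA ler_wpM2r.
have uA : A \in unitmx.
  rewrite -row_free_unit; apply: inj_row_free => v vA.
  apply/eqP; rewrite -normr_eq0 eq_le normr_ge0 andbT.
  have := small _ v; rewrite mulmxBr mulmx1 vA subr0.
  by have := normr_ge0 v; lra.
split=> //.
have E : invmx A = 1%:M + (1%:M - A) *m invmx A.
  by rewrite mulmxBl mul1mx mulmxV// addrC subrK.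
have n1 : `|1%:M : 'M[R]_m| <= 1.
  apply: mx_norm_le => // i j; rewrite !mxE.
  by case: (i == j); rewrite ?normr1 ?normr0.
have := ler_normD (1%:M) ((1%:M - A) *m invmx A); rewrite -E.
have := small' _ (invmx A); lra.
Qed.

End matrix_norm.

(** * Directional derivatives *)

Section calculus.
Variables (R : realType) (n : nat).
Implicit Types (f : 'rV[R]_n -> R) (x v w : 'rV[R]_n).

Local Notation e i := (delta_mx 0 i : 'rV[R]_n).
Local Notation d_ i f := ('D_(delta_mx 0 i : 'rV[R]_n) f).

Lemma is_derive_line f x v t df : is_derive (x + t *: v) v f df ->
  is_derive (t : R) (1 : R) (fun c : R => f (x + c *: v)) df.
Proof.
move=> [dfx <-].
have E : (fun h : R => h^-1 *: ((fun c : R => f (x + c *: v)) (h *: (1:R) + t) -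
    (fun c : R => f (x + c *: v)) t)) =
  (fun h : R => h^-1 *: (f (h *: v + (x + t *: v)) - f (x + t *: v))).
  apply/funext => h /=; congr (_ *: (f _ - _)).
  by rewrite [h *: _]mulr1 scalerDl addrCA.
split; first by rewrite /derivable /= E.
by rewrite /derive /= E.
Qed.

Lemma is_derive_addr f y z v df : is_derive (y + z) v f df ->
  is_derive y v (fun u => f (u + z)) df.
Proof.
move=> [dfx <-].
have E : (fun h : R => h^-1 *: (f (h *: v + y + z) - f (y + z))) =
  (fun h : R => h^-1 *: (f (h *: v + (y + z)) - f (y + z))).
  by apply/funext => h /=; rewrite addrA.
split; first by rewrite /derivable /= E.
by rewrite /derive /= E.
Qed.

Lemma MVT_line_ge0 f x v (t : R) : 0 <= t ->
  (forall c : R, 0 <= c <= t -> derivable f (x + c *: v) v) ->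
  exists2 c, 0 <= c <= t & f (x + t *: v) - f x = t * 'D_v f (x + c *: v).
Proof.
move=> t0 df.
pose F (c : R) := f (x + c *: v).
have dF (c : R) : 0 <= c <= t -> is_derive (c : R) (1 : R) F ('D_v f (x + c *: v)).
  by move=> ct; apply: is_derive_line; exact/derivableP/df.
have cF (a b : R) : (forall c, a <= c <= b -> 0 <= c <= t) ->
    {within `[a, b], continuous F}.
  move=> H; apply: derivable_within_continuous => c.
  by rewrite in_itv /= => /H /dF [].
have [|c] := @MVT_segment R F (fun c => 'D_v f (x + c *: v)) 0 t t0 _
    (cF _ _ (fun=> id)).
  by move=> c; rewrite in_itv /= => /andP[? ?]; apply: dF; rewrite !ltW.
rewrite in_itv /= => ct E; exists c => //.
by move: E; rewrite /F scale0r addr0 subr0 mulrC.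
Qed.

(** The sign of t is free here, as increments along coordinate axes require. *)
Lemma MVT_line f x v (t : R) :
  (forall c : R, `|c| <= `|t| -> derivable f (x + c *: v) v) ->
  exists2 c, `|c| <= `|t| & f (x + t *: v) - f x = t * 'D_v f (x + c *: v).
Proof.
have [t0 df|t0 df] := leP 0 t.
  have df' (c : R) : 0 <= c <= t -> derivable f (x + c *: v) v.
    by move=> /andP[c0 ct]; apply: df; rewrite !ger0_norm.
  have [c ct E] := MVT_line_ge0 t0 df'.
  by exists c => //; case/andP: ct => c0 ct; rewrite !ger0_norm.
have tc (c : R) : 0 <= c <= - t -> `|t + c| <= `|t|.
  move=> /andP[c0 ct]; rewrite (ltr0_norm t0) ler0_norm; last by lra.
  by lra.
have df' (c : R) : 0 <= c <= - t -> derivable f (x + t *: v + c *: v) v.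
  by move=> ct; rewrite -addrA -scalerDl; apply/df/tc.
have [|c ct] := MVT_line_ge0 _ df'; first by lra.
rewrite -!addrA -!scalerDl addrN scale0r addr0 => E.
by exists (t + c); [exact: tc|rewrite -opprB E mulNr opprK].
Qed.

(** Moving from x to x + h along the coordinate axes uses only partial derivatives. *)
Definition trunc_rV (j : nat) (h : 'rV[R]_n) : 'rV[R]_n :=
  \row_i (if (i < j)%N then h 0 i else 0).

Lemma trunc_rVS (j : 'I_n) h : trunc_rV j.+1 h = trunc_rV j h + h 0 j *: e j.
Proof.
apply/rowP => i; rewrite !mxE eqxx /= ltnS leq_eqVlt.
have [->|ij] := eqVneq i j; first by rewrite eqxx ltnn /= mulr1 add0r.
by rewrite -val_eqE in ij; rewrite (negPf ij) /= mulr0 addr0.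
Qed.

Lemma trunc_rV_full h : trunc_rV n h = h.
Proof. by apply/rowP => i; rewrite mxE ltn_ord. Qed.

Lemma trunc_rV0 h : trunc_rV 0 h = 0.
Proof. by apply/rowP => i; rewrite !mxE. Qed.

(** The mean value theorem applied to each coordinate in turn. *)
Lemma increment_le f x (r M : R) h : 0 <= M ->
  (forall y, `|y - x| < r -> forall i, derivable f y (e i)) ->
  (forall y, `|y - x| < r -> forall i, `|d_ i f y| <= M) ->
  `|h| < r -> `|f (x + h) - f x| <= M * (n%:R * `|h|).
Proof.
move=> M0 df dM hr.
suff H j : (j <= n)%N -> `|f (x + trunc_rV j h) - f x| <= M * (j%:R * `|h|).
  by rewrite -{1}(trunc_rV_full h) H.
elim: j => [_|j IH jn].
  by rewrite trunc_rV0 addr0 subrr normr0 mul0r mulr0.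
have inball (c : R) : `|c| <= `|h 0 (Ordinal jn)| ->
    `|x + trunc_rV j h + c *: e (Ordinal jn) - x| < r.
  move=> ch; apply: le_lt_trans hr.
  apply: mx_norm_le => // i0 i; rewrite ord1 (_ : _ - x = trunc_rV j h + c *: e (Ordinal jn));
    last by rewrite addrC addrA addrA addNr add0r.
  rewrite !mxE eqxx /=; have [->|ij] := eqVneq i (Ordinal jn).
    by rewrite /= ltnn add0r mulr1 (le_trans ch)// mx_coord_le.
  rewrite mulr0 addr0; case: ifP => _; first exact: mx_coord_le.
  by rewrite normr0.
rewrite (trunc_rVS (Ordinal jn)) /= addrA.
have [c ch E] := @MVT_line f (x + trunc_rV j h) (e (Ordinal jn))
    (h 0 (Ordinal jn)) (fun c ch => df _ (inball c ch) _).
rewrite -(subrKA (f (x + trunc_rV j h))) (le_trans (ler_normD _ _))//.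
rewrite -[j.+1]add1n natrD mulrDl mul1r mulrDr lerD ?IH ?(ltnW jn)//.
rewrite E normrM mulrC ler_pM//; first exact/dM/inball.
exact: mx_coord_le.
Qed.

Lemma is_derive_affine f x v c :
  (forall h : R, f (h *: v + x) - f x = h * c) -> is_derive x v f c.
Proof.
move=> H.
suff E : (fun h : R => h^-1 *: (f (h *: v + x) - f x)) @ 0^' --> c.
  by split; [exact: (cvgP _ E)|exact: (cvg_lim (@norm_hausdorff _ _) E)].
apply: cvg_near_cst; near=> h; rewrite H [_ *: _]mulKf//.
by near: h; exact: nbhs_dnbhs_neq.
Unshelve. all: by end_near. Qed.

(** A function with continuous partial derivatives has a derivative in every
    direction: subtracting the linear part leaves small partial derivatives. *)
Lemma is_derive_C1 f x w (r : R) : 0 < r ->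
  (forall y, `|y - x| < r -> forall i, derivable f y (e i)) ->
  (forall i, {for x, continuous (d_ i f)}) ->
  is_derive x w f (\sum_i w 0 i * d_ i f x).
Proof.
move=> r0 df cf.
suff H : (fun h : R => h^-1 *: (f (h *: w + x) - f x)) @ 0^' -->
    (\sum_i w 0 i * d_ i f x).
  by split; [exact: (cvgP _ H)|exact: (cvg_lim (@norm_hausdorff _ _) H)].
apply/cvgrPdist_le => eps eps0.
pose K := n%:R * `|w| + 1.
have K0 : 0 < K by rewrite ltr_wpDl// mulr_ge0.
pose eta := eps / K.
have eta0 : 0 < eta by rewrite divr_gt0.
have [r1 r10 rr1] : exists2 r1 : R, 0 < r1 & forall y, `|y - x| < r1 ->
    forall i, `|d_ i f y - d_ i f x| <= eta.
  have : \forall y \near x, forall i, `|d_ i f y - d_ i f x| <= eta.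
    apply: (@filter_forall _ _ (fun i y => `|d_ i f y - d_ i f x| <= eta) (nbhs x) _) => i.
    have /cvgrPdist_le := cf i.
    by move=> /(_ eta eta0); apply: filterS => y; rewrite distrC.
  move=> /nbhs_ballP[r1 /= r10 H]; exists r1 => // y yx; apply: H.
  by rewrite -ball_normE /= distrC.
pose r2 := Num.min r r1.
have r20 : 0 < r2 by rewrite lt_min r0.
pose g := f - (fun y => \sum_i y 0 i * d_ i f x).
have lind y i : is_derive y (e i)
    (fun y : 'rV[R]_n => \sum_i y 0 i * d_ i f x) (d_ i f x).
  apply: is_derive_affine => h; rewrite -sumrB (bigD1 i)//= big1 ?addr0.
    by rewrite !mxE !eqxx /= mulr1 -mulrBl addrK.
  by move=> k ki; rewrite !mxE eqxx /= (negPf ki) mulr0 add0r subrr.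
have gder y i : `|y - x| < r2 -> is_derive y (e i) g (d_ i f y - d_ i f x).
  rewrite lt_min => /andP[yr _]; apply: is_deriveB.
  exact/derivableP/df.
near=> h.
have hn0 : h != 0 by near: h; exact: nbhs_dnbhs_neq.
have hw : `|h *: w| < r2.
  rewrite normrZ (@le_lt_trans _ _ (`|h| * (`|w| + 1)))//.
    by rewrite ler_wpM2l// lerDl.
  rewrite -ltr_pdivlMr ?ltr_wpDl//.
  near: h; apply: dnbhs0_lt; by rewrite divr_gt0// ltr_wpDl.
have := @increment_le g x r2 eta (h *: w) (ltW eta0) _ _ hw.
move=> /(_ (fun y yr i => @ex_derive _ _ _ _ _ _ _ (gder y i yr))).
have gd y : `|y - x| < r2 -> forall i, `|d_ i g y| <= eta.
  move=> yr i; have [_ ->] := gder y i yr.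
  by apply: rr1; move: yr; rewrite lt_min => /andP[].
move=> /(_ gd).
have -> : g (x + h *: w) - g x =
    f (h *: w + x) - f x - h * \sum_i w 0 i * d_ i f x.
  rewrite /g !fctE (addrC (h *: w)).
  have -> : \sum_i (x + h *: w) 0 i * d_ i f x =
      \sum_i x 0 i * d_ i f x + h * \sum_i w 0 i * d_ i f x.
    rewrite mulr_sumr -big_split; apply: eq_bigr => i _ /=.
    by rewrite !mxE mulrDl mulrA.
  by lra.
move=> H.
have -> : \sum_i w 0 i * d_ i f x - h^-1 *: (f (h *: w + x) - f x) =
   - (h^-1 * (f (h *: w + x) - f x - h * \sum_i w 0 i * d_ i f x)).
  by rewrite [_ *: _]/(_ * _) mulrBr mulKf// opprB.
rewrite normrN normrM normfV ler_pdivrMl ?normr_gt0// (le_trans H)//.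
have -> : eta * (n%:R * `|h *: w|) = `|h| * (eps * (n%:R * `|w| / K)).
  by rewrite normrZ /eta; field; rewrite gt_eqF.
rewrite ler_wpM2l// ler_piMr ?(ltW eps0)//.
by rewrite ler_pdivrMr// mul1r /K lerDl.
Unshelve. all: by end_near. Qed.

(** * Smooth functions *)

Variables (U : set 'rV[R]_n) (oU : open U).

Lemma smooth_on_partials f s : smooth_on U f -> smooth_on U (partials s f).
Proof.
by move=> sf t x Ux; have := sf (t ++ s) x Ux; rewrite /partials foldr_cat.
Qed.

Lemma smooth_on_continuous f x : smooth_on U f -> U x -> {for x, continuous f}.
Proof. by move=> sf Ux; have [] := sf [::] x Ux. Qed.

Lemma smooth_on_is_derive f x w : smooth_on U f -> U x ->
  is_derive x w f (\sum_i w 0 i * partials [:: i] f x).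
Proof.
move=> sf Ux.
have /nbhs_ballP[r /= r0 rU] : nbhs x U by apply: open_nbhs_nbhs.
apply: (@is_derive_C1 _ _ _ r) => //.
  move=> y yx i; have [] // := sf [::] y.
  by apply: rU; rewrite -ball_normE /= distrC.
by move=> i; have [] := sf [:: i] x Ux.
Qed.

Lemma smooth_on_MVT f x w : smooth_on U f ->
  (forall c : R, 0 <= c <= 1 -> U (x + c *: w)) ->
  exists2 c : R, 0 <= c <= 1 &
    f (x + w) - f x = \sum_i w 0 i * partials [:: i] f (x + c *: w).
Proof.
move=> sf HU.
have [c] := @MVT_line_ge0 f x w 1 ler01 (fun c ch => @ex_derive _ _ _ _ _ _ _
   (smooth_on_is_derive w sf (HU c ch))).
rewrite scale1r mul1r => c1 ->; exists c => //.
by have [_ ->] := smooth_on_is_derive w sf (HU c c1).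
Qed.

(** Both mixed partial derivatives are limits of the same second difference
    quotient, by two applications of the mean value theorem. *)
Lemma partials_swap f i j x : smooth_on U f -> U x ->
  partials [:: i; j] f x = partials [:: j; i] f x.
Proof.
move=> sf Ux.
have /nbhs_ballP[r /= r0 rU] : nbhs x U by apply: open_nbhs_nbhs.
have inU (y : 'rV[R]_n) : `|y - x| < r -> U y.
  by move=> H; apply: rU; rewrite -ball_normE /= distrC.
have e1 k : `|e k| <= 1.
  apply: mx_norm_le => // l0 l; rewrite ord1 mxE eqxx /=.
  by case: (l == k); rewrite ?normr1 ?normr0.
pose D f (s : R) k y := f (y + s *: e k) - f y : R.
(* second difference at step s is s^2 times a mixed derivative nearby *)
have key (g : 'rV[R]_n -> R) k l (s : R) : smooth_on U g -> 0 < s -> s < r / 2 ->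
    exists2 y, `|y - x| <= 2 * s &
      D (D g s l) s k x = s ^+ 2 * partials [:: l; k] g y.
  move=> sg s0 sr.
  have inr (a b : R) : `|a| <= s -> `|b| <= s ->
      `|x + a *: e k + b *: e l - x| <= 2 * s.
    move=> a1 b1; rewrite (_ : _ - x = a *: e k + b *: e l); last first.
      by rewrite addrC !addrA addNr add0r.
    rewrite (le_trans (ler_normD _ _))// !normrZ mulr_natl mulr2n lerD//.
      by rewrite (le_trans (ler_piMr _ _)).
    by rewrite (le_trans (ler_piMr _ _)).
  have inU2 (a b : R) : `|a| <= s -> `|b| <= s -> U (x + a *: e k + b *: e l).
    move=> a1 b1; apply: inU; apply: le_lt_trans (inr _ _ a1 b1) _.
    by rewrite mulrC -ltr_pdivlMr.
  have ss : `|s| = s by rewrite gtr0_norm.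
  have sss : `|s| <= s by rewrite ss.
  have der (c : R) : `|c| <= `|s| -> is_derive (x + c *: e k) (e k) (D g s l)
      (D (partials [:: k] g) s l (x + c *: e k)).
    rewrite ss => cs; apply: is_deriveB.
      apply: is_derive_addr; apply/derivableP.
      have [_] := sg [::] _ (inU2 c s cs sss); apply.
    apply/derivableP.
    have [|_] := sg [::] (x + c *: e k) _; last by apply.
    by rewrite -[X in U X]addr0 -(scale0r (e l)); apply: inU2 => //; rewrite normr0 ltW.
  have [c cs E] := @MVT_line (D g s l) x (e k) s (fun c cs => @ex_derive _ _ _ _ _ _ _ (der c cs)).
  rewrite /D in E *; rewrite E; have [_ ->] := der c cs.
  rewrite ss in cs.
  have [|c' cs' E'] := @MVT_line (partials [:: k] g) (x + c *: e k) (e l) s.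
    move=> c'; rewrite ss => cs'.
    have [_] := sg [:: k] _ (inU2 c c' cs cs'); apply.
  rewrite ss in cs'.
  exists (x + c *: e k + c' *: e l); first exact: inr.
  by rewrite /D E' mulrA expr2.
apply/eqP; rewrite -subr_eq0 -normr_eq0 eq_le normr_ge0 andbT.
apply/ler_addgt0Pr => eps eps0; rewrite add0r.
have cont k l : exists2 r1 : R, 0 < r1 & forall y, `|y - x| < r1 ->
    `|partials [:: k; l] f x - partials [:: k; l] f y| <= eps / 2.
  have [+ _] := sf [:: k; l] x Ux.
  move=> /cvgrPdist_le /(_ (eps / 2)); rewrite divr_gt0// => /(_ isT).
  move=> /nbhs_ballP[r1 /= r10 H]; exists r1 => // y yx; apply: H.
  by rewrite -ball_normE /= distrC.
have [r1 r10 H1] := cont i j; have [r2 r20 H2] := cont j i.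
have [s s0 [sr sr1 sr2]] :
    exists2 s : R, 0 < s & [/\ s < r / 2, 2 * s < r1 & 2 * s < r2].
  have m0 : 0 < Num.min r (Num.min r1 r2) by rewrite !lt_min r0 r10.
  exists (Num.min r (Num.min r1 r2) / 4); first by rewrite divr_gt0.
  have : Num.min r (Num.min r1 r2) / 2 < Num.min r (Num.min r1 r2).
    by rewrite ltr_pdivrMr// ltr_pMr// ltr1n.
  rewrite !lt_min.
  by move: (Num.min r _) => m /and3P[h1 h2 h3]; split; lra.
have [y yx E] := key f j i s sf s0 sr.
have [y' yx' E'] := key f i j s sf s0 sr.
have DD : D (D f s i) s j x = D (D f s j) s i x.
  rewrite /D (addrAC x).
  by move: (f _) (f _) (f _) (f _) => a b c d; ring.
have s2 : s ^+ 2 != 0 by rewrite expf_neq0// gt_eqF.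
have EE : partials [:: i; j] f y = partials [:: j; i] f y'.
  by apply: (mulfI s2); apply: etrans (esym E) _; rewrite DD.
move: (H1 y (le_lt_trans yx sr1)) (H2 y' (le_lt_trans yx' sr2)); rewrite EE.
have tri (a b c : R) : `|a - b| <= eps / 2 -> `|c - b| <= eps / 2 -> `|a - c| <= eps.
  move=> ab cb; have -> : a - c = (a - b) - (c - b) by ring.
  apply: le_trans (ler_normB _ _) _; rewrite [leRHS]splitr; exact: lerD.
exact: tri.
Qed.

End calculus.

(** * Matrices of given rank *)

Section rank_factorization.
Variables (F : fieldType) (m k : nat).
Hypothesis km : (k <= m)%N.
Variables (H Lt Rt A : 'M[F]_m).
Local Notation P := (pid_mx k : 'M[F]_m).
Local Notation L := (P *m Lt).
Local Notation Rr := (Rt *m P).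
Hypothesis defA : A = L *m H *m Rr + (1%:M - P).

(** After changes of basis L selects k rows of H and Rr selects k columns; A
    completes the resulting k x k corner to an m x m matrix, whose invertibility
    means that the corner is invertible. *)
Lemma pid_mxK : P *m P = P.
Proof. by rewrite mul_pid_mx minnn (minn_idPr km). Qed.

Lemma pid_mx_corner : P *m A = L *m H *m Rr.
Proof. by rewrite defA mulmxDr mulmxBr mulmx1 !mulmxA !pid_mxK subrr addr0. Qed.

Hypothesis uA : A \in unitmx.

Lemma corner_inv : L *m H *m Rr *m invmx A = P.
Proof. by rewrite -pid_mx_corner -mulmxA mulmxV// mulmx1. Qed.

(** When the corner is invertible, the k selected rows have full rank, hence span
    the row space of H; expressing H in them gives the formula. *)
Lemma rank_factorization : \rank H = k ->
  H *m Rr *m invmx A *m L *m H = H.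
Proof.
move=> rH.
have sLH : (L *m H <= H)%MS by exact: submxMl.
have : (H <= L *m H)%MS.
  rewrite -(geq_leqif (mxrank_leqif_sup sLH)) rH.
  apply: leq_trans (mxrankM_maxl (L *m H) Rr).
  by rewrite -pid_mx_corner mxrankMfree ?row_free_unit// rank_pid_mx.
move=> /submxP[X HX].
rewrite {1}HX (_ : _ *m H = X *m (L *m H *m Rr *m invmx A) *m L *m H); last first.
  by rewrite !mulmxA.
by rewrite corner_inv -!mulmxA (mulmxA P P) pid_mxK [RHS]HX -!mulmxA.
Qed.

(** Together with rank_factorization: H *m Rr *m invmx A *m L is a projector. *)
Lemma corner_factorization : L *m (H *m Rr *m invmx A *m L) = L.
Proof. by rewrite !(mulmxA L) corner_inv mulmxA pid_mxK. Qed.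

End rank_factorization.

(** * The Hessian of constant rank *)

Section near_point.
Variables (R : realType) (m : nat).

Lemma mulmx_le n p (A : 'M[R]_(n, m)) (B : 'M[R]_(m, p)) (a b : R) :
  `|A| <= a -> `|B| <= b -> `|A *m B| <= m%:R * (a * b).
Proof.
move=> Aa Bb; rewrite (le_trans (mulmx_norm_le _ _))// ler_wpM2l//.
by rewrite ler_pM.
Qed.

Lemma invmxB (A B : 'M[R]_m) : A \in unitmx -> B \in unitmx ->
  invmx A - invmx B = invmx A *m (B - A) *m invmx B.
Proof.
move=> uA uB; rewrite mulmxBr mulmxBl (mulVmx uA) mul1mx -mulmxA (mulmxV uB).
by rewrite mulmx1.
Qed.

Lemma near_bounded (I : finType) (f : I -> 'rV[R]_m -> R) (x : 'rV[R]_m) :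
  (forall i, {for x, continuous (f i)}) ->
  exists2 M : R, 0 <= M & exists2 r : R, 0 < r &
    forall y, `|y - x| < r -> forall i, `|f i y| <= M.
Proof.
move=> cf; pose M := \sum_i `|f i x| + 1.
have M1 i : `|f i x| + 1 <= M.
  by rewrite lerD2r (bigD1 i)//= lerDl sumr_ge0.
have : \forall y \near x, forall i, `|f i y - f i x| <= 1.
  apply: (@filter_forall _ _ (fun i y => `|f i y - f i x| <= 1) (nbhs x) _) => i.
  have /cvgrPdist_le /(_ 1 ltr01) := cf i.
  by apply: filterS => y; rewrite distrC.
move=> /nbhs_ballP[r /= r0 H]; exists M; first by rewrite addr_ge0// sumr_ge0.
exists r => // y yx i; apply: le_trans (M1 i).
have := H y; rewrite -ball_normE /= distrC => /(_ yx i) h.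
by rewrite -(subrK (f i x) (f i y)) addrC (le_trans (ler_normD _ _))// lerD2l.
Qed.

Lemma ball_segment (x0 x w : 'rV[R]_m) (r c : R) : 0 <= c <= 1 ->
  `|x - x0| < r -> `|x + w - x0| < r -> `|x + c *: w - x0| < r.
Proof.
move=> /andP[c0 c1] h1 h2.
have -> : x + c *: w - x0 = (1 - c) *: (x - x0) + c *: (x + w - x0).
  by rewrite scalerBl scale1r !scalerDr !scalerN; apply/rowP => i; rewrite !mxE; ring.
rewrite (le_lt_trans (ler_normD _ _))// !normrZ (ger0_norm c0) ger0_norm ?subr_ge0//.
have [->|c00] := eqVneq c 0; first by rewrite subr0 mul0r mul1r addr0.
have -> : r = (1 - c) * r + c * r by ring.
apply: ler_ltD; first by rewrite ler_wpM2l ?subr_ge0// ltW.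
by rewrite ltr_pM2l// lt_def c00.
Qed.

End near_point.

Section nullity.
Variables (R : realType) (m k : nat) (U : set 'rV[R]_m) (phi : 'rV[R]_m -> R).
Hypotheses (km : (k <= m)%N) (oU : open U) (sphi : smooth_on U phi).
Hypothesis rankH : forall x, U x -> \rank (hessian phi x) = k.
Variables (x0 : 'rV[R]_m) (Ux0 : U x0).
Local Notation H := (hessian phi).
Local Notation P := (pid_mx k : 'M[R]_m).

Lemma hessian_sym x : U x -> (H x)^T = H x.
Proof.
by move=> Ux; apply/matrixP => i j; rewrite !mxE; exact: (partials_swap oU).
Qed.

Definition dhessian (i : 'I_m) (x : 'rV[R]_m) : 'M[R]_m :=
  \matrix_(a, b) partials [:: i; a; b] phi x.

Lemma partials3_swap12 i j l x : U x ->
  partials [:: i; j; l] phi x = partials [:: j; i; l] phi x.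
Proof.
move=> Ux.
exact: (partials_swap oU i j (smooth_on_partials [:: l] sphi) Ux).
Qed.

Lemma partials3_swap23 i j l x : U x ->
  partials [:: i; j; l] phi x = partials [:: i; l; j] phi x.
Proof.
move=> Ux; apply: near_eq_derive.
have /= := open_nbhs_nbhs (conj oU Ux); apply: filterS => y Uy.
exact: (partials_swap oU).
Qed.

(** Write L for P *m Lt. Near x0, the matrix X y *m L is a projector with the
    same kernel as H y acting on rows: it factors as H y *m Y y, and it fixes
    H y on the left, so that 1 - X y *m L sends every row to a null vector of
    H y. The matrices Lt and Rt reduce H x0 to the block P; the corner of
    L *m H y *m Rr then stays invertible for y near x0, and constancy of the
    rank makes rank_factorization available at y. The bounds and the Lipschitz
    estimates hold uniformly near x0. *)
Lemma null_projector : exists (r c : R) (Lt : 'M[R]_m) (X Y : 'rV[R]_m -> 'M[R]_m),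
  [/\ 0 < r, 0 <= c & Lt \in unitmx] /\
  (forall y, `|y - x0| < r ->
    [/\ U y, X y *m (P *m Lt) = H y *m Y y, X y *m (P *m Lt) *m H y = H y &
        P *m Lt *m (X y *m (P *m Lt)) = P *m Lt] /\
    [/\ `|X y| <= c, `|Y y| <= c, `|H y| <= c & forall i, `|dhessian i y| <= c]) /\
  (forall y z, `|y - x0| < r -> `|z - x0| < r ->
    `|H y - H z| <= c * `|y - z| /\ `|X y - X z| <= c * `|y - z|).
Proof.
have /nbhs_ballP[rU /= rU0 HU] : nbhs x0 U by apply: open_nbhs_nbhs.
have inU y : `|y - x0| < rU -> U y.
  by move=> h; apply: HU; rewrite -ball_normE /= distrC.
have [M3 M30 [r3 r30 H3]] : exists2 M : R, 0 <= M & exists2 r : R, 0 < r &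
    forall y, `|y - x0| < r -> forall t : 'I_m * 'I_m * 'I_m,
      `|partials [:: t.1.1; t.1.2; t.2] phi y| <= M.
  apply: (@near_bounded _ _ _ (fun t => partials [:: t.1.1; t.1.2; t.2] phi)).
  by move=> t; have [] := sphi [:: t.1.1; t.1.2; t.2] Ux0.
pose cH := m%:R * M3.
have cH0 : 0 <= cH by rewrite mulr_ge0.
pose r1 := Num.min rU r3.
have lipH y z : `|y - x0| < r1 -> `|z - x0| < r1 -> `|H y - H z| <= cH * `|y - z|.
  move=> hy hz; apply: mx_norm_le => [|i j]; first by rewrite mulr_ge0.
  rewrite !mxE; set f := partials [:: i; j] phi.
  have zy : z + (y - z) = y by rewrite addrC subrK.
  have seg (c : R) : 0 <= c <= 1 -> `|z + c *: (y - z) - x0| < r1.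
    by move=> c01; apply: ball_segment => //; rewrite zy.
  have [||c c01] := @smooth_on_MVT _ _ _ oU f z (y - z).
  - exact: smooth_on_partials.
  - by move=> c /seg; rewrite lt_min => /andP[/inU].
  rewrite zy => ->; rewrite (le_trans (ler_norm_sum _ _ _))//.
  rewrite /cH -mulrA -[m in m%:R]card_ord -sumr_const mulr_suml ler_sum// => l _.
  rewrite mul1r normrM mulrC ler_pM// ?mx_coord_le//.
  apply: (H3 _ _ (l, i, j)).
  by have := seg c c01; rewrite lt_min => /andP[].
pose L0 := invmx (col_ebase (H x0)); pose Rt := invmx (row_ebase (H x0)).
have uL0 : L0 \in unitmx by rewrite unitmx_inv col_ebase_unit.
pose L := P *m L0; pose Rr := Rt *m P.
pose A y := L *m H y *m Rr + (1%:M - P).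
have Ax0 : A x0 = 1%:M.
  rewrite /A /L /Rr -(mulmx_ebase (H x0)) rankH//.
  rewrite (_ : P *m L0 *m _ *m _ = P *m (L0 *m col_ebase (H x0)) *m P *m (row_ebase (H x0) *m Rt) *m P).
    by rewrite mulVmx ?col_ebase_unit// mulmxV ?row_ebase_unit// !mulmx1 !pid_mxK// addrC subrK.
  by rewrite !mulmxA.
have defA y : A y = L *m H y *m Rr + (1%:M - P) by [].
clearbody A.
pose b := m%:R * (m%:R * (`|L| * cH) * `|Rr|).
have b0 : 0 <= b by rewrite !mulr_ge0.
pose r := Num.min r1 (2^-1 / (m%:R * b + 1)).
have r0 : 0 < r by rewrite !lt_min rU0 r30 divr_gt0// ltr_wpDl// mulr_ge0.
have rr1 y : `|y - x0| < r -> `|y - x0| < r1 by rewrite lt_min => /andP[].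
have lipA y z : `|y - x0| < r -> `|z - x0| < r -> `|A y - A z| <= b * `|y - z|.
  move=> /rr1 hy /rr1 hz; have -> : A y - A z = L *m (H y - H z) *m Rr.
    by rewrite !defA mulmxBr mulmxBl [X in _ - X]addrC opprD addrA addrK.
  rewrite (le_trans (mulmx_le (mulmx_le (lexx _) (lipH _ _ hy hz)) (lexx _)))//.
  by rewrite /b le_eqVlt; apply/orP; left; apply/eqP; ring.
have x0r : `|x0 - x0| < r by rewrite subrr normr0.
have invA y : `|y - x0| < r -> A y \in unitmx /\ `|invmx (A y)| <= 2.
  move=> hy; apply: unitmx_near1; rewrite -Ax0 distrC.
  rewrite (le_trans (ler_wpM2l _ (lipA _ _ hy x0r)))//.
  have : `|y - x0| < 2^-1 / (m%:R * b + 1) by move: hy; rewrite lt_min => /andP[].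
  rewrite ltr_pdivlMr ?ltr_wpDl ?mulr_ge0// => h.
  rewrite mulrA; apply: le_trans (ltW h); rewrite mulrC ler_wpM2l// lerDl//.
pose X y := H y *m Rr *m invmx (A y); pose Y y := Rr *m invmx (A y) *m L.
pose c2 := `|H x0| + cH * r.
have c20 : 0 <= c2 by rewrite addr_ge0// mulr_ge0// ltW.
have Hc y : `|y - x0| < r -> `|H y| <= c2.
  move=> hy; rewrite -(subrK (H x0) (H y)) addrC (le_trans (ler_normD _ _))//.
  rewrite lerD2l (le_trans (lipH _ _ (rr1 _ hy) (rr1 _ x0r)))//.
  by rewrite ler_wpM2l// ltW.
pose cX := m%:R * (m%:R * (c2 * `|Rr|) * 2).
pose cY := m%:R * (m%:R * (`|Rr| * 2) * `|L|).
pose cI := m%:R * (m%:R * (2 * b) * 2).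
pose cL := m%:R * (m%:R * (cH * `|Rr|) * 2) + m%:R * (m%:R * (c2 * `|Rr|) * cI).
have cX0 : 0 <= cX by rewrite !mulr_ge0.
have cY0 : 0 <= cY by rewrite !mulr_ge0.
have cI0 : 0 <= cI by rewrite !mulr_ge0.
have cL0 : 0 <= cL by rewrite addr_ge0// !mulr_ge0.
pose c := cX + cY + c2 + M3 + cH + cL.
have [cXc cYc c2c [M3c cHc cLc]] : [/\ cX <= c, cY <= c, c2 <= c & [/\ M3 <= c, cH <= c & cL <= c]].
  rewrite /c; clearbody cX cY c2 cL cH.
  by split; [lra|lra|lra|split; lra].
exists r, c, L0, X, Y; split; first by split => //; lra.
split.
- move=> y hy; have [uA iA] := invA y hy.
  have Uy : U y by apply: inU; move: (rr1 _ hy); rewrite lt_min => /andP[].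
  split.
    split=> //; first by rewrite /X /Y !mulmxA.
    + exact: (rank_factorization km (defA y) uA (rankH Uy)).
    + exact: (corner_factorization km (defA y) uA).
  split; last by move=> i; apply: (le_trans _ M3c); apply: mx_norm_le => // a b';
      rewrite mxE; apply: (H3 _ _ (i, a, b')); move: (rr1 _ hy); rewrite lt_min => /andP[].
  + by apply: le_trans cXc; apply: mulmx_le => //; apply: mulmx_le => //; exact: Hc.
  + by apply: le_trans cYc; apply: mulmx_le => //; apply: mulmx_le.
  + by apply: le_trans c2c; exact: Hc.
- move=> y z hy hz; split.
    by rewrite (le_trans (lipH _ _ (rr1 _ hy) (rr1 _ hz)))// ler_wpM2r.
  have [uA iA] := invA y hy; have [uB iB] := invA z hz.
  have -> : X y - X z = (H y - H z) *m Rr *m invmx (A y) +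
       H z *m Rr *m (invmx (A y) - invmx (A z)).
    by rewrite mulmxBr 2!mulmxBl addrA subrK.
  have I1 : `|invmx (A y) - invmx (A z)| <= cI * `|y - z|.
    rewrite (invmxB uA uB).
    apply: le_trans (mulmx_le (mulmx_le iA _) iB) _.
      by rewrite distrC; exact: lipA.
    by rewrite le_eqVlt /cI; apply/orP; left; apply/eqP; ring.
  apply: le_trans (ler_normD _ _) _.
  apply: (@le_trans _ _ (cL * `|y - z|)); last by rewrite ler_wpM2r.
  rewrite /cL mulrDl lerD//.
    apply: le_trans (mulmx_le (mulmx_le (lipH _ _ (rr1 _ hy) (rr1 _ hz)) (lexx _)) iA) _.
    by rewrite le_eqVlt; apply/orP; left; apply/eqP; ring.
  apply: le_trans (mulmx_le (mulmx_le (Hc _ hz) (lexx _)) I1) _.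
  by rewrite le_eqVlt; apply/orP; left; apply/eqP; ring.
Qed.

End nullity.

(** * Null segments of the graph *)

Section leaves.
Variables (R : realType) (m k : nat) (U : set 'rV[R]_m) (phi : 'rV[R]_m -> R).
Hypotheses (km : (k <= m)%N) (oU : open U) (sphi : smooth_on U phi).
Variables (x0 : 'rV[R]_m) (r c : R) (Lt : 'M[R]_m) (X Y : 'rV[R]_m -> 'M[R]_m).
Local Notation H := (hessian phi).
Local Notation P := (pid_mx k : 'M[R]_m).
Local Notation L := (P *m Lt).
Local Notation dhessian := (dhessian phi).
Hypotheses (c0 : 0 <= c).
Hypothesis inU : forall y, `|y - x0| < r -> U y.
Hypothesis SY : forall y, `|y - x0| < r -> X y *m L = H y *m Y y.
Hypothesis SH : forall y, `|y - x0| < r -> X y *m L *m H y = H y.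
Hypothesis LS : forall y, `|y - x0| < r -> L *m (X y *m L) = L.
Hypothesis cX : forall y, `|y - x0| < r -> `|X y| <= c.
Hypothesis cY : forall y, `|y - x0| < r -> `|Y y| <= c.
Hypothesis cH : forall y, `|y - x0| < r -> `|H y| <= c.
Hypothesis cT : forall y, `|y - x0| < r -> forall i, `|dhessian i y| <= c.
Hypothesis lipH : forall y z, `|y - x0| < r -> `|z - x0| < r ->
  `|H y - H z| <= c * `|y - z|.
Hypothesis lipX : forall y z, `|y - x0| < r -> `|z - x0| < r ->
  `|X y - X z| <= c * `|y - z|.

Lemma is_derive_quadratic0 (f : 'rV[R]_m -> R) y v d (C s : R) :
  is_derive y v f d -> f y = 0 -> 0 < s ->
  (forall t : R, `|t| < s -> `|f (y + t *: v)| <= C * t ^+ 2) -> d = 0.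
Proof.
move=> [df <-] fy s0 hC.
have C0 : 0 <= C.
  have h2 : 0 < s / 2 by rewrite divr_gt0.
  have := hC (s / 2); rewrite gtr0_norm// => /(_ _)/(le_trans (normr_ge0 _)).
  rewrite pmulr_lge0 ?exprn_gt0//; apply.
  by rewrite ltr_pdivrMr// ltr_pMr// ltr1n.
have : (fun h : R => h^-1 *: (f (h *: v + y) - f y)) @ 0^' --> (0 : R).
  apply/cvgr0Pnorm_le => eps eps0; near=> h.
  have hn0 : h != 0 by near: h; exact: nbhs_dnbhs_neq.
  rewrite fy subr0 normrM normfV ler_pdivrMl ?normr_gt0// addrC.
  apply: (le_trans (hC _ _)).
    by near: h; exact: dnbhs0_lt.
  rewrite -real_normK ?num_real// expr2 mulrA mulrC ler_wpM2l//.
  apply: (@le_trans _ _ ((C + 1) * `|h|)); first by rewrite ler_wpM2r// lerDl.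
  rewrite mulrC -ler_pdivlMr ?ltr_wpDl//.
  by near: h; apply: dnbhs0_le; rewrite divr_gt0// ltr_wpDl.
by move=> /(cvg_lim (@norm_hausdorff _ _)).
Unshelve. all: by end_near. Qed.

Lemma is_derive_hessian_row (w v : 'rV[R]_m) j y : U y ->
  is_derive y v (fun z => (w *m H z) 0 j)
    (\sum_a w 0 a * \sum_l v 0 l * partials [:: l; a; j] phi y).
Proof.
move=> Uy.
have -> : (fun z => (w *m H z) 0 j) =
    \sum_a (w 0 a \*: partials [:: a; j] phi).
  by apply/funext => z; rewrite mxE fct_sumE; apply: eq_bigr => a _; rewrite mxE.
apply: is_derive_sum => a; apply: is_deriveZ.
apply: (smooth_on_is_derive oU v (smooth_on_partials [:: a; j] sphi) Uy).
Qed.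

Lemma hessian_colE y (w : 'rV[R]_m) : U y -> H y *m w^T = (w *m H y)^T.
Proof. by move=> Uy; rewrite trmx_mul (hessian_sym oU sphi Uy). Qed.

(** The quadratic form of the Hessian at z, evaluated on a null vector at y, is of
    second order in z - y by constancy of the rank: near y the Hessian factors as H *m Y *m H, and both outer
    factors vanish to first order on a null vector of H y. *)
Lemma dhessian_null (y w : 'rV[R]_m) i : `|y - x0| < r -> w *m H y = 0 ->
  w *m dhessian i y *m w^T = 0.
Proof.
move=> yr wH0; have Uy := inU yr.
apply/matrixP => i0 j0; rewrite !ord1 !mxE.
pose e : 'rV[R]_m := delta_mx 0 i.
pose G z := (w *m H z *m w^T) 0 0.
have dG : is_derive y e G (\sum_j (w *m dhessian i y) 0 j * w^T j 0).
  have -> : G = \sum_j (w 0 j \*: (fun z => (w *m H z) 0 j)).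
    apply/funext => z; rewrite /G mxE fct_sumE; apply: eq_bigr => j _.
    by rewrite mulrC [w^T _ _]mxE.
  have -> : \sum_j (w *m dhessian i y) 0 j * w^T j 0 =
      \sum_j w 0 j *: \sum_a w 0 a * \sum_l e 0 l * partials [:: l; a; j] phi y.
    apply: eq_bigr => j _; rewrite mulrC [w^T _ _]mxE; congr (_ * _).
    rewrite mxE; apply: eq_bigr => a _; congr (_ * _).
    rewrite mxE (bigD1 i)//= big1 ?addr0 => [|l li].
      by rewrite mxE !eqxx mul1r.
    by rewrite mxE eqxx (negPf li) mul0r.
  by apply: is_derive_sum => j; apply: is_deriveZ; exact: is_derive_hessian_row.
have e1 : `|e| <= 1.
  apply: mx_norm_le => // a b; rewrite mxE.
  by case: (_ && _); rewrite ?normr1 ?normr0.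
pose D : R := m%:R * (m%:R * (m%:R * (`|w| * c) * c) * (m%:R * (`|w| * c))).
apply: (@is_derive_quadratic0 G y e _ D (r - `|y - x0|) dG).
- by rewrite /G wH0 mul0mx mxE.
- by rewrite subr_gt0.
move=> t ht; set z := y + t *: e.
have te : `|t *: e| <= `|t| by rewrite normrZ ler_piMr.
have zr : `|z - x0| < r.
  rewrite /z addrAC; apply: le_lt_trans (ler_normD _ _) _; rewrite -ltrBrDl.
  exact: le_lt_trans te ht.
have zy : z - y = t *: e by rewrite /z addrAC subrr add0r.
clearbody z.
have wHz : `|w *m H z| <= m%:R * (`|w| * c) * `|t|.
  have -> : w *m H z = w *m (H z - H y).
    by move: (H z) (H y) wH0 => Hz Hy wHy; rewrite mulmxBr wHy subr0.
  rewrite -!mulrA; apply: mulmx_le => //.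
  by apply: le_trans (lipH zr yr) _; rewrite zy ler_wpM2l.
rewrite /G; have -> : H z = H z *m Y z *m H z by rewrite -(SY zr) (SH zr).
rewrite !mulmxA -(mulmxA _ (H z)) (hessian_colE w (inU zr)).
apply: le_trans (mx_coord_le _ _ _) _.
apply: le_trans (mulmx_le (mulmx_le wHz (cY zr)) (_ : _ <= m%:R * (`|w| * c) * `|t|)) _.
  apply: mx_norm_le => [|a b]; first by rewrite !mulr_ge0.
  by rewrite mxE (le_trans (mx_coord_le _ _ _)).
by rewrite /D -[t ^+ 2]real_normK ?num_real// le_eqVlt; apply/orP; left; apply/eqP; ring.
Qed.

(** Split w into a null vector w0 of H y and the remainder w1 = (w *m H y) *m Y y,
    which is of the size of w *m H y; only the terms with w1 survive dhessian_null. *)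
Lemma dhessian_le (y w : 'rV[R]_m) i : `|y - x0| < r ->
  `|w *m dhessian i y *m w^T| <=
   m%:R ^+ 3 * c ^+ 2 * (2 + m%:R ^+ 2 * c ^+ 2) * `|w| * `|w *m H y|.
Proof.
move=> yr; set h := `|w *m H y|.
pose w1 := w *m (X y *m L); pose w0 := w - w1.
have w1E : w1 = (w *m H y) *m Y y by rewrite /w1 SY// mulmxA.
have w1h : `|w1| <= m%:R * (h * c).
  by rewrite w1E; apply: mulmx_le => //; exact: cY.
have hw : h <= m%:R * (`|w| * c) by apply: mulmx_le => //; exact: cH.
have w0w : `|w0| <= `|w| * (1 + m%:R ^+ 2 * c ^+ 2).
  apply: le_trans (ler_normB _ _) _; rewrite mulrDr mulr1 lerD2l.
  apply: le_trans w1h _.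
  apply: le_trans (ler_wpM2l _ (ler_wpM2r c0 hw)) _ => //.
  by rewrite le_eqVlt; apply/orP; left; apply/eqP; ring.
have w00 : w0 *m dhessian i y *m w0^T = 0.
  apply: dhessian_null => //.
  by rewrite mulmxBl -(mulmxA w) (SH yr) subrr.
have trle (u : 'rV[R]_m) : `|u^T| <= `|u|.
  by apply: mx_norm_le => // a b; rewrite mxE mx_coord_le.
have -> : w *m dhessian i y *m w^T = w1 *m dhessian i y *m w0^T + w *m dhessian i y *m w1^T.
  have -> : w *m dhessian i y *m w^T = w *m dhessian i y *m w0^T + w *m dhessian i y *m w1^T.
    by rewrite -mulmxDr -linearD /= subrK.
  congr (_ + _); rewrite -{1}(subrK w1 w) -/w0 mulmxDl mulmxDl w00.
  by rewrite add0r.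
apply: le_trans (ler_normD _ _) _.
apply: le_trans (lerD (mulmx_le (mulmx_le w1h (cT yr i)) (le_trans (trle _) w0w))
  (mulmx_le (mulmx_le (lexx _) (cT yr i)) (le_trans (trle _) w1h))) _.
by rewrite le_eqVlt; apply/orP; left; apply/eqP; ring.
Qed.

(** The derivative of w *m H in the direction w is a quadratic form in w, since
    third derivatives are symmetric. *)
Lemma sum_trilinear (w : 'rV[R]_m) j y : U y ->
  \sum_a w 0 a * (\sum_l w 0 l * partials [:: l; a; j] phi y) =
  (w *m dhessian j y *m w^T) 0 0.
Proof.
move=> Uy; rewrite mxE; apply: eq_bigr => a _.
rewrite [w^T _ _]mxE mulrC mxE; congr (_ * _); apply: eq_bigr => l _.
by rewrite mxE (partials3_swap23 oU sphi l a j Uy) (partials3_swap12 oU sphi l j a Uy).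
Qed.

(** The null directions of the Hessian integrate to straight segments: along
    the segment in a null direction w, the derivative of w *m H is controlled
    by w *m H itself, which starts from zero. *)
Lemma null_segment : exists2 eta : R, 0 < eta & forall x w : 'rV[R]_m,
  `|x - x0| < r -> `|x + w - x0| < r -> `|w| <= eta -> w *m H x = 0 ->
  forall t : R, 0 <= t <= 1 -> w *m H (x + t *: w) = 0.
Proof.
pose K := m%:R ^+ 3 * c ^+ 2 * (2 + m%:R ^+ 2 * c ^+ 2).
have K0 : 0 <= K by rewrite !mulr_ge0 ?addr_ge0 ?mulr_ge0 ?exprn_ge0.
exists (2^-1 / (K + 1)); first by rewrite divr_gt0// ltr_wpDl.
move=> x w xr xwr weta wHx.
have seg (t : R) : 0 <= t <= 1 -> `|x + t *: w - x0| < r.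
  by move=> t01; exact: ball_segment.
(* the supremum of the norm along the segment is at most half of itself *)
pose S : set R := [set s | exists2 t : R, 0 <= t <= 1 & s = `|w *m H (x + t *: w)|].
have S0 : S !=set0 by exists `|w *m H (x + 0 *: w)|, 0; rewrite ?lexx ?ler01.
have Sub : ubound S (m%:R * (`|w| * c)).
  by move=> _ [t t01 ->]; apply: mulmx_le => //; apply/cH/seg.
have Shas : has_sup S by split=> //; exists (m%:R * (`|w| * c)).
have supS s : S s -> s <= sup S by move=> Ss; exact: (sup_upper_bound Shas Ss).
have supS0 : 0 <= sup S.
  by have [s Ss] := S0; apply: le_trans (supS _ Ss); case: Ss => t _ ->.
have half (t : R) : 0 <= t <= 1 -> `|w *m H (x + t *: w)| <= 2^-1 * sup S.
  move=> /andP[t0 t1]; apply: mx_norm_le => [|i j]; first by rewrite mulr_ge0.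
  rewrite ord1.
  have der (s : R) : 0 <= s <= t -> is_derive (x + s *: w) w (fun z => (w *m H z) 0 j)
      ((w *m dhessian j (x + s *: w) *m w^T) 0 0).
    move=> /andP[s0 st]; have Us : U (x + s *: w).
      by apply/inU/seg; rewrite s0 (le_trans st).
    by rewrite -sum_trilinear//; exact: is_derive_hessian_row.
  have [s st E] := MVT_line_ge0 t0 (fun s st => @ex_derive _ _ _ _ _ _ _ (der s st)).
  have E0 : (w *m H x) 0 j = 0 by rewrite wHx mxE.
  rewrite (etrans (esym (etrans (congr1 (fun u => _ - u) E0) (subr0 _))) E).
  have [_ ->] := der s st; case/andP: st => s0 st.
  have s01 : 0 <= s <= 1 by rewrite s0 (le_trans st).
  have tn : `|t| <= 1 by rewrite ger0_norm.
  rewrite normrM; apply: le_trans (ler_piMl _ tn) _ => //.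
  apply: le_trans (mx_coord_le _ _ _) _.
  apply: le_trans (dhessian_le w j (seg s s01)) _; rewrite -/K.
  apply: (@le_trans _ _ (K * `|w| * sup S)).
    by apply: ler_wpM2l; [rewrite mulr_ge0|apply: supS; exists s].
  rewrite ler_wpM2r//; apply: le_trans (ler_wpM2l K0 weta) _.
  by rewrite mulrCA ler_piMr// ler_pdivrMr ?ltr_wpDl// mul1r lerDl.
have supS1 : sup S = 0.
  apply/eqP; rewrite eq_le supS0 andbT.
  have : sup S <= 2^-1 * sup S by apply: ge_sup => // _ [t t01 ->]; exact: half.
  by move: (sup S) => z; lra.
move=> t t01; apply/eqP; rewrite -normr_eq0 eq_le normr_ge0 andbT.
by have := half t t01; rewrite supS1 mulr0.
Qed.

Definition grad (x : 'rV[R]_m) : 'cV[R]_m := \col_i partials [:: i] phi x.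

Lemma grad_MVT x w :
  `|x - x0| < r -> `|x + w - x0| < r -> exists2 t : R, 0 <= t <= 1 &
  phi (x + w) - phi x = (w *m grad (x + t *: w)) 0 0.
Proof.
move=> xr xwr.
have [|t t01 ->] := smooth_on_MVT (x := x) (w := w) oU sphi.
  by move=> t t01; apply/inU/ball_segment.
by exists t => //; rewrite mxE; apply: eq_bigr => i _; rewrite mxE.
Qed.

Lemma partial_MVT x w j :
  `|x - x0| < r -> `|x + w - x0| < r -> exists2 t : R, 0 <= t <= 1 &
  grad (x + w) j 0 - grad x j 0 = (w *m H (x + t *: w)) 0 j.
Proof.
move=> xr xwr.
have [|t t01] := smooth_on_MVT (x := x) (w := w) oU (smooth_on_partials [:: j] sphi).
  by move=> t t01; apply/inU/ball_segment.
rewrite !mxE => ->; exists t => //; rewrite mxE; apply: eq_bigr => i _.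
by rewrite mxE.
Qed.

(** As w stays a null vector along the segment, the gradient has zero derivative
    there: the graph is ruled. *)
Lemma grad_null_segment : exists2 eta : R, 0 < eta & forall x w : 'rV[R]_m,
  `|x - x0| < r -> `|x + w - x0| < r -> `|w| <= eta -> w *m H x = 0 ->
  [/\ w *m H (x + w) = 0, grad (x + w) = grad x &
      phi (x + w) = phi x + (w *m grad x) 0 0].
Proof.
have [eta eta0 hseg] := null_segment.
exists eta; first exact: eta0.
move=> x w xr xwr weta wHx.
have gradE (t : R) : 0 <= t <= 1 -> grad (x + t *: w) = grad x.
  move=> t01; have xtr : `|x + t *: w - x0| < r by exact: ball_segment.
  apply/matrixP => i j; rewrite ord1; apply/eqP; rewrite -subr_eq0.
  have [s s01 ->] := partial_MVT i xr xtr.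
  rewrite -scalemxAl scalerA hseg ?scaler0 ?mxE//.
  by case/andP: t01 s01 => t0 t1 /andP[s0 s1]; rewrite mulr_ge0// mulr_ile1.
split.
- by have := hseg _ _ xr xwr weta wHx 1; rewrite scale1r; apply; rewrite ler01 lexx.
- by have := gradE 1; rewrite scale1r; apply; rewrite ler01 lexx.
- have [t t01 E] := grad_MVT xr xwr.
  by rewrite -[LHS](subrK (phi x)) E gradE// addrC.
Qed.

Lemma taylor2 x w : `|x - x0| < r -> `|x + w - x0| < r ->
  `|phi (x + w) - phi x - (w *m grad x) 0 0| <= m%:R ^+ 2 * c * `|w| ^+ 2.
Proof.
move=> xr xwr; have [t t01 ->] := grad_MVT xr xwr.
have -> : (w *m grad (x + t *: w)) 0 0 - (w *m grad x) 0 0 =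
   (w *m (grad (x + t *: w) - grad x)) 0 0 by rewrite mulmxBr !mxE.
apply: le_trans (mx_coord_le _ _ _) _.
have G : `|grad (x + t *: w) - grad x| <= m%:R * (`|w| * c).
  apply: mx_norm_le => [|i j]; first by rewrite !mulr_ge0.
  rewrite ord1 [X in `|X|]mxE [(- grad x) _ _]mxE.
  have xtr : `|x + t *: w - x0| < r by exact: ball_segment.
  have [s s01 ->] := partial_MVT i xr xtr.
  apply: le_trans (mx_coord_le _ _ _) _; apply: mulmx_le.
    case/andP: t01 => t0 t1.
    by rewrite normrZ ger0_norm// ler_piMl.
  by apply: cH; apply: ball_segment.
apply: le_trans (mulmx_le (lexx _) G) _.
by rewrite le_eqVlt; apply/orP; left; apply/eqP; ring.
Qed.

End leaves.

(** * Frames and grids for the caps *)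

Section frames.
Variables (F : fieldType) (m k : nat).
Hypothesis km : (k <= m)%N.
Local Notation P := (pid_mx k : 'M[F]_m).
Variable Lt : 'M[F]_m.
Local Notation L := (P *m Lt).

(** Rows of the frame adapted to the cap at a point: the first k are fixed
    transversal directions, the others span the kernel of the Hessian, onto
    which 1 - X *m L projects. *)
Definition cap_frame (X : 'M[F]_m) : 'M[F]_m :=
  L + (1%:M - P) *m Lt *m (1%:M - X *m L).

(** A cap has size s in the k transversal directions and size 1 in the others. *)
Definition cap_scale (s : F) : 'M[F]_m := s *: P + (1%:M - P).

Lemma pid_diag : P = diag_mx (\row_i (i < k)%N%:R).
Proof.
by apply/matrixP => i j; rewrite !mxE -val_eqE; case: (_ == _); rewrite ?mulr1n ?mulr0n.
Qed.

(** The frame is Lt multiplied by a unitriangular matrix, so that all caps have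
    the same volume. *)
Lemma det_cap_frame X : \det (cap_frame X) = \det Lt.
Proof.
have -> : cap_frame X = (1%:M - (1%:M - P) *m (Lt *m X) *m P) *m Lt.
  rewrite /cap_frame mulmxBr mulmx1 addrA -mulmxDl [P + _]addrC subrK mul1mx.
  by rewrite [RHS]mulmxBl mul1mx !mulmxA.
rewrite det_mulmx -[RHS]mul1r; congr (_ * _).
have E i j : ((1%:M - P) *m (Lt *m X) *m P) i j =
    (1 - (i < k)%N%:R) * (Lt *m X) i j * (j < k)%N%:R.
  rewrite {2}pid_diag mul_mx_diag mxE; congr (_ * _); last by rewrite mxE.
  rewrite mulmxBl mul1mx pid_diag mul_diag_mx !mxE.
  by rewrite mulrBl mul1r.
rewrite det_trig ?big1// => [i _|].
  by rewrite mxE [X in _ + X]mxE E mxE eqxx; case: (i < k)%N; rewrite ?subrr ?mul0r ?mulr0 subr0.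
apply/is_trig_mxP => i j ij; rewrite mxE [X in _ + X]mxE E mxE.
rewrite -val_eqE ltn_eqF// add0r; case: ltnP => ik; first by rewrite subrr !mul0r oppr0.
by rewrite (ltnNge j) (leq_trans ik (ltnW ij)) mulr0 oppr0.
Qed.

Lemma det_cap_scale s : \det (cap_scale s) = s ^+ k.
Proof.
have -> : cap_scale s = diag_mx (\row_i (if (i < k)%N then s else 1)).
  apply/matrixP => i j; rewrite /cap_scale pid_diag !mxE.
  case: (i == j); rewrite ?mulr1n ?mulr0n ?subrr ?mulr0 ?addr0//.
  by case: ifP; rewrite ?mulr1 ?subrr ?addr0// mulr0 subr0 add0r.
rewrite det_diag (eq_bigr (fun i : 'I_m => if (i < k)%N then s else 1)); last first.
  by move=> i _; rewrite mxE.
rewrite -big_mkcond /= prodr_const; congr (_ ^+ _).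
rewrite (eq_card (_ : _ =i [pred i : 'I_m | i < k]%N)) ?card_ord_lt//.
by rewrite -sum1_card (big_ord_narrow km) sum1_card card_ord.
Qed.

(** A displacement that splits into a transversal part h *m Lt and a vector w
    fixed by 1 - X *m L, as null vectors of the Hessian are, has coordinates
    s^-1 *: h and those of w: bounded ones when h is of size s. *)
Lemma row_cap_frame (X : 'M[F]_m) (s : F) (h w : 'rV[F]_m) :
  Lt \in unitmx -> s != 0 -> L *m (X *m L) = L -> h *m P = h ->
  w *m (X *m L) = 0 ->
  (s^-1 *: h + (w *m invmx Lt) *m (1%:M - P)) *m (cap_scale s *m cap_frame X) =
  h *m Lt + w.
Proof.
move=> uL s0 LS hP wS.
have PP := pid_mxK F km.
have cP : (1%:M - P) *m P = 0 by rewrite mulmxBl mul1mx PP subrr.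
have cc : (1%:M - P) *m (1%:M - P) = 1%:M - P by rewrite mulmxBr mulmx1 cP subr0.
have hc : h *m (1%:M - P) = 0 by rewrite mulmxBr mulmx1 hP subrr.
rewrite mulmxA.
have -> : (s^-1 *: h + w *m invmx Lt *m (1%:M - P)) *m cap_scale s =
    h + w *m invmx Lt *m (1%:M - P).
  move: (w *m _) => v; rewrite /cap_scale [LHS]mulmxDr -scalemxAr !mulmxDl.
  rewrite -!scalemxAl hP hc scaler0 add0r -(mulmxA v _ P) cP mulmx0 addr0.
  by rewrite scalerA mulfV// scale1r -mulmxA cc.
rewrite mulmxDl; congr (_ + _).
  by rewrite /cap_frame [LHS]mulmxDr !mulmxA hP hc !mul0mx addr0.
have wv : w = w *m invmx Lt *m Lt by rewrite -mulmxA mulVmx// mulmx1.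
rewrite [in RHS]wv; move: (w *m _) wv => v wv.
have Z : L *m (1%:M - X *m L) = 0 by rewrite mulmxBr mulmx1 LS subrr.
rewrite /cap_frame [LHS]mulmxDr -(mulmxA v _ L) (mulmxA _ P Lt) cP mul0mx mulmx0 add0r.
rewrite -(mulmxA v) (mulmxA (1%:M - P)) (mulmxA (1%:M - P) (1%:M - P)) cc.
rewrite mulmxBl mul1mx mulmxBl Z subr0 (mulmxA v Lt) -wv mulmxBr mulmx1 wS subr0.
by rewrite wv.
Qed.

End frames.

Section grid.
Variables (R : realType) (m k K : nat) (D : R).
Hypotheses (K0 : (0 < K)%N) (D0 : 0 < D).

Definition grid_pt (j : {ffun 'I_k -> 'I_K.+1}) : 'rV[R]_m :=
  \row_i (if insub (val i) is Some i' then - D + 2 * D / K%:R * (j i' : nat)%:R else 0).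

Lemma grid_pt_pid j : grid_pt j *m pid_mx k = grid_pt j.
Proof.
rewrite pid_diag; apply/rowP => i; rewrite mul_mx_diag !mxE.
by case: insubP => [u -> _|/negPf ->]; rewrite ?mulr1 ?mulr0.
Qed.

Lemma grid_pt_le j : `|grid_pt j| <= D.
Proof.
have KR : 0 < K%:R :> R by rewrite ltr0n.
apply: mx_norm_le => [|i0 i]; first exact: ltW.
rewrite mxE; case: insubP => [u _ _|_]; last by rewrite normr0 ltW.
rewrite ler_norml; apply/andP; split.
  by rewrite lerDl mulr_ge0// divr_ge0// ?mulr_ge0// ltW.
suff : 2 * D / K%:R * (j u : nat)%:R <= 2 * D by lra.
rewrite -mulrA ler_piMr ?mulr_ge0 ?(ltW D0)//.
by rewrite mulrC ler_pdivrMr// mul1r ler_nat -ltnS.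
Qed.

Lemma grid_near (a : 'rV[R]_m) : a *m pid_mx k = a -> `|a| <= D ->
  exists j, `|a - grid_pt j| <= 2 * D / K%:R.
Proof.
move=> aP aD.
have KR : 0 < K%:R :> R by rewrite ltr0n.
have st0 : 0 < 2 * D / K%:R by rewrite divr_gt0// mulr_gt0.
pose y (i : 'I_m) : R := (a 0 i + D) / (2 * D / K%:R).
have y0 i : 0 <= y i.
  have := le_trans (mx_coord_le a 0 i) aD; rewrite ler_norml => /andP[h _].
  by rewrite divr_ge0 ?(ltW st0)//; lra.
have yK i : y i <= K%:R.
  have := le_trans (mx_coord_le a 0 i) aD; rewrite ler_norml => /andP[_ h].
  rewrite ler_pdivrMr// mulrCA mulfV ?gt_eqF// mulr1; lra.
pose q (l : 'I_k) : 'I_K.+1 :=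
  inord (if insub (val l) is Some i then Num.truncn (y i) else 0%N).
exists [ffun l => q l].
apply: mx_norm_le => [|i0 i]; first exact: ltW.
rewrite ord1 mxE [X in _ + X]mxE mxE; case: insubP => [u uk uE|ik]; last first.
  rewrite -aP pid_diag mul_mx_diag !mxE (negPf ik) mulr0 subrr normr0.
  exact: ltW.
rewrite ffunE /q; case: insubP => [i' _ i'E|]; last by rewrite uE ltn_ord.
have {i'E}-> : i' = i by apply: val_inj; rewrite i'E uE.
have /andP[t1 t2] := truncn_itv (y0 i).
rewrite inordK; last first.
  by rewrite ltnS -(ler_nat R) (le_trans t1).
have -> : a 0 i - (- D + 2 * D / K%:R * (Num.truncn (y i))%:R) =
    (y i - (Num.truncn (y i))%:R) * (2 * D / K%:R).
  rewrite mulrBl [y i * _]divfK ?gt_eqF//; ring.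
rewrite normrM (ger0_norm (ltW st0)) ler_piMl ?(ltW st0)//.
rewrite ger0_norm ?subr_ge0//; rewrite -natr1 in t2; lra.
Qed.

End grid.

(** * Covering the graph by caps *)

Section caps.
Variables (R : realType) (m k : nat) (U : set 'rV[R]_m) (phi : 'rV[R]_m -> R).
Hypotheses (km : (k <= m)%N) (oU : open U) (sphi : smooth_on U phi).
Hypothesis rankH : forall x, U x -> \rank (hessian phi x) = k.
Variables (x0 : 'rV[R]_m) (Ux0 : U x0).
Local Notation H := (hessian phi).
Local Notation P := (pid_mx k : 'M[R]_m).

(** The patch of the graph over a ball is covered by (K + 1) ^ k parallelepipeds
    of equal volume, thin of order K^-2 across the tangent plane, of order K^-1
    in k tangent directions and of unit size in the m - k others. The centers
    lie over a grid in the transversal through x0. Sliding x along its null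
    segment leads to a foot in the transversal; the grid point F j nearest to
    the foot is at distance O(K^-1). The null segments at F j and at the foot
    are almost parallel, so x is O(K^-1) away from a point F j + wj of the null
    segment through F j. The gradient there is the gradient at F j, hence
    taylor2 puts the graph at x within O(K^-2) of the tangent plane at F j. The
    exponent of the determinant is 2 for the thickness plus k for the widths. *)
Lemma cap_cover : exists rho C d0 : R, [/\ 0 < rho, 0 < C & d0 != 0] /\
  (forall x, `|x - x0| <= rho -> U x) /\
  forall K : nat, (0 < K)%N ->
  exists (F : {ffun 'I_k -> 'I_K.+1} -> 'rV[R]_m)
         (Q : {ffun 'I_k -> 'I_K.+1} -> 'M[R]_(1 + m)),
  (forall j, \det (Q j) = d0 * K%:R^-1 ^+ k.+2) /\
  forall x, `|x - x0| <= rho -> exists j (theta : 'rV[R]_(1 + m)),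
    `|theta| <= C /\
    row_mx (phi x - phi (F j))%:M (x - F j) = theta *m Q j.
Proof.
have parts (a b d q t : R) : 0 <= a -> 0 <= b -> 0 <= d -> 0 <= q -> t <= b ->
    [/\ a + q <= a + b + q + d + 1, b <= a + b + q + d + 1,
        t <= a + b + q + d + 1, q <= a + b + q + d + 1 &
        [/\ a <= a + b + q + d + 1, d + 1 <= a + b + q + d + 1 &
            1 <= a + b + q + d + 1]].
  by move=> *; split; [lra|lra|lra|lra|split; lra].
have sums (a b d : R) : 0 <= a -> 0 <= b -> 0 <= d ->
    [/\ 0 < a + b + d + 1, a <= a + b + d + 1 & b + d <= a + b + d + 1].
  by move=> *; split; lra.
have half1 : 2^-1 <= 1 :> R by lra.
have half (a : R) : a <= 2^-1 -> 2 * a <= 1 by move=> ?; lra.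
have [r [c [Lt [X [Y [[r0 c0 uLt] [facts lips]]]]]]] :=
  null_projector km oU sphi rankH Ux0.
have inU y : `|y - x0| < r -> U y by move=> /facts[[]].
have SY y : `|y - x0| < r -> X y *m (P *m Lt) = H y *m Y y by move=> /facts[[]].
have SH y : `|y - x0| < r -> X y *m (P *m Lt) *m H y = H y by move=> /facts[[]].
have LS y : `|y - x0| < r -> P *m Lt *m (X y *m (P *m Lt)) = P *m Lt by move=> /facts[[]].
have cX y : `|y - x0| < r -> `|X y| <= c by move=> /facts[_ []].
have cY y : `|y - x0| < r -> `|Y y| <= c by move=> /facts[_ []].
have cH y : `|y - x0| < r -> `|H y| <= c by move=> /facts[_ []].
have cT y : `|y - x0| < r -> forall i, `|dhessian phi i y| <= c by move=> /facts[_ []].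
have lipH y z : `|y - x0| < r -> `|z - x0| < r -> `|H y - H z| <= c * `|y - z|.
  by move=> hy hz; have [] := lips y z hy hz.
have lipX y z : `|y - x0| < r -> `|z - x0| < r -> `|X y - X z| <= c * `|y - z|.
  by move=> hy hz; have [] := lips y z hy hz.
have [eta eta0 ruled] := grad_null_segment oU sphi c0 inU SY SH cY cH cT lipH.
have taylor := taylor2 oU sphi c0 inU cH.
clear facts lips.
have SHv y (w : 'rV[R]_m) : `|y - x0| < r -> (w - w *m (X y *m (P *m Lt))) *m H y = 0.
  move=> hy; rewrite mulmxBl -(mulmxA w); have := SH _ hy.
  by move: (H y) => Hy ->; rewrite subrr.
have Snull y (w : 'rV[R]_m) : `|y - x0| < r -> w *m H y = 0 -> w *m (X y *m (P *m Lt)) = 0.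
  move=> hy; have -> := SY _ hy; move: (H y) => Hy e.
  by rewrite mulmxA e mul0mx.
set M : R := m%:R; have M0 : 0 <= M by exact: ler0n.
set ell := `|P *m Lt|; have ell0 : 0 <= ell by exact: normr_ge0.
set beta := `|Lt|; have beta0 : 0 <= beta by exact: normr_ge0.
set beta' := `|invmx Lt|; have beta'0 : 0 <= beta' by exact: normr_ge0.
pose sg := M * (c * ell); have sg0 : 0 <= sg by rewrite !mulr_ge0.
have cS y (w : 'rV[R]_m) (a : R) : `|y - x0| < r -> `|w| <= a ->
    `|w *m (X y *m (P *m Lt))| <= M * (a * sg).
  by move=> hy wa; apply: mulmx_le => //; apply: mulmx_le => //; exact: cX.
pose de := M * (M * sg * beta'); have de0 : 0 <= de by rewrite !mulr_ge0.
pose u := 1 + M * sg; have u1 : 1 <= u by rewrite lerDl mulr_ge0.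
have u0 : 0 <= u by rewrite (le_trans ler01).
(* every length met below is at most rho * T, which has to be small *)
pose T := u ^+ 2 + u + M * ((de + 1) * beta) + de + 1.
have uu0 : 0 <= u ^+ 2 by rewrite exprn_ge0.
have Mdb0 : 0 <= M * ((de + 1) * beta) by rewrite !mulr_ge0// addr_ge0.
have T0 : 0 < T by rewrite /T; clearbody u de; lra.
pose rho := Num.min (r / 2) (Num.min eta (2^-1)) / T.
have mn0 : 0 < Num.min (r / 2) (Num.min eta 2^-1).
  by rewrite !lt_min eta0 invr_gt0 ltr0n divr_gt0.
have rho0 : 0 < rho by rewrite divr_gt0.
have [Tr Teta T1] : [/\ rho * T < r, rho * T <= eta & rho * T <= 2^-1].
  rewrite /rho divfK ?gt_eqF//; split.
  - apply: le_lt_trans (_ : r / 2 < r); first by rewrite ge_min lexx.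
    by rewrite ltr_pdivrMr// ltr_pMr// ltr1n.
  - by rewrite !ge_min lexx orbT.
  - by rewrite !ge_min lexx !orbT.
have part (a : R) : a <= T -> rho * a <= rho * T by rewrite ler_pM2l.
have Msu : M * sg <= u by rewrite lerDr.
move: (parts _ _ _ _ _ uu0 u0 de0 Mdb0 Msu).
rewrite -/T => -[pT1 pT2 pT3 pT4 [pT5 pT6 pT7]].
clearbody T rho.
pose D := rho * (de + 1); have D0 : 0 < D by rewrite mulr_gt0// ltr_wpDl.
have D2 : 2 * D <= 1.
  exact: (half _ (le_trans (part _ pT6) T1)).
pose kap := 1 + M * (M * (1 * (c * (M * (1 * beta)))) * 1).
have kap0 : 0 <= kap by rewrite addr_ge0// !mulr_ge0.
pose kap2 := M ^+ 2 * c * (M * (kap * beta)) ^+ 2.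
have kap20 : 0 <= kap2 by rewrite !mulr_ge0 ?exprn_ge0// !mulr_ge0.
pose vb := M * (M * (1 * beta') * 1); have vb0 : 0 <= vb by rewrite !mulr_ge0.
have [C0 C1 C2] := sums _ _ _ kap20 kap0 vb0.
exists rho, (kap2 + kap + vb + 1), (\det Lt); split.
  split=> //.
  by rewrite -unitfE -unitmxE.
split.
  move=> x hx; apply: inU; apply: le_lt_trans hx (le_lt_trans _ Tr).
  by have := part _ pT7; rewrite mulr1.
move=> K K0; pose s : R := K%:R^-1.
have s0 : 0 < s by rewrite invr_gt0 ltr0n.
have s1 : s <= 1 by rewrite invf_le1 ?ltr0n// ler1n.
(* the first row of Q is vertical of length s ^ 2, and the others are tangent to
   the graph at F j *)
pose F (j : {ffun 'I_k -> 'I_K.+1}) := x0 + grid_pt m D j *m Lt.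
pose Bj j := cap_scale m k s *m cap_frame k Lt (X (F j)).
pose Q j : 'M[R]_(1 + m) := block_mx (s ^+ 2)%:M 0 (Bj j *m grad phi (F j)) (Bj j).
exists F, Q; split.
  move=> j; rewrite /Q det_lblock det_scalar1 /Bj det_mulmx.
  by rewrite (det_cap_scale km) det_cap_frame -/s !exprS; ring.
have FrM j : `|F j - x0| <= rho * (M * ((de + 1) * beta)).
  rewrite /F addrAC subrr add0r.
  apply: le_trans (mulmx_le (grid_pt_le m K0 D0 j) (lexx beta)) _; rewrite -/M.
  by rewrite /D le_eqVlt; apply/orP; left; apply/eqP; ring.
have Fr j : `|F j - x0| <= rho * T by exact: le_trans (FrM j) (part _ pT4).
move=> x hx.
have xr : `|x - x0| < r.
  by apply: le_lt_trans hx (le_lt_trans _ Tr); have := part _ pT7; rewrite mulr1.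
pose z := x - x0; pose w := z - z *m (X x *m (P *m Lt)).
have wx : w *m H x = 0 by exact: SHv.
have zS : `|z *m (X x *m (P *m Lt))| <= M * (rho * sg) by exact: cS.
have wle : `|w| <= rho * u.
  apply: le_trans (ler_normB _ _) _; rewrite /u mulrDr mulr1 lerD//.
  by apply: le_trans zS _; rewrite mulrCA.
(* the foot of the leaf through x, and its coordinates in the transversal *)
pose foot := x0 + z *m (X x *m (P *m Lt)).
have footE : foot = x - w.
  rewrite /foot /w; move: (z *m _) => q; rewrite /z.
  by apply/rowP => i; rewrite !mxE; ring.
have footr : `|foot - x0| < r.
  rewrite /foot addrAC subrr add0r; apply: le_lt_trans zS (le_lt_trans _ Tr).
  by apply: le_trans (part _ pT3); rewrite mulrCA.
have [wf _ _] : [/\ (- w) *m H foot = 0, grad phi foot = grad phi x &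
      phi foot = phi x + ((- w) *m grad phi x) 0 0].
  rewrite footE; apply: ruled => //; first by rewrite -footE.
    by rewrite normrN (le_trans wle)// (le_trans (part _ pT2)).
  by rewrite mulNmx wx oppr0.
have {}wf : w *m H foot = 0 by rewrite -[LHS]opprK -mulNmx wf oppr0.
pose a := z *m X x *m P.
have aLt : a *m Lt = foot - x0 by rewrite /a /foot addrAC subrr add0r !mulmxA.
clearbody w foot.
have aP : a *m P = a by rewrite /a -!mulmxA (pid_mxK R km).
have ale : `|a| <= D.
  have -> : a = (z *m (X x *m (P *m Lt))) *m invmx Lt.
    by rewrite /a -!mulmxA mulmxV// mulmx1.
  apply: le_trans (mulmx_le zS (lexx beta')) _; rewrite -/M.
  apply: (@le_trans _ _ (rho * de)); last by rewrite /D ler_pM2l// lerDl.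
  by rewrite /de le_eqVlt; apply/orP; left; apply/eqP; ring.
clearbody a.
have [j aj] := grid_near K0 D0 aP ale.
have ajs : `|a - grid_pt m D j| <= s.
  apply: le_trans aj _; rewrite -[X in _ <= X]mul1r.
  by rewrite ler_wpM2r ?(ltW s0).
have Fjr : `|F j - x0| < r by apply: le_lt_trans (Fr j) Tr.
pose wj := w - w *m (X (F j) *m (P *m Lt)).
have wjle : `|wj| <= rho * u ^+ 2.
  apply: le_trans (ler_normB _ _) _.
  apply: le_trans (lerD wle (cS _ _ _ Fjr wle)) _.
  by rewrite /u le_eqVlt; apply/orP; left; apply/eqP; ring.
have wjH : wj *m H (F j) = 0 by exact: SHv.
have Fwr : `|F j + wj - x0| < r.
  rewrite addrAC; apply: le_lt_trans (ler_normD _ _) (le_lt_trans _ Tr).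
  apply: le_trans (part _ pT1); rewrite mulrDr [leLHS]addrC.
  exact: (lerD wjle (FrM j)).
have [_ gradj phij] := ruled _ _ Fjr Fwr (le_trans wjle (le_trans (part _ pT5) Teta)) wjH.
(* the component of x - F j transversal to the leaf through F j *)
pose h := (a - grid_pt m D j) + w *m X (F j) *m P.
have hP : h *m P = h.
  by rewrite /h mulmxDl mulmxBl aP grid_pt_pid -(mulmxA _ P) (pid_mxK R km).
have wXf : w *m X foot *m P = 0.
  have -> : w *m X foot *m P = (w *m (X foot *m (P *m Lt))) *m invmx Lt.
    by rewrite -!mulmxA mulmxV// mulmx1.
  by rewrite (Snull _ _ footr wf) mul0mx.
have P1 : `|P| <= 1.
  by apply: mx_norm_le => // i i'; rewrite mxE; case: (_ && _); rewrite ?normr1 ?normr0.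
have P1' : `|1%:M - P| <= 1.
  apply: mx_norm_le => // i i'; rewrite !mxE -val_eqE; case: (_ == _) => /=.
    by case: (_ < _)%N; rewrite ?subrr ?subr0 ?normr1 ?normr0.
  by rewrite subr0 normr0.
have w1 : `|w| <= 1.
  by apply: le_trans wle (le_trans (part _ pT2) (le_trans T1 _)).
have Ffoot : `|F j - foot| <= M * (s * beta).
  have -> : F j - foot = - ((a - grid_pt m D j) *m Lt).
    rewrite mulmxBl aLt /F; move: (grid_pt m D j *m Lt) => q.
    by apply/rowP => i; rewrite !mxE; ring.
  by rewrite normrN; exact: mulmx_le.
have hle : `|h| <= s * kap.
  rewrite /kap mulrDr mulr1; apply: le_trans (ler_normD _ _) _; apply: lerD => //.
  have -> : w *m X (F j) *m P = w *m (X (F j) - X foot) *m P.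
    by rewrite mulmxBr mulmxBl wXf subr0.
  apply: le_trans (mulmx_le (mulmx_le w1 (le_trans (lipX _ _ Fjr footr) (ler_wpM2l c0 Ffoot))) P1) _; rewrite -/M.
  by rewrite le_eqVlt; apply/orP; left; apply/eqP; ring.
have xE : x = F j + wj + h *m Lt.
  have hLt : h *m Lt = (a *m Lt - grid_pt m D j *m Lt) + w *m (X (F j) *m (P *m Lt)).
    by rewrite /h mulmxDl mulmxBl !mulmxA.
  have FE : F j = x0 + grid_pt m D j *m Lt by [].
  rewrite hLt aLt footE /wj.
  move: (w *m (X _ *m _)) => p; rewrite FE; move: (grid_pt m D j *m Lt) => q.
  by apply/rowP => i; rewrite !mxE; ring.
(* the height of x over the tangent plane at F j *)
pose tau := phi x - phi (F j + wj) - ((h *m Lt) *m grad phi (F j + wj)) 0 0.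
have tle : `|tau| <= s ^+ 2 * kap2.
  rewrite /tau {1}xE; apply: le_trans (taylor _ _ Fwr _) _; first by rewrite -xE.
  have hL : `|h *m Lt| <= s * (M * (kap * beta)).
    apply: le_trans (mulmx_le hle (lexx beta)) _; rewrite -/M.
    by rewrite le_eqVlt; apply/orP; left; apply/eqP; ring.
  have hL0 : 0 <= s * (M * (kap * beta)) := le_trans (normr_ge0 _) hL.
  rewrite -ler_sqr ?nnegrE// in hL.
  have M2c : 0 <= M ^+ 2 * c by rewrite mulr_ge0// exprn_ge0.
  apply: le_trans (ler_wpM2l M2c hL) _.
  by rewrite /kap2 le_eqVlt; apply/orP; left; apply/eqP; ring.
pose v := wj *m invmx Lt.
have v1 : `|v| <= M * (1 * beta').
  apply: mulmx_le => //.
  by apply: le_trans wjle (le_trans (part _ pT5) (le_trans T1 _)).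
pose th := s^-1 *: h + v *m (1%:M - P).
have xF : x - F j = h *m Lt + wj.
  have gen (p q e : 'rV[R]_m) : p + q + e - p = e + q.
    by apply/rowP => i; rewrite !mxE; ring.
  by rewrite [X in X - _]xE gen.
have thB : th *m Bj j = x - F j.
  by rewrite xF /Bj (row_cap_frame km uLt (lt0r_neq0 s0) (LS _ Fjr) hP (Snull _ _ Fjr wjH)).
have phiE : phi x - phi (F j) = tau + ((x - F j) *m grad phi (F j)) 0 0.
  have lin (p q : 'rV[R]_m) (g : 'cV[R]_m) :
      ((p + q) *m g) 0 0 = (p *m g) 0 0 + (q *m g) 0 0 by rewrite mulmxDl mxE.
  by rewrite xF lin /tau gradj phij; ring.
have s20 : s ^+ 2 != 0 by rewrite expf_neq0 ?lt0r_neq0.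
exists j, (row_mx (tau / s ^+ 2)%:M th); split.
  apply: mx_norm_le => [|i0 i]; first exact: ltW.
  have s2 : 0 < s ^+ 2 by exact: exprn_gt0.
  rewrite mxE; case: splitP => i' _.
    rewrite ord1 ord1 mxE mulr1n normrM normfV (gtr0_norm s2) ler_pdivrMr//.
    by apply: le_trans tle _; rewrite mulrC; exact: (ler_wpM2r (ltW s2) C1).
  apply: le_trans (mx_coord_le _ _ _) _; apply: le_trans (ler_normD _ _) _.
  apply: le_trans C2; apply: lerD; last exact: mulmx_le.
  by rewrite normrZ normfV (gtr0_norm s0) ler_pdivrMl.
rewrite /Q mul_row_block mulmx0 add0r mulmxA thB; congr row_mx.
rewrite -scalar_mxM divfK// phiE.
apply/matrixP => i i'; rewrite !ord1 [in LHS]mxE [in RHS]mxE [in RHS]mxE !mulr1n.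
by [].
Qed.

End caps.

(** * Integration over row vectors *)

Section monotone.
Local Open Scope ereal_scope.
Context d (T : measurableType d) (R : realType) (mu : {measure set T -> \bar R}).

(** The integral of a nonnegative function is a supremum over the simple
    functions below it, hence is monotone whatever the measurability of f and g:
    moduli of Fourier transforms can be compared with it directly. *)
Lemma le_lower_integral (A D : set T) (f g : T -> \bar R) :
  A `<=` D -> (forall x, A x -> 0 <= f x <= g x) -> (forall x, D x -> 0 <= g x) ->
  \int[mu]_(x in A) f x <= \int[mu]_(x in D) g x.
Proof.
move=> AD fg g0; rewrite !ge0_integralE//; last by move=> x /fg/andP[].
apply: le_ereal_sup => _ [h hf <-]; exists h => // x.
apply: le_trans (hf x) _; rewrite !patchE.
case: ifPn => xA; last by case: ifPn => // xD; apply: g0; rewrite inE in xD.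
rewrite inE in xA; have /andP[_ h2] := fg _ xA.
by rewrite ifT// inE; exact: AD.
Qed.

End monotone.

Section open_measurable.
Variables (R : realType) (n : nat).

(** The sigma-algebra is generated by the coordinates, so it contains the boxes,
    and an open set is a countable union of rational boxes. *)
Lemma open_measurable_rV (A : set 'rV[R]_n) : open A -> measurable A.
Proof.
move=> oA.
(* boxes with rational centers and radii 1 / (k + 1) *)
pose B (q : 'rV[rat]_n * nat) : set 'rV[R]_n := \bigcap_(i in [set: 'I_n])
  [set y | y 0 i \in `]ratr (q.1 0 i) - q.2.+1%:R^-1, ratr (q.1 0 i) + q.2.+1%:R^-1[].
have mB q : measurable (B q).
  apply: fin_bigcap_measurable => // i _.
  have := @measurable_coord R 1 n 0 i measurableT _
    (measurable_itv `]ratr (q.1 0 i) - q.2.+1%:R^-1, ratr (q.1 0 i) + q.2.+1%:R^-1[).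
  by rewrite setTI.
have -> : A = \bigcup_q (if `[< B q `<=` A >] then B q else set0).
  apply/seteqP; split => [x Ax|x [q _]]; last first.
    by case: ifPn => // /asboolP qA; exact: qA.
  have /nbhs_ballP[r /= r0 rA] : nbhs x A by apply: open_nbhs_nbhs.
  have [k] := ltr_add_invr (divr_gt0 r0 (ltr0n R 2)); rewrite add0r => kr.
  have k0 : 0 < k.+1%:R^-1 :> R by rewrite invr_gt0.
  have /choice[q hq] : forall i : 'I_n, exists q : rat,
      ratr q \in `]x 0 i - k.+1%:R^-1, x 0 i + k.+1%:R^-1[.
    move=> i; apply: rat_in_itvoo; move: (k.+1%:R^-1) k0 => e e0; lra.
  exists (\row_i q i, k) => //; rewrite ifT.
    move=> i _ /=; rewrite mxE in_itv /=; have := hq i; rewrite in_itv /= => /andP[h1 h2].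
    by move: (k.+1%:R^-1) h1 h2 => e h1 h2; apply/andP; split; lra.
  apply/asboolP => y /= By; apply: rA; rewrite -ball_normE /=.
  apply: (@le_lt_trans _ _ (2 * k.+1%:R^-1)); last by move: (k.+1%:R^-1) kr => e; lra.
  apply: mx_norm_le => [|a i]; first by rewrite mulr_ge0// ltW.
  rewrite ord1 !mxE; have := By i I; have := hq i; rewrite /= mxE !in_itv /=.
  move=> /andP[h1 h2] /andP[h3 h4].
  move: (k.+1%:R^-1) h1 h2 h3 h4 => e h1 h2 h3 h4.
  by rewrite ler_norml; apply/andP; split; lra.
apply: countable_bigcupT_measurable => [|q]; first exact: countableP.
by case: ifP.
Qed.

Lemma closed_measurable_rV (A : set 'rV[R]_n) : closed A -> measurable A.
Proof.
move=> cA; rewrite -[A]setCK; apply: measurableC; apply: open_measurable_rV.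
exact: closed_openC.
Qed.

End open_measurable.

Section affine_line.
Variable R : realType.
Local Notation mu := (@lebesgue_measure R).
Local Open Scope ereal_scope.

Lemma measurable_affine (c a : R) :
  measurable_fun setT (fun t : measurableTypeR R => c * t + a : measurableTypeR R)%R.
Proof.
by apply: measurable_funD => //; apply: measurable_funM.
Qed.

(** Both sides are measures that agree on half-open intervals. *)
Lemma lebesgue_affine (c a : R) (A : set (measurableTypeR R)) : c != 0%R -> measurable A ->
  mu ((fun t => c * t + a)%R @^-1` A) = (`|c|^-1)%:E * mu A.
Proof.
move=> c0 mA.
have cp : (0 < `|c|)%R by rewrite normr_gt0.
pose pf : {measure set (measurableTypeR R) -> \bar R} :=
  measure_function.measure_function_pushforward__canonical__measure_function_Measure
    mu (measurable_affine c a).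
pose nu : {measure set (measurableTypeR R) -> \bar R} := mscale (NngNum (ltW cp)) pf.
have E : mu A = nu A.
  apply: lebesgue_measure_unique => // _ [[x y] _ <-] /=.
  rewrite /mscale /= /pushforward lebesgue_measure_itv /= lte_fin.
  have [cpos|cneg] := ltP 0%R c.
    rewrite (_ : _ @^-1` _ = `]((x - a) / c)%R, ((y - a) / c)%R]%classic); last first.
      apply/seteqP; split => t /=; rewrite !in_itv /= ltr_pdivrMr// ler_pdivlMr//;
        by rewrite (mulrC t) ltrBlDr lerBrDr.
    rewrite lebesgue_measure_itv /= lte_fin ltr_pM2r ?invr_gt0// ltrD2r.
    case: ifP => _; last by rewrite mule0.
    by rewrite -!EFinD -EFinM gtr0_norm//; congr EFin; field; rewrite gt_eqF.
  have {}cneg : (c < 0)%R by rewrite lt_def eq_sym c0.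
  rewrite (_ : _ @^-1` _ = `[((y - a) / c)%R, ((x - a) / c)%R[%classic); last first.
    apply/seteqP; split => t /=; rewrite !in_itv /= ler_ndivrMr// ltr_ndivlMr//;
      by rewrite (mulrC t) ltrBlDr lerBrDr andbC.
  rewrite lebesgue_measure_itv /= lte_fin ltr_nM2r ?invr_lt0// ltrD2r.
  case: ifP => _; last by rewrite mule0.
  by rewrite -!EFinD -EFinM ltr0_norm//; congr EFin; field; rewrite lt_eqF.
rewrite E /nu /mscale /= muleA -EFinM mulVf ?mul1e//.
by rewrite gt_eqF.
Qed.

Lemma integral_affine (c a : R) (f : R -> \bar R) : c != 0%R ->
  measurable_fun setT f -> (forall x, 0 <= f x) ->
  \int[mu]_t f (c * t + a)%R = (`|c|^-1)%:E * \int[mu]_t f t.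
Proof.
move=> c0 mf f0.
have cp : (0 <= `|c|^-1)%R by rewrite invr_ge0.
have := @ge0_integral_pushforward _ _ (measurableTypeR R) (measurableTypeR R) R _
  (measurable_affine c a) mu setT f measurableT mf (fun x _ => f0 x).
rewrite preimage_setT => <-.
rewrite -(ge0_integral_mscale mu measurableT (NngNum cp))//.
apply: eq_measure_integral; first exact: measurable_affine.
by move=> mphi A mA _; exact: (lebesgue_affine a c0 mA).
Qed.

End affine_line.

Section rV_integral.
Variable R : realType.
Local Notation mu1 := (@lebesgue_measure R).
Local Open Scope ereal_scope.

Section fubini.
Variables (n : nat) (F : 'rV[R]_n.+1 -> \bar R).
Hypotheses (mF : measurable_fun setT F) (F0 : forall x, 0 <= F x).

Lemma measurable_comp_cons :
  measurable_fun setT (fun p : measurableTypeR R * 'rV[R]_n => F (cons_rV p)).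
Proof. by apply: measurableT_comp mF _; exact: measurable_cons_rV. Qed.

Lemma integral_consE : \int[lebesgue_rV n.+1]_x F x =
  \int[mu1 \x lebesgue_rV n]_p F (cons_rV p).
Proof.
have := ge0_integral_pushforward (@measurable_cons_rV R n)
  (mu1 \x lebesgue_rV n)%E measurableT mF (fun x _ => F0 x).
by rewrite preimage_setT => <-.
Qed.

Lemma integral_cons : \int[lebesgue_rV n.+1]_x F x =
  \int[mu1]_t \int[lebesgue_rV n]_y F (cons_rV (t, y)).
Proof.
rewrite integral_consE.
by rewrite (fubini_tonelli1 _ measurable_comp_cons (fun p => F0 (cons_rV p))).
Qed.

Lemma integral_cons_swap : \int[lebesgue_rV n.+1]_x F x =
  \int[lebesgue_rV n]_y \int[mu1]_t F (cons_rV (t, y)).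
Proof.
rewrite integral_consE.
by rewrite (fubini_tonelli2 _ measurable_comp_cons (fun p => F0 (cons_rV p))).
Qed.

Lemma measurable_integral_cons :
  measurable_fun setT (fun t => \int[lebesgue_rV n]_y F (cons_rV (t, y))).
Proof.
exact: (measurable_fun_fubini_tonelli_F _ measurable_comp_cons (fun p => F0 (cons_rV p))).
Qed.

End fubini.

Lemma measurable_mulmx m n (A : 'M[R]_(m, n)) :
  measurable_fun setT (fun x : 'rV[R]_m => x *m A).
Proof.
apply: measurable_matrix_fun => i j.
apply: (eq_measurable_fun (fun x : 'rV[R]_m => (\sum_l x i l * A l j)%R)).
  by move=> x _; rewrite mxE.
apply: measurable_sum => l; apply: measurable_funM => //.
exact: measurable_coord.
Qed.

Lemma measurable_addmx n (a : 'rV[R]_n) :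
  measurable_fun setT (fun x : 'rV[R]_n => (x + a)%R).
Proof.
apply: measurable_matrix_fun => i j.
apply: (eq_measurable_fun (fun x : 'rV[R]_n => (x i j + a i j)%R)).
  by move=> x _; rewrite mxE.
by apply: measurable_funD => //; exact: measurable_coord.
Qed.

Lemma cons_rVD n (t s : R) (y z : 'rV[R]_n) :
  (cons_rV (t, y) + cons_rV (s, z))%R = cons_rV ((t + s)%R, (y + z)%R).
Proof.
apply: etrans (add_row_mx (t%:M : 'rV[R]_1) y s%:M z) _.
by rewrite /cons_rV /= raddfD.
Qed.

Lemma cons_rV_surj n (x : 'rV[R]_n.+1) : x = cons_rV (uncons_rV x).
Proof.
apply: etrans (esym (@hsubmxK R 1 1 n x)) _.
rewrite /cons_rV /uncons_rV /=; congr (row_mx _ _).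
apply/matrixP => i j; rewrite !ord1 !mxE eqxx mulr1n; congr (x _ _).
exact/val_inj.
Qed.

Lemma integral_translate n (a : 'rV[R]_n) (F : 'rV[R]_n -> \bar R) :
  measurable_fun setT F -> (forall x, 0 <= F x) ->
  \int[lebesgue_rV n]_x F (x + a)%R = \int[lebesgue_rV n]_x F x.
Proof.
elim: n a F => [|n IH] a F mF F0.
  by apply: eq_integral => x _; congr F; apply/rowP => -[].
apply: etrans (integral_cons (measurableT_comp mF (measurable_addmx a)) _) _.
  by move=> x; exact: F0.
apply: (etrans _ (esym (integral_cons mF F0))).
rewrite (cons_rV_surj a); case: (uncons_rV a) => s b.
have mG := measurable_integral_cons mF F0.
transitivity (\int[mu1]_t (fun t => \int[lebesgue_rV n]_y F (cons_rV (t, y))) (1 * t + s)%R).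
  apply: eq_integral => t _; rewrite mul1r.
  rewrite -(IH b (fun y => F (cons_rV ((t + s)%R, y))))//.
    by apply: eq_integral => y _; rewrite -cons_rVD.
  exact: (measurable_fun_pair2 _ (measurable_comp_cons mF)).
apply: etrans (integral_affine s (oner_neq0 R) mG _) _.
  by move=> t; apply: integral_ge0.
by rewrite normr1 invr1 mul1e.
Qed.

(** * Linear change of variables *)

(** The matrices satisfying the change of variables formula are closed under
    products, so that triangular factorizations reach all invertible ones. *)
Definition scales_integral n (A : 'M[R]_n) := forall F : 'rV[R]_n -> \bar R,
  measurable_fun setT F -> (forall x, 0 <= F x) ->
  \int[lebesgue_rV n]_x F (x *m A) = (`|\det A|^-1)%:E * \int[lebesgue_rV n]_x F x.

Lemma scales_integral_mul n (A B : 'M[R]_n) : scales_integral A -> scales_integral B -> scales_integral (A *m B).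
Proof.
move=> cA cB F mF F0.
transitivity (\int[lebesgue_rV n]_x (fun y => F (y *m B)) (x *m A)).
  by apply: eq_integral => x _; rewrite mulmxA.
apply: etrans (cA (fun y => F (y *m B)) _ (fun x => F0 _)) _.
  exact: measurableT_comp mF (measurable_mulmx B).
by rewrite cB// det_mulmx normrM invfM EFinM muleA.
Qed.

Lemma mul_cons_rV n (t : R) (y : 'rV[R]_n) (a : R) r c (D : 'M[R]_n) :
  cons_rV (t, y) *m (block_mx a%:M r c D : 'M[R]_(1 + n)) =
  cons_rV ((a * t + (y *m c) 0 0)%R, (y *m D + t *: r)%R).
Proof.
apply: (etrans (@mul_row_block R 1 1 n 1 n t%:M y a%:M r c D)).
rewrite /cons_rV /=; congr (row_mx _ _); last by rewrite mul_scalar_mx addrC.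
apply/matrixP => i j; rewrite !ord1 -scalar_mxM [LHS]mxE [RHS]mxE.
by rewrite [X in (X + _)%R = _]mxE eqxx !mulr1n mulrC.
Qed.

(** Integrating over the tail first, the row r is a translation and D acts
    alone; the pivot a rescales the line of the head. *)
Lemma scales_integral_upper n (a : R) (r : 'rV[R]_n) (D : 'M[R]_n) : a != 0%R -> scales_integral D ->
  scales_integral (block_mx a%:M r 0 D : 'M[R]_(1 + n)).
Proof.
move=> a0 cD F mF F0.
have mG := measurable_integral_cons mF F0.
apply: etrans (integral_cons (measurableT_comp mF (measurable_mulmx _)) (fun x => F0 _)) _.
rewrite /=.
transitivity (\int[mu1]_t ((`|\det D|^-1)%:E *
    (fun t => \int[lebesgue_rV n]_y F (cons_rV (t, y))) (a * t + 0)%R)).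
  apply: eq_integral => t _; rewrite addr0.
  have mH : measurable_fun setT (fun y : 'rV[R]_n => F (cons_rV ((a * t)%R, y))).
    exact: (measurable_fun_pair2 _ (measurable_comp_cons mF)).
  rewrite -(integral_translate (t *: r) mH)//.
  rewrite -(cD (fun y => F (cons_rV ((a * t)%R, (y + t *: r)%R))))//.
    by apply: eq_integral => y _; rewrite mul_cons_rV mulmx0 mxE addr0.
  exact: measurableT_comp mH (measurable_addmx _).
rewrite ge0_integralZl//; last 2 first.
- exact: measurableT_comp mG (measurable_affine a 0).
- by move=> t _; apply: integral_ge0.
rewrite (integral_affine 0 a0 mG); last by move=> t; apply: integral_ge0.
rewrite -(integral_cons mF F0) muleA -EFinM.
by rewrite (@det_ublock _ 1 n) det_scalar1 normrM invfM mulrC.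
Qed.

(** Integrating over the head first, the column c is a translation. *)
Lemma scales_integral_lower n (c : 'cV[R]_n) : scales_integral (block_mx 1%:M 0 c 1%:M : 'M[R]_(1 + n)).
Proof.
move=> F mF F0.
apply: etrans (integral_cons_swap (measurableT_comp mF (measurable_mulmx _)) (fun x => F0 _)) _.
rewrite /= (@det_lblock _ 1 n) !det1 mulr1 normr1 invr1 mul1e.
apply: (etrans _ (esym (integral_cons_swap mF F0))).
apply: eq_integral => y _.
have mH : measurable_fun setT (fun t : measurableTypeR R => F (cons_rV (t, y))).
  exact: (measurable_fun_pair1 _ (measurable_comp_cons mF)).
have := integral_affine ((y *m c) 0 0)%R (oner_neq0 R) mH (fun t => F0 _).
rewrite normr1 invr1 mul1e => <-; apply: eq_integral => t _.
by rewrite mul_cons_rV mulmx1 scaler0 addr0.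
Qed.

Local Close Scope ereal_scope.

(** By induction on the size, with a block triangular factorization when the
    upper left entry is nonzero. *)
Lemma linear_change_of_variables n (A : 'M[R]_n) : A \in unitmx -> scales_integral A.
Proof.
elim: n A => [|n IH] A uA.
  move=> F mF F0; rewrite det_mx00 normr1 invr1 mul1e.
  by apply: eq_integral => x _; congr F; apply/rowP => -[].
have pivot (B : 'M[R]_(1 + n)) : B \in unitmx -> B 0 0 != 0%R -> scales_integral B.
  move=> uB B0; pose a := B 0 0.
  have aE : ulsubmx B = a%:M.
    by apply/matrixP => i j; rewrite !ord1 !mxE mulr1n; congr (B _ _); exact/val_inj.
  pose S := (drsubmx B - dlsubmx B *m (a^-1 *: ursubmx B))%R.
  have BE : B = (block_mx 1%:M 0 (a^-1 *: dlsubmx B) 1%:M : 'M[R]_(1 + n)) *m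
                (block_mx a%:M (ursubmx B) 0 S : 'M[R]_(1 + n)).
    rewrite mulmx_block !mul1mx !mul0mx !addr0 -[LHS]submxK aE.
    congr block_mx; first by rewrite -scalemxAl mul_mx_scalar scalerA mulVf// scale1r.
    by rewrite -scalemxAl scalemxAr addrC subrK.
  have uS : S \in unitmx.
    move: uB; rewrite !unitmxE {1}BE det_mulmx (@det_ublock _ 1 n) => /unitrPr[x hx].
    rewrite unitfE; apply: contra_eqN hx => /eqP ->.
    by rewrite !mulr0 mul0r eq_sym oner_eq0.
  rewrite BE; apply: scales_integral_mul; first exact: scales_integral_lower.
  by apply: scales_integral_upper => //; exact: IH.
have [A0|] := eqVneq (A 0 0) 0%R; last exact: pivot.
(* a vanishing corner becomes the squared length of the rest of the first row *)
pose r := ursubmx (A : 'M[R]_(1 + n)).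
pose L (c : 'cV[R]_n) := block_mx 1%:M 0 c 1%:M : 'M[R]_(1 + n).
have uL c : L c \in unitmx by rewrite unitmxE (@det_lblock _ 1 n) !det1 mulr1 unitr1.
have LL c : L c *m L (- c) = 1%:M.
  by rewrite /L mulmx_block !(mul1mx, mul0mx, mulmx1, mulmx0, addr0, add0r) subrr -scalar_mx_block.
have LK : A = (A *m L r^T) *m L (- r^T).
  by rewrite -(mulmxA (A : 'M[R]_(1 + n))) LL mulmx1.
rewrite LK; apply: scales_integral_mul; last exact: scales_integral_lower.
apply: pivot; first by rewrite unitmx_mul uA uL.
have E0 : (A *m L r^T) 0 0 = \sum_j r 0 j ^+ 2.
  have -> : (A *m L r^T) 0 0 = ((A : 'M[R]_(1 + n)) *m L r^T) (lshift n 0) (lshift n 0).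
    by congr fun_of_matrix; exact/val_inj.
  rewrite -{1}(@submxK R 1 n 1 n A) /L mulmx_block block_mxEul !mulmx1 -/r.
  rewrite mxE [X in X + _](_ : _ = 0) ?add0r.
    by rewrite mxE; apply: eq_bigr => j _; rewrite [r^T _ _]mxE -expr2.
  by rewrite !mxE -[RHS]A0; congr fun_of_matrix; exact/val_inj.
rewrite E0 psumr_eq0; last by move=> j _; exact: sqr_ge0.
apply/negP => /allP r0.
have rowA : row 0 A = 0.
  apply/rowP => j; rewrite !mxE; case: (split_ordP (j : 'I_(1 + n))) => l ->.
    by rewrite -[RHS]A0; congr (A _ _); rewrite ord1; exact/val_inj.
  have := r0 l; rewrite mem_index_enum sqrf_eq0 => /(_ isT)/eqP.
  move=> rl; apply: etrans rl; rewrite 2![RHS]mxE.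
  by congr fun_of_matrix; exact/val_inj.
have : (delta_mx 0 0 : 'rV[R]_n.+1) = 0.
  by rewrite -(mulmxK uA (delta_mx 0 0)) -rowE rowA mul0mx.
by move=> /rowP/(_ 0); rewrite !mxE !eqxx => /eqP; rewrite oner_eq0.
Qed.

End rV_integral.

(** * Gaussian integrals *)

Section gaussian.
Variable R : realType.

Definition sqn n (z : 'rV[R]_n) : R := \sum_i z 0 i ^+ 2.
Definition gauss n (z : 'rV[R]_n) : R := expR (- sqn z).

Lemma sqn_ge0 n (z : 'rV[R]_n) : 0 <= sqn z.
Proof. by apply: sumr_ge0 => i _; exact: sqr_ge0. Qed.

Lemma gauss_gt0 n (z : 'rV[R]_n) : 0 < gauss z.
Proof. exact: expR_gt0. Qed.

Lemma gauss_ge0 n (z : 'rV[R]_n) : 0 <= gauss z.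
Proof. exact: expR_ge0. Qed.

Lemma gauss_le1 n (z : 'rV[R]_n) : gauss z <= 1.
Proof. by rewrite /gauss -expR0 ler_expR oppr_le0 sqn_ge0. Qed.

Lemma measurable_sqn n : measurable_fun setT (@sqn n).
Proof.
apply: measurable_sum => i; apply: measurable_funX; exact: measurable_coord.
Qed.

Lemma measurable_gauss n : measurable_fun setT (@gauss n).
Proof.
apply: measurableT_comp; first exact: measurable_expR.
by apply: measurable_funN; exact: measurable_sqn.
Qed.

Lemma sqn_cons n (t : R) (y : 'rV[R]_n) : sqn (cons_rV (t, y)) = t ^+ 2 + sqn y.
Proof.
rewrite /sqn big_ord_recl; congr (_ ^+ 2 + _).
  by have := congr1 fst (cons_rVK (t, y)).
apply: eq_bigr => i _; congr (_ ^+ 2).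
have /rowP/(_ i) := congr1 snd (cons_rVK (t, y)); rewrite /= mxE => <-.
by congr fun_of_matrix; exact/val_inj.
Qed.

Lemma integral_gauss n :
  (\int[lebesgue_rV n]_z (gauss z)%:E)%E = (Num.sqrt pi ^+ n)%:E.
Proof.
have mE k : measurable_fun setT (fun z : 'rV[R]_k => (gauss z)%:E).
  by apply/measurable_EFinP; exact: measurable_gauss.
elim: n => [|n IH].
  rewrite /= (@eq_integral _ _ _ _ _ (cst 1%E)); last first.
    by move=> z _; rewrite /gauss /sqn big_ord0 oppr0 expR0.
  by rewrite integral_cst//= diracT mule1.
rewrite integral_cons//; last by move=> x; rewrite lee_fin gauss_ge0.
transitivity (\int[@lebesgue_measure R]_t ((Num.sqrt pi ^+ n)%:E * (gauss_fun t)%:E)%E)%E.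
  apply: eq_integral => t _; rewrite -IH muleC -ge0_integralZl//.
  - apply: eq_integral => y _; rewrite -EFinM; congr EFin.
    by rewrite /gauss sqn_cons opprD expRD.
  - exact: mE.
  - by move=> y _; rewrite lee_fin gauss_ge0.
  - by rewrite lee_fin gauss_fun_ge0.
rewrite ge0_integralZl//.
- by rewrite integralT_gauss -EFinM exprSr.
- by apply/measurable_EFinP; exact: measurable_gauss_fun.
- by move=> t _; rewrite lee_fin gauss_fun_ge0.
Qed.

Lemma cos_ge_linear (u : R) : 1 - `|u| <= cos u.
Proof.
suff H (v : R) : 0 <= v -> 1 - v <= cos v.
  have := H _ (normr_ge0 u); have [u0|u0] := leP 0 u.
    by rewrite (ger0_norm u0).
  by rewrite (ltr0_norm u0) cosN.
move=> v0.
have cc (a b : R) : {within `[a, b], continuous (@cos R)}.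
  by apply: continuous_subspaceT => c; exact: continuous_cos.
have [c _ E] := @MVT_segment R cos (fun c => - sin c) 0 v v0
  (fun c _ => is_derive_cos c) (cc _ _).
rewrite cos0 subr0 in E.
have : - v <= - sin c * v.
  by rewrite -mulN1r ler_wpM2r// lerN2 sin_le1.
lra.
Qed.

Section wave.
Variables (n : nat) (A : 'M[R]_n).
Hypothesis uA : A \in unitmx.
Local Notation leb := (lebesgue_rV n).
Local Notation kap := (Num.sqrt pi ^+ n : R).

Lemma measurable_gaussmx (B : 'M[R]_n) :
  measurable_fun setT (fun x : 'rV[R]_n => gauss (x *m B)).
Proof. exact: measurableT_comp (@measurable_gauss n) (measurable_mulmx B). Qed.

Lemma integral_gaussmx (B : 'M[R]_n) : B \in unitmx ->
  (\int[leb]_x (gauss (x *m B))%:E)%E = (kap / `|\det B|)%:E.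
Proof.
move=> uB.
rewrite (linear_change_of_variables uB (F := fun z => (gauss z)%:E)).
- by rewrite integral_gauss -EFinM mulrC.
- by apply/measurable_EFinP; exact: measurable_gauss.
- by move=> x; rewrite lee_fin gauss_ge0.
Qed.

Lemma integrable_gaussmx (B : 'M[R]_n) : B \in unitmx ->
  leb.-integrable setT (EFin \o (fun x : 'rV[R]_n => gauss (x *m B))).
Proof.
move=> uB; apply/integrableP; split.
  by apply/measurable_EFinP; exact: measurable_gaussmx.
under eq_integral do rewrite /= ger0_norm ?gauss_ge0//.
by rewrite integral_gaussmx// ltry.
Qed.

Lemma Rintegral_gaussmx (B : 'M[R]_n) : B \in unitmx ->
  \int[leb]_x gauss (x *m B) = kap / `|\det B|.
Proof. by move=> uB; rewrite /Rintegral integral_gaussmx. Qed.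

Lemma integrable_wave (h : 'rV[R]_n -> R) : measurable_fun setT h ->
  (forall x, `|h x| <= 1) ->
  leb.-integrable setT (EFin \o (fun x : 'rV[R]_n => gauss (x *m A) * h x)).
Proof.
move=> mh h1; apply: le_integrable (integrable_gaussmx uA) => //.
  apply/measurable_EFinP; apply: measurable_funM => //.
  exact: measurable_gaussmx.
move=> x _; rewrite /= lee_fin normrM ler_piMr//.
Qed.

(** The factor of the phase is absorbed by a wider Gaussian: expR (3 t ^ 2 / 4)
    dominates 1 + 3 t ^ 2 / 4, hence t. *)
Lemma norm_gauss_le (z : 'rV[R]_n) : `|z| * gauss z <= gauss (z *m (2^-1)%:M).
Proof.
have -> : gauss (z *m (2^-1)%:M) = expR (3 / 4 * sqn z) * gauss z.
  rewrite /gauss -expRD; congr expR.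
  have -> : sqn (z *m (2^-1)%:M) = sqn z / 4.
    rewrite /sqn mulr_suml; apply: eq_bigr => i _.
    by rewrite mul_mx_scalar mxE exprMn mulrC; congr (_ * _); field.
  by field.
rewrite ler_wpM2r ?gauss_ge0//; apply: mx_norm_le => [|i j]; first exact: expR_ge0.
rewrite ord1 (@le_trans _ _ (1 + 3 / 4 * sqn z))// ?expR_ge1Dx//.
apply: (@le_trans _ _ (1 + 3 / 4 * z 0 j ^+ 2)).
  rewrite -(real_normK (num_real (z 0 j))); move: `|z 0 j| => t.
  have := sqr_ge0 (t - 2 / 3); rewrite sqrrB; lra.
rewrite lerD2l ler_wpM2l ?divr_ge0// /sqn (bigD1 j)//= lerDl sumr_ge0// => l _.
exact: sqr_ge0.
Qed.

(** Radius of the frequency window in which a packet keeps half of its peak: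
    with the mass 2 ^ n of the wider Gaussian and the Lipschitz constant
    2 * pi * n of the phase, the loss stays below one half. *)
Definition osc_const : R := (4 * pi * (n%:R + 1) * 2 ^+ n)^-1.

Lemma osc_const_gt0 : 0 < osc_const.
Proof. by rewrite invr_gt0 !mulr_gt0 ?pi_gt0 ?ltr_wpDl ?exprn_gt0. Qed.

Lemma measurable_dotmul (y : 'rV[R]_n) : measurable_fun setT (fun x => dotmul x y).
Proof.
apply: measurable_sum => i; apply: measurable_funM => //.
exact: measurable_coord.
Qed.

Lemma measurable_coswave (eta : 'rV[R]_n) :
  measurable_fun setT (fun x => cos (2 * pi * dotmul x eta)).
Proof.
apply: measurableT_comp; first by apply: continuous_measurable_fun; exact: continuous_cos.
by apply: measurable_funM => //; exact: measurable_dotmul.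
Qed.

Lemma integrable_coswave (eta : 'rV[R]_n) : leb.-integrable setT
  (EFin \o (fun x : 'rV[R]_n => gauss (x *m A) * cos (2 * pi * dotmul x eta))).
Proof.
apply: integrable_wave; first exact: measurable_coswave.
by move=> x; exact: cos_max.
Qed.

(** The integral is the Fourier transform of a Gaussian at a frequency within the
    window adapted to A: there the phase stays small on the bulk of the
    Gaussian, and cos t >= 1 - |t| with the error controlled by norm_gauss_le
    shows that no cancellation occurs. *)
Lemma coswave_ge (eta theta : 'rV[R]_n) : eta = theta *m A^T ->
  `|theta| <= osc_const ->
  kap / `|\det A| / 2 <= \int[leb]_x (gauss (x *m A) * cos (2 * pi * dotmul x eta)).
Proof.
move=> etaE th.
pose B := A *m (2^-1)%:M.
have detB : \det B = \det A * 2^-1 ^+ n by rewrite det_mulmx det_scalar.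
have uB : B \in unitmx.
  by rewrite unitmxE detB unitrM -unitmxE uA unitrX// unitfE invr_eq0.
pose c := 2 * pi * (n%:R * osc_const).
have c0 : 0 <= c by rewrite !mulr_ge0 ?pi_ge0// ltW// osc_const_gt0.
have low x : gauss (x *m A) - c * gauss (x *m B) <=
    gauss (x *m A) * cos (2 * pi * dotmul x eta).
  have dE : dotmul x eta = ((x *m A) *m theta^T) 0 0.
    rewrite etaE -[A in RHS]trmxK -mulmxA -trmx_mul mxE.
    by apply: eq_bigr => i _; rewrite [_^T _ _]mxE.
  have d1 : `|2 * pi * dotmul x eta| <= c * `|x *m A|.
    rewrite normrM ger0_norm ?mulr_ge0 ?pi_ge0// /c -mulrA ler_wpM2l ?mulr_ge0 ?pi_ge0//.
    rewrite dE (le_trans (mx_coord_le _ _ _))//.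
    have tt : `|theta^T| <= osc_const.
      apply: mx_norm_le => [|i j]; first exact: ltW osc_const_gt0.
      by rewrite mxE (le_trans (mx_coord_le _ _ _)).
    apply: le_trans (mulmx_le (lexx _) tt) _.
    by rewrite le_eqVlt; apply/orP; left; apply/eqP; ring.
  have := norm_gauss_le (x *m A); rewrite -mulmxA -/B => h.
  have h2 := cos_ge_linear (2 * pi * dotmul x eta).
  have g0 := gauss_ge0 (x *m A).
  apply: (@le_trans _ _ (gauss (x *m A) * (1 - c * `|x *m A|))); last first.
    by rewrite ler_wpM2l//; lra.
  rewrite mulrBr mulr1 lerD2l lerN2 mulrCA ler_wpM2l//.
  by rewrite mulrC.
have iB : leb.-integrable setT (EFin \o (fun x : 'rV[R]_n => c * gauss (x *m B))).
  apply: (@eq_integrable _ _ _ _ _ measurableT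
     (fun x => c%:E * (EFin \o (fun x : 'rV[R]_n => gauss (x *m B))) x)%E) => //.
  by apply: integrableZl => //; exact: integrable_gaussmx.
have iAB : leb.-integrable setT (EFin \o (fun x : 'rV[R]_n => gauss (x *m A) - c * gauss (x *m B))).
  apply: (@eq_integrable _ _ _ _ _ measurableT
    (fun x => ((gauss (x *m A))%:E - (c * gauss (x *m B))%R%:E)%E)) => //.
  exact: (integrableB measurableT (integrable_gaussmx uA) iB).
apply: le_trans (le_Rintegral measurableT iAB (integrable_coswave eta) (fun x _ => low x)).
rewrite RintegralB//; last exact: integrable_gaussmx.
rewrite RintegralZl//; last exact: integrable_gaussmx.
rewrite !Rintegral_gaussmx// detB normrM invfM.
rewrite (ger0_norm (exprn_ge0 _ _))// exprVn invrK.
have c2 : c * 2 ^+ n <= 2^-1.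
  have p0 := pi_gt0 R.
  have e0 : 0 < 2 ^+ n :> R by exact: exprn_gt0.
  have -> : c * 2 ^+ n = 2^-1 * (n%:R / (n%:R + 1)).
    have n0 : n%:R + 1 != 0 :> R by rewrite gt_eqF// ltr_wpDl.
    rewrite /c /osc_const; move: (2 ^+ n) e0 (pi : R) p0 n0 => E e0 q q0 n0.
    field; rewrite n0 !gt_eqF//=.
  by rewrite ler_piMr// ler_pdivrMr ?ltr_wpDl// mul1r lerDl.
have k0 : 0 <= kap / `|\det A|.
  by rewrite divr_ge0// exprn_ge0// sqrtr_ge0.
have -> : c * (kap * (`|\det A|^-1 * 2 ^+ n)) = kap / `|\det A| * (c * 2 ^+ n) by ring.
rewrite -[X in X - _]mulr1 -mulrBr ler_wpM2l//; lra.
Qed.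

(** The wave packet transform is measurable in the frequency, by Tonelli's
    theorem applied to the nonnegative integrand with 1 + cos. *)
Lemma measurable_coswave_freq (y : 'rV[R]_n) : measurable_fun setT
  (fun xi : 'rV[R]_n => \int[leb]_x (gauss (x *m A) * cos (2 * pi * dotmul x (y - xi)))).
Proof.
pose F (p : 'rV[R]_n * 'rV[R]_n) : \bar R :=
  (gauss (p.2 *m A) * (1 + cos (2 * pi * dotmul p.2 (y - p.1))))%:E.
have F0 : forall p, (0 <= F p)%E.
  move=> [xi x]; rewrite /F lee_fin; apply: mulr_ge0; first exact: gauss_ge0.
  have := cos_geN1 (2 * pi * dotmul x (y - xi)).
  by rewrite -subr_ge0 opprK addrC.
have mF : measurable_fun setT F.
  apply/measurable_EFinP; apply: measurable_funM.
    exact: measurableT_comp (measurable_gaussmx A) measurable_snd.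
  apply: measurable_funD => //; apply: measurableT_comp.
    by apply: continuous_measurable_fun; exact: continuous_cos.
  apply: measurable_funM => //; apply: measurable_sum => i.
  apply: measurable_funM.
    exact: measurableT_comp (measurable_coord 0 i) measurable_snd.
  apply: (eq_measurable_fun (fun p : 'rV[R]_n * 'rV[R]_n => y 0 i - p.1 0 i)).
    by move=> p _; rewrite !mxE.
  apply: measurable_funB => //.
  exact: measurableT_comp (measurable_coord 0 i) measurable_fst.
have := measurable_fun_fubini_tonelli_F (m2 := leb) F mF F0 => mG.
apply: (eq_measurable_fun (fun xi => fine (fubini_F leb F xi) - kap / `|\det A|)).
  move=> xi _; rewrite -(Rintegral_gaussmx uA) /fubini_F -/(Rintegral _ _ _).
  rewrite -RintegralB//.
  - by apply: eq_Rintegral => x _; rewrite mulrDr mulr1 addrC addKr.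
  - apply: (@eq_integrable _ _ _ _ _ measurableT (fun x : 'rV[R]_n => ((gauss (x *m A))%:E +
      (gauss (x *m A) * cos (2 * pi * dotmul x (y - xi)))%R%:E)%E)) => //.
      by move=> x _; rewrite /= -EFinD; congr EFin; ring.
    exact: (integrableD measurableT (integrable_gaussmx uA) (integrable_coswave (y - xi))).
  - exact: integrable_gaussmx.
by apply: measurable_funB => //; exact: measurableT_comp.
Qed.

End wave.

End gaussian.

(** * Random signs *)

Section random_signs.
Variables (R : realType) (J : finType).
Implicit Types (e : {ffun J -> bool}) (u v : J -> R).

Definition sg (b : bool) : R := if b then 1 else - 1.

Lemma sg2 b : sg b * sg b = 1.
Proof. by case: b; rewrite /sg ?mulr1 ?mulrNN ?mulr1. Qed.

Local Notation N := (#|{ffun J -> bool}|%:R : R).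

Definition flip (j : J) e : {ffun J -> bool} :=
  [ffun l => if l == j then ~~ e l else e l].

Lemma flipK j : involutive (flip j).
Proof.
by move=> e; apply/ffunP => l; rewrite !ffunE; case: (l == j); rewrite //= negbK.
Qed.

(** Independent signs are orthogonal: flipping one sign is an involution that
    changes the sign of the product. *)
Lemma sum_sg2 (j l : J) : \sum_(e : {ffun J -> bool}) sg (e j) * sg (e l) = if j == l then N else 0.
Proof.
case: eqVneq => [->|jl].
  rewrite (eq_bigr (fun=> 1)) ?sumr_const// => e _; exact: sg2.
set S := \sum_(e : {ffun J -> bool}) _.
suff : S = - S by move/eqP; rewrite -addr_eq0 -mulr2n mulrn_eq0 /= => /eqP.
rewrite {1}/S (reindex_inj (inv_inj (flipK j))) /= -sumrN.
apply: eq_bigr => e _; rewrite !ffunE eqxx eq_sym (negPf jl).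
by rewrite /sg; case: (e j) => /=; rewrite ?mulN1r ?mul1r ?opprK.
Qed.

Lemma sum_sg_coef c (j0 : J) : \sum_(e : {ffun J -> bool}) sg (e j0) * (\sum_j sg (e j) * c j) = N * c j0.
Proof.
under eq_bigr do rewrite mulr_sumr.
rewrite exchange_big /= (bigD1 j0)//= [X in _ + X]big1 ?addr0.
  under eq_bigr do rewrite mulrA.
  by rewrite -mulr_suml sum_sg2 eqxx.
move=> j jj0; under eq_bigr do rewrite mulrA.
by rewrite -mulr_suml sum_sg2 eq_sym (negPf jj0) mul0r.
Qed.

(** Averaging against one sign isolates its coefficient: signs cannot make the
    mean of the absolute value smaller than any single term. *)
Lemma sum_sg_norm_ge c (j0 : J) : N * `|c j0| <= \sum_(e : {ffun J -> bool}) `|\sum_j sg (e j) * c j|.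
Proof.
rewrite -[N]ger0_norm// -normrM -sum_sg_coef (le_trans (ler_norm_sum _ _ _))//.
apply: ler_sum => e _; rewrite normrM /sg.
by case: (e j0); rewrite ?normrN normr1 mul1r.
Qed.

Lemma sum_sg_sqr c : \sum_(e : {ffun J -> bool}) (\sum_j sg (e j) * c j) ^+ 2 = N * \sum_j c j ^+ 2.
Proof.
transitivity (\sum_(e : {ffun J -> bool}) \sum_l c l * (sg (e l) * (\sum_j sg (e j) * c j))).
  apply: eq_bigr => e _; rewrite expr2 mulr_suml; apply: eq_bigr => l _.
  by rewrite mulrA (mulrC (c l)).
rewrite exchange_big /= mulr_sumr; apply: eq_bigr => l _.
by rewrite -mulr_sumr sum_sg_coef expr2 mulrCA.
Qed.

(** Averaged over x of mean m, this bounds the mean of the s-th powers by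
    2 * m ^ s, which replaces Jensen's inequality up to the factor 2. *)
Lemma powR_le_tangent (x m s : R) : 0 <= x -> 0 < m -> 0 < s -> s <= 1 ->
  x `^ s <= m `^ s * (1 + x / m).
Proof.
move=> x0 m0 s0 s1.
have xE : x = m * (x / m) by rewrite mulrC divfK// gt_eqF.
have r0 : 0 <= x / m by rewrite divr_ge0// ltW.
rewrite {1}xE powRM ?(ltW m0)// ler_wpM2l ?powR_ge0//.
have [r1|r1] := leP (x / m) 1.
  apply: (@le_trans _ _ 1); last by rewrite lerDl.
  by have := @ge0_ler_powR R s (ltW s0) (x / m) 1; rewrite powR1 !nnegrE; apply.
apply: (@le_trans _ _ (x / m)); last by rewrite lerDr.
by rewrite ler1_powR// ltW.
Qed.

(** The weights w j / m are at most 1, so their s-th powers are larger. *)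
Lemma powR_sum_le w (s : R) : (forall j, 0 <= w j) -> 0 < s -> s <= 1 ->
  (\sum_(j : J) w j) `^ s <= \sum_j (w j) `^ s.
Proof.
move=> w0 s0 s1; set m := \sum_j w j.
have m0 : 0 <= m by apply: sumr_ge0.
have [mE|mN] := eqVneq m 0.
  by rewrite mE powR0 ?gt_eqF// sumr_ge0// => j _; exact: powR_ge0.
have mp : 0 < m by rewrite lt_def mN.
have -> : m `^ s = \sum_j m `^ s * (w j / m).
  by rewrite -mulr_sumr -mulr_suml divff// mulr1.
apply: ler_sum => j _.
have -> : (w j) `^ s = m `^ s * (w j / m) `^ s.
  by rewrite -powRM ?divr_ge0// [m * _]mulrC divfK.
rewrite ler_wpM2l ?powR_ge0//.
have r1 : w j / m <= 1.
  by rewrite ler_pdivrMr// mul1r /m (bigD1 j)//= lerDl sumr_ge0.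
have r0 : 0 <= w j / m by rewrite divr_ge0.
have [->|rn] := eqVneq (w j / m) 0; first exact: powR_ge0.
by rewrite ger1_powR// r1 lt_def rn r0.
Qed.

(** Khinchine's inequality for exponents 2 s <= 2, followed by the embedding of
    the s-th power sums; the planar form serves complex amplitudes. *)
Lemma sum_sg_powR u v (s : R) : 0 < s -> s <= 1 ->
  \sum_(e : {ffun J -> bool}) ((\sum_j sg (e j) * u j) ^+ 2 + (\sum_j sg (e j) * v j) ^+ 2) `^ s
   <= 2 * N * \sum_j (u j ^+ 2 + v j ^+ 2) `^ s.
Proof.
move=> s0 s1; set m := \sum_j (u j ^+ 2 + v j ^+ 2).
pose X e := (\sum_j sg (e j) * u j) ^+ 2 + (\sum_j sg (e j) * v j) ^+ 2.
have X0 e : 0 <= X e by rewrite addr_ge0// sqr_ge0.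
have w0 j : 0 <= u j ^+ 2 + v j ^+ 2 by rewrite addr_ge0// sqr_ge0.
have m0 : 0 <= m by apply: sumr_ge0.
have SX : \sum_(e : {ffun J -> bool}) X e = N * m by rewrite big_split /= !sum_sg_sqr -mulrDr -big_split.
apply: (@le_trans _ _ (2 * N * m `^ s)); last first.
  by rewrite ler_wpM2l ?mulr_ge0//; exact: powR_sum_le.
have [mE|mN] := eqVneq m 0.
  rewrite mE powR0 ?gt_eqF// mulr0 big1// => e _.
  have : \sum_(e : {ffun J -> bool}) X e == 0 by rewrite SX mE mulr0.
  rewrite psumr_eq0// => /allP/(_ e); rewrite mem_index_enum => /(_ isT) /eqP Xe.
  by rewrite -/(X e) Xe powR0 ?gt_eqF.
have mp : 0 < m by rewrite lt_def mN.
apply: (@le_trans _ _ (\sum_(e : {ffun J -> bool}) m `^ s * (1 + X e / m))).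
  by apply: ler_sum => e _; exact: (powR_le_tangent (X0 e) mp s0 s1).
rewrite -mulr_sumr big_split /= sumr_const -mulr_suml SX mulfK//.
by rewrite le_eqVlt; apply/orP; left; apply/eqP; ring.
Qed.

End random_signs.

(** * Gaussian wave packets are Schwartz functions *)

Section schwartz_class.
Variables (R : realType) (n : nat).
Implicit Types (f g : 'rV[R]_n -> R) (x v y : 'rV[R]_n) (A : 'M[R]_n).

Lemma is_derive_of_line f x v df :
  is_derive (0 : R) (1 : R) (fun c : R => f (x + c *: v)) df -> is_derive x v f df.
Proof.
move=> [dfx <-].
have E : (fun h : R => h^-1 *: ((fun c : R => f (x + c *: v)) (h *: (1:R) + 0) -
    (fun c : R => f (x + c *: v)) 0)) =
  (fun h : R => h^-1 *: (f (h *: v + x) - f x)).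
  apply/funext => h /=; rewrite scale0r addr0 addr0 [h *: _]mulr1.
  by rewrite (addrC x).
split; first by rewrite /derivable /= -E.
by rewrite /derive /= -E.
Qed.

Lemma is_derive_comp1 (g : R -> R) f x v df dg :
  is_derive x v f df -> is_derive (f x) (1 : R) g dg ->
  is_derive x v (fun z => g (f z)) (dg * df).
Proof.
move=> hf hg; apply: is_derive_of_line.
have hl : is_derive (0 : R) (1 : R) (fun c : R => f (x + c *: v)) df.
  by apply: is_derive_line; rewrite scale0r addr0.
have hg' : is_derive ((fun c : R => f (x + c *: v)) 0) (1 : R) g dg.
  by rewrite scale0r addr0.
exact: (is_derive1_comp hg' hl).
Qed.

(** Polynomial functions, kept as a class of functions closed under the
    operations used below rather than as formal polynomials. *)
Inductive polyfun : ('rV[R]_n -> R) -> Prop :=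
| polyfun_cst c : polyfun (fun=> c)
| polyfun_coord i : polyfun (fun x => x 0 i)
| polyfun_add P Q : polyfun P -> polyfun Q -> polyfun (fun x => P x + Q x)
| polyfun_mul P Q : polyfun P -> polyfun Q -> polyfun (fun x => P x * Q x).

Lemma polyfun_sum (I : Type) (r : seq I) (F : I -> 'rV[R]_n -> R) :
  (forall i, polyfun (F i)) -> polyfun (fun x => \sum_(i <- r) F i x).
Proof.
move=> pF; elim: r => [|i r IH].
  rewrite (_ : (fun x => _) = (fun=> 0)); first exact: polyfun_cst.
  by apply/funext => x; rewrite big_nil.
rewrite (_ : (fun x => _) = (fun x => F i x + \sum_(i <- r) F i x)); first exact: polyfun_add.
by apply/funext => x; rewrite big_cons.
Qed.

Lemma polyfun_prod (I : Type) (r : seq I) (F : I -> 'rV[R]_n -> R) :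
  (forall i, polyfun (F i)) -> polyfun (fun x => \prod_(i <- r) F i x).
Proof.
move=> pF; elim: r => [|i r IH].
  rewrite (_ : (fun x => _) = (fun=> 1)); first exact: polyfun_cst.
  by apply/funext => x; rewrite big_nil.
rewrite (_ : (fun x => _) = (fun x => F i x * \prod_(i <- r) F i x)); first exact: polyfun_mul.
by apply/funext => x; rewrite big_cons.
Qed.

Lemma polyfun_exp P k : polyfun P -> polyfun (fun x => P x ^+ k).
Proof.
move=> pP; elim: k => [|k IH].
  by rewrite (_ : (fun x => _) = (fun=> 1)); [exact: polyfun_cst|apply/funext => x; rewrite expr0].
by rewrite (_ : (fun x => _) = (fun x => P x * P x ^+ k));
  [exact: polyfun_mul|apply/funext => x; rewrite exprS].
Qed.

Lemma polyfun_dotmul y : polyfun (fun x => dotmul x y).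
Proof.
by apply: polyfun_sum => i; apply: polyfun_mul; [exact: polyfun_coord|exact: polyfun_cst].
Qed.

Lemma polyfun_sqn A : polyfun (fun x => sqn (x *m A)).
Proof.
apply: polyfun_sum => i; apply: (polyfun_exp 2).
rewrite (_ : (fun x => _) = (fun x => \sum_j x 0 j * A j i)).
  by apply: polyfun_sum => j; apply: polyfun_mul; [exact: polyfun_coord|exact: polyfun_cst].
by apply/funext => x; rewrite mxE.
Qed.

Lemma is_derive_mulE f g x v df dg : is_derive x v f df -> is_derive x v g dg ->
  is_derive x v (fun z => f z * g z) (f x * dg + g x * df).
Proof. by move=> hf hg; exact: (is_deriveM hf hg). Qed.

Lemma is_derive_addE f g x v df dg : is_derive x v f df -> is_derive x v g dg ->
  is_derive x v (fun z => f z + g z) (df + dg).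
Proof. by move=> hf hg; exact: (is_deriveD hf hg). Qed.

Lemma polyfun_derive P v : polyfun P ->
  exists2 P', polyfun P' & forall x, is_derive x v P (P' x).
Proof.
elim=> [c|i|{}P Q pP [P' pP' dP] pQ [Q' pQ' dQ]|{}P Q pP [P' pP' dP] pQ [Q' pQ' dQ]].
- by exists (fun=> 0); [exact: polyfun_cst|move=> x; exact: is_derive_cst].
- exists (fun=> v 0 i); first exact: polyfun_cst.
  by move=> x; apply: is_derive_affine => h; rewrite !mxE addrK.
- exists (fun x => P' x + Q' x); first exact: polyfun_add.
  by move=> x; exact: is_derive_addE.
- exists (fun x => P x * Q' x + Q x * P' x).
    by apply: polyfun_add; exact: polyfun_mul.
  by move=> x; exact: is_derive_mulE.
Qed.

Lemma polyfun_continuous P : polyfun P -> continuous P.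
Proof.
elim=> [c|i|{}P Q pP cP pQ cQ|{}P Q pP cP pQ cQ] x.
- exact: cst_continuous.
- exact: coord_continuous.
- exact: (continuousD (cP x) (cQ x)).
- exact: (continuousM (cP x) (cQ x)).
Qed.

(** A class stable under derivatives and under multiplication by polynomials, whose
    members are bounded: this makes each of them a Schwartz function. *)
Inductive wavefun : ('rV[R]_n -> R) -> Prop :=
| wavefun0 : wavefun (fun=> 0)
| wavefun_cos A y P : A \in unitmx -> polyfun P ->
    wavefun (fun x => P x * gauss (x *m A) * cos (2 * pi * dotmul x y))
| wavefun_sin A y P : A \in unitmx -> polyfun P ->
    wavefun (fun x => P x * gauss (x *m A) * sin (2 * pi * dotmul x y))
| wavefun_add f g : wavefun f -> wavefun g -> wavefun (fun x => f x + g x).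

Lemma wavefun_mul f P : wavefun f -> polyfun P -> wavefun (fun x => P x * f x).
Proof.
move=> wf pP; elim: wf => [|A y Q uA pQ|A y Q uA pQ|{}f g _ wf _ wg].
- rewrite (_ : (fun x => _) = (fun=> 0)); first exact: wavefun0.
  by apply/funext => x; rewrite mulr0.
- rewrite (_ : (fun x => _) = (fun x => P x * Q x * gauss (x *m A) * cos (2 * pi * dotmul x y))).
    by apply: (wavefun_cos _ uA (polyfun_mul pP pQ)).
  by apply/funext => x; rewrite !mulrA.
- rewrite (_ : (fun x => _) = (fun x => P x * Q x * gauss (x *m A) * sin (2 * pi * dotmul x y))).
    by apply: (wavefun_sin _ uA (polyfun_mul pP pQ)).
  by apply/funext => x; rewrite !mulrA.
- rewrite (_ : (fun x => _) = (fun x => P x * f x + P x * g x)); first exact: wavefun_add.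
  by apply/funext => x; rewrite mulrDr.
Qed.

Lemma gauss_derive A v : exists2 P', polyfun P' &
  forall x, is_derive x v (fun x => gauss (x *m A)) (P' x * gauss (x *m A)).
Proof.
have [Q' pQ' dQ] := polyfun_derive v (polyfun_mul (polyfun_cst (- 1)) (polyfun_sqn A)).
exists Q' => // x; rewrite mulrC.
have -> : (fun x => gauss (x *m A)) = (fun z => expR (- 1 * sqn (z *m A))).
  by apply/funext => z; rewrite mulN1r.
have -> : gauss (x *m A) = expR (- 1 * sqn (x *m A)) by rewrite mulN1r.
exact: (is_derive_comp1 (dQ x) (is_derive_expR _)).
Qed.

Lemma phase_derive y v : exists2 P', polyfun P' &
  (forall x, is_derive x v (fun x => 2 * pi * dotmul x y) (P' x)).
Proof.
exact: (polyfun_derive v (polyfun_mul (polyfun_cst (2 * pi)) (polyfun_dotmul y))).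
Qed.

Lemma wavefun_derive f v : wavefun f ->
  exists2 g, wavefun g & forall x, is_derive x v f (g x).
Proof.
elim=> [|A y P uA pP|A y P uA pP|{}f g _ [f' wf' df] _ [g' wg' dg]].
- by exists (fun=> 0); [exact: wavefun0|move=> x; exact: is_derive_cst].
- have [P' pP' dP] := polyfun_derive v pP.
  have [Q' pQ' dQ] := gauss_derive A v; have [L' pL' dL] := phase_derive y v.
  exists (fun x => (P x * Q' x + P' x) * gauss (x *m A) * cos (2 * pi * dotmul x y) +
     (- 1 * (P x * L' x)) * gauss (x *m A) * sin (2 * pi * dotmul x y)).
    apply: wavefun_add.
      by apply: (wavefun_cos _ uA); apply: polyfun_add => //; exact: polyfun_mul.
    apply: (wavefun_sin _ uA); apply: polyfun_mul; first exact: polyfun_cst.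
    exact: polyfun_mul.
  move=> x; apply: is_derive_eq.
    apply: is_derive_mulE (is_derive_mulE (dP x) (dQ x)) _.
    exact: (is_derive_comp1 (dL x) (is_derive_cos _)).
  by rewrite /=; ring.
- have [P' pP' dP] := polyfun_derive v pP.
  have [Q' pQ' dQ] := gauss_derive A v; have [L' pL' dL] := phase_derive y v.
  exists (fun x => (P x * Q' x + P' x) * gauss (x *m A) * sin (2 * pi * dotmul x y) +
     (P x * L' x) * gauss (x *m A) * cos (2 * pi * dotmul x y)).
    apply: wavefun_add.
      by apply: (wavefun_sin _ uA); apply: polyfun_add => //; exact: polyfun_mul.
    by apply: (wavefun_cos _ uA); exact: polyfun_mul.
  move=> x; apply: is_derive_eq.
    apply: is_derive_mulE (is_derive_mulE (dP x) (dQ x)) _.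
    exact: (is_derive_comp1 (dL x) (is_derive_sin _)).
  by rewrite /=; ring.
- exists (fun x => f' x + g' x); first exact: wavefun_add.
  by move=> x; exact: is_derive_addE.
Qed.

Lemma gauss_continuous A : continuous (fun x => gauss (x *m A)).
Proof.
have -> : (fun x => gauss (x *m A)) = expR \o (fun z => - 1 * sqn (z *m A)).
  by apply/funext => z; rewrite /= mulN1r.
move=> x; apply: continuous_comp; last exact: continuous_expR.
exact: (polyfun_continuous (polyfun_mul (polyfun_cst (- 1)) (polyfun_sqn A))).
Qed.

Lemma wavefun_continuous f : wavefun f -> continuous f.
Proof.
have cph y : continuous (fun x => 2 * pi * dotmul x y).
  exact: (polyfun_continuous (polyfun_mul (polyfun_cst (2 * pi)) (polyfun_dotmul y))).
elim=> [|A y P uA pP|A y P uA pP|{}f g _ cf _ cg] x.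
- exact: cst_continuous.
- have c1 := continuousM (@polyfun_continuous P pP x) (@gauss_continuous A x).
  have c2 : {for x, continuous (fun x => cos (2 * pi * dotmul x y))}.
    by apply: continuous_comp; [exact: cph|exact: continuous_cos].
  exact: (continuousM c1 c2).
- have c1 := continuousM (@polyfun_continuous P pP x) (@gauss_continuous A x).
  have c2 : {for x, continuous (fun x => sin (2 * pi * dotmul x y))}.
    by apply: continuous_comp; [exact: cph|exact: continuous_sin].
  exact: (continuousM c1 c2).
- exact: (continuousD (cf x) (cg x)).
Qed.

(** A factor 1 + t ^ 2 is below any exponential of c * sqn x up to a constant, and
    the exponent c is shared between the factors of a product. *)
Lemma polyfun_growth P : polyfun P -> forall c : R, 0 < c ->
  exists2 C : R, 0 <= C & forall x, `|P x| <= C * expR (c * sqn x).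
Proof.
have exp1 (c : R) x : 0 < c -> 1 <= expR (c * sqn x).
  by move=> c0; rewrite -expR0 ler_expR mulr_ge0 ?sqn_ge0// ltW.
elim=> [a|i|{}P Q pP hP pQ hQ|{}P Q pP hP pQ hQ] c c0.
- by exists `|a| => // x; rewrite ler_peMr// exp1.
- exists (1 + c^-1); first by rewrite addr_ge0// invr_ge0 ltW.
  move=> x; set t := x 0 i.
  have t2 : t ^+ 2 <= sqn x.
    by rewrite /sqn (bigD1 i)//= lerDl sumr_ge0// => l _; exact: sqr_ge0.
  apply: (@le_trans _ _ (1 + t ^+ 2)).
    by rewrite -(real_normK (num_real t)); have := sqr_ge0 (`|t| - 1); rewrite sqrrB; nra.
  rewrite mulrDl mul1r lerD ?exp1//.
  rewrite ler_pdivlMl//; apply: le_trans (ler_wpM2l (ltW c0) t2) _.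
  by apply: le_trans (expR_ge1Dx _); rewrite lerDr.
- have [C C0 HC] := hP c c0; have [D D0 HD] := hQ c c0.
  exists (C + D); first exact: addr_ge0.
  by move=> x; rewrite mulrDl (le_trans (ler_normD _ _))// lerD.
- have c2 : 0 < c / 2 by rewrite divr_gt0.
  have [C C0 HC] := hP _ c2; have [D D0 HD] := hQ _ c2.
  exists (C * D); first exact: mulr_ge0.
  move=> x; rewrite normrM.
  have -> : c * sqn x = c / 2 * sqn x + c / 2 * sqn x by rewrite -mulrDl -splitr.
  by rewrite expRD mulrACA ler_pM.
Qed.

(** The Gaussian of x *m A decays in every direction because A is invertible. *)
Lemma sqn_le_mulmx A : A \in unitmx ->
  exists2 D : R, 0 < D & forall x, sqn x <= D * sqn (x *m A).
Proof.
move=> uA; pose a := n%:R * `|invmx A|.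
have a0 : 0 <= a by rewrite mulr_ge0.
exists (n%:R * a ^+ 2 + 1); first by rewrite ltr_wpDl// mulr_ge0// exprn_ge0.
move=> x; have s0 := sqn_ge0 (x *m A).
have N : `|x *m A| ^+ 2 <= sqn (x *m A).
  rewrite -[leRHS](sqr_sqrtr s0) ler_sqr ?nnegrE ?sqrtr_ge0//.
  apply: mx_norm_le => [|i j]; first exact: sqrtr_ge0.
  rewrite ord1 -sqrtr_sqr ler_sqrt// /sqn (bigD1 j)//= lerDl sumr_ge0// => l _.
  exact: sqr_ge0.
have X : `|x| <= a * `|x *m A|.
  rewrite -{1}[x](mulmxK uA) (le_trans (mulmx_norm_le _ _))//.
  by rewrite /a le_eqVlt; apply/orP; left; apply/eqP; ring.
apply: (@le_trans _ _ (n%:R * `|x| ^+ 2)).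
  rewrite /sqn -[n in n%:R]card_ord -sumr_const mulr_suml ler_sum// => i _.
  by rewrite mul1r -(real_normK (num_real (x 0 i))) ler_sqr ?nnegrE// mx_coord_le.
rewrite mulrDl mul1r; apply: le_trans (_ : n%:R * a ^+ 2 * sqn (x *m A) <= _).
  rewrite -mulrA ler_wpM2l//.
  apply: (@le_trans _ _ ((a * `|x *m A|) ^+ 2)).
    by rewrite ler_sqr ?nnegrE// mulr_ge0.
  by rewrite exprMn ler_wpM2l// exprn_ge0.
by rewrite lerDl.
Qed.

Lemma poly_gauss_bounded A P : A \in unitmx -> polyfun P ->
  exists C : R, forall x, `|P x * gauss (x *m A)| <= C.
Proof.
move=> uA pP; have [D D0 HD] := sqn_le_mulmx uA.
have D1 : 0 < D^-1 by rewrite invr_gt0.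
have [C C0 HC] := polyfun_growth pP D1.
exists C => x; rewrite normrM (ger0_norm (gauss_ge0 _)).
apply: le_trans (ler_wpM2r (gauss_ge0 _) (HC x)) _.
rewrite -mulrA /gauss -expRD ler_piMr// -expR0 ler_expR.
by rewrite subr_le0 ler_pdivrMl.
Qed.

Lemma wavefun_bounded f : wavefun f -> exists C : R, forall x, `|f x| <= C.
Proof.
elim=> [|A y P uA pP|A y P uA pP|{}f g _ [C HC] _ [D HD]].
- by exists 0 => x; rewrite normr0.
- have [C HC] := poly_gauss_bounded uA pP; exists C => x.
  rewrite normrM (le_trans _ (HC x))// ler_piMr//.
  exact: cos_max.
- have [C HC] := poly_gauss_bounded uA pP; exists C => x.
  rewrite normrM (le_trans _ (HC x))// ler_piMr//.
  exact: sin_max.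
- by exists (C + D) => x; rewrite (le_trans (ler_normD _ _))// lerD.
Qed.

Lemma wavefun_partials f s : wavefun f -> wavefun (partials s f).
Proof.
move=> wf; elim: s => [|i s IH] //=.
have [g wg dg] := wavefun_derive (delta_mx 0 i) IH.
rewrite (_ : 'D_(delta_mx 0 i) _ = g)//.
by apply/funext => x; have [_ ->] := dg x.
Qed.

Lemma wavefun_schwartz f : wavefun f -> schwartz_real f.
Proof.
move=> wf; split.
  move=> s x _; have ws := wavefun_partials s wf; split.
    exact: wavefun_continuous.
  by move=> i; have [g _ dg] := wavefun_derive (delta_mx 0 i) ws; have [] := dg x.
move=> alpha s; apply: wavefun_bounded; apply: wavefun_mul.
  exact: wavefun_partials.
by apply: polyfun_prod => i; apply: polyfun_exp; exact: polyfun_coord.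
Qed.

End schwartz_class.

(** * The restriction inequality on wave packets *)

Section integral_sums.
Context d (T : measurableType d) (R : realType) (mu : {measure set T -> \bar R}).

Lemma Rintegral_sum (I : Type) (r : seq I) (f : I -> T -> R) :
  (forall i, mu.-integrable setT (EFin \o f i)) ->
  \int[mu]_x (\sum_(i <- r) f i x) = \sum_(i <- r) \int[mu]_x f i x.
Proof.
move=> fi; elim: r => [|i r IH].
  rewrite big_nil -[RHS](_ : \int[mu]_(x in setT) 0 = 0).
    by apply: eq_Rintegral => x _; rewrite big_nil.
  by rewrite /Rintegral integral0.
rewrite big_cons -IH -RintegralD//.
  by apply: eq_Rintegral => x _; rewrite big_cons.
apply: (@eq_integrable _ _ _ _ _ measurableT (fun x => \sum_(i <- r) (EFin \o f i) x)%E).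
  by move=> x _; rewrite /= sumEFin.
by apply: integrable_sum => // l _; exact: fi.
Qed.

(** A bound of the norm that is affine in the integral, so that it can be averaged
    over families of functions: t <= lambda + lambda ^ (1 - p) * t ^ p. *)
Lemma Lnorm_le_level (f : T -> R) (p lambda : R) : 1 <= p -> 0 < lambda ->
  (forall x, 0 <= f x) -> (\int[mu]_x (f x `^ p)%:E < +oo)%E ->
  (Lnorm mu p%:E (EFin \o f) <=
     lambda%:E + (lambda `^ (1 - p))%:E * \int[mu]_x (f x `^ p)%:E)%E.
Proof.
move=> p1 l0 f0 Ioo; have p0 : 0 < p by apply: lt_le_trans p1.
have LE : (Lnorm mu p%:E (EFin \o f) `^ p = \int[mu]_x (f x `^ p)%:E)%E.
  apply: (etrans (poweR_Lnorm mu (EFin \o f) (lt0r_neq0 p0))).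
  apply: eq_integral => x _ /=.
  by rewrite ger0_norm// poweR_EFin.
rewrite -LE; rewrite -LE in Ioo.
have : (0 <= Lnorm mu p%:E (EFin \o f))%E by exact: Lnorm_ge0.
case: (Lnorm mu p%:E (EFin \o f)) Ioo => [l _ lge0|h _|//]; last first.
  by move: h; rewrite poweRyr ?gt_eqF// ltxx.
rewrite lee_fin in lge0.
rewrite poweR_EFin -EFinM -EFinD lee_fin.
have [ll|ll] := leP l lambda.
  by rewrite (le_trans ll)// lerDl mulr_ge0 ?powR_ge0.
have lp : 0 < l := lt_trans l0 ll.
apply: (@le_trans _ _ (lambda `^ (1 - p) * l `^ p)); last by rewrite lerDr ltW.
have -> : l `^ p = l `^ (p - 1) * l.
  by rewrite -[X in _ * X](powRr1 (ltW lp)) -powRD ?subrK// gt_eqF ?implybT.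
rewrite mulrA ler_peMl ?(ltW lp)// -opprB powRN -ler_pdivrMl ?invr_gt0 ?powR_gt0//.
rewrite invrK mulr1 ge0_ler_powR ?nnegrE ?subr_ge0//; exact: ltW.
Qed.

End integral_sums.

Section test_function.
Variables (R : realType) (n : nat) (J : finType).
Variables (A : J -> 'M[R]_n) (y : J -> 'rV[R]_n) (a : R).
Hypotheses (uA : forall j, A j \in unitmx) (a0 : 0 <= a).
Local Notation leb := (lebesgue_rV n).
Implicit Types (e : {ffun J -> bool}) (x xi : 'rV[R]_n).

Definition packet_re j x : R := a * (gauss (x *m A j) * cos (2 * pi * dotmul x (y j))).
Definition packet_im j x : R := a * (gauss (x *m A j) * sin (2 * pi * dotmul x (y j))).

(** The Fourier transform of packet j is a Gaussian bump at the frequency y j, of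
    the shape of the ellipsoid of the theta *m (A j)^T, and of height one when
    a is |det (A j)| / sqrt pi ^ n. *)
Definition packets e x : R[i] :=
  Complex (\sum_j sg R (e j) * packet_re j x) (\sum_j sg R (e j) * packet_im j x).

Lemma packets_schwartz e : schwartz (packets e).
Proof.
have sum_wave (r : seq J) (F : J -> 'rV[R]_n -> R) :
    (forall j, wavefun (F j)) -> wavefun (fun x => \sum_(j <- r) F j x).
  move=> wF; elim: r => [|j r IH].
    rewrite (_ : (fun x => _) = (fun=> 0)); first exact: wavefun0.
    by apply/funext => x; rewrite big_nil.
  rewrite (_ : (fun x => _) = (fun x => F j x + \sum_(i <- r) F i x)).
    exact: wavefun_add.
  by apply/funext => x; rewrite big_cons.
split; apply: wavefun_schwartz; apply: sum_wave => j.
- rewrite (_ : (fun x => _) = (fun x => (fun=> sg R (e j) * a) x *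
     gauss (x *m A j) * cos (2 * pi * dotmul x (y j)))).
    by apply: wavefun_cos => //; exact: polyfun_cst.
  by apply/funext => x; rewrite /packet_re !mulrA.
- rewrite (_ : (fun x => _) = (fun x => (fun=> sg R (e j) * a) x *
     gauss (x *m A j) * sin (2 * pi * dotmul x (y j)))).
    by apply: wavefun_sin => //; exact: polyfun_cst.
  by apply/funext => x; rewrite /packet_im !mulrA.
Qed.

Definition coef j xi : R :=
  \int[leb]_x (gauss (x *m A j) * cos (2 * pi * dotmul x (y j - xi))).

Lemma fourier_packets_re e xi :
  complex.Re (fourier (packets e) xi) = \sum_j sg R (e j) * (a * coef j xi).
Proof.
have int_coef j : leb.-integrable setT (EFin \o (fun x : 'rV[R]_n =>
    sg R (e j) * a * (gauss (x *m A j) * cos (2 * pi * dotmul x (y j - xi))))).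
  apply: (@eq_integrable _ _ _ _ _ measurableT (fun x => (sg R (e j) * a)%:E *
     (gauss (x *m A j) * cos (2 * pi * dotmul x (y j - xi)))%:E)%E) => //.
  by apply: integrableZl => //; exact: integrable_coswave.
rewrite /fourier /=.
transitivity (\int[leb]_x (\sum_j sg R (e j) * a *
    (gauss (x *m A j) * cos (2 * pi * dotmul x (y j - xi))))).
  apply: eq_Rintegral => x _; rewrite cosN sinN mulNr opprK.
  set t := 2 * pi * dotmul x xi.
  rewrite !mulr_sumr -big_split; apply: eq_bigr => j _ /=.
  have -> : 2 * pi * dotmul x (y j - xi) =
      2 * pi * dotmul x (y j) - 2 * pi * dotmul x xi.
    rewrite -mulrBr; congr (_ * _); rewrite /dotmul -sumrB; apply: eq_bigr => i _.
    by rewrite !mxE mulrBr.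
  by rewrite cosB -/t /packet_re /packet_im; ring.
rewrite Rintegral_sum//; apply: eq_bigr => j _.
rewrite RintegralZl//; last exact: integrable_coswave.
by rewrite mulrA.
Qed.

Lemma packets_norm e x : Normc.normc (packets e x) =
  Num.sqrt ((\sum_j sg R (e j) * packet_re j x) ^+ 2 +
            (\sum_j sg R (e j) * packet_im j x) ^+ 2).
Proof. by []. Qed.

Lemma packet_sqr j x : packet_re j x ^+ 2 + packet_im j x ^+ 2 = (a * gauss (x *m A j)) ^+ 2.
Proof.
rewrite /packet_re /packet_im !exprMn -!mulrDr cos2Dsin2.
by rewrite mulr1.
Qed.

(** When the right side is at most 1, p-th powers of the modulus are bounded by its
    q-th powers for q <= p. *)
Lemma packets_norm_le e x : Normc.normc (packets e x) <= 2 * (#|J|%:R * a).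
Proof.
have bnd (f : J -> R) : (forall j, `|f j| <= a) -> `|\sum_j sg R (e j) * f j| <= #|J|%:R * a.
  move=> fa; rewrite (le_trans (ler_norm_sum _ _ _))// -sumr_const mulr_suml.
  apply: ler_sum => j _; rewrite mul1r normrM /sg.
  by case: (e j); rewrite ?normrN normr1 mul1r.
have g1 j (t : R) : `|t| <= 1 -> `|a * (gauss (x *m A j) * t)| <= a.
  move=> t1; rewrite normrM (ger0_norm a0) ler_piMr// normrM.
  by rewrite mulr_ile1// ger0_norm ?gauss_ge0// gauss_le1.
have hre : `|\sum_j sg R (e j) * packet_re j x| <= #|J|%:R * a.
  exact: (bnd _ (fun j => g1 j _ (cos_max _))).
have him : `|\sum_j sg R (e j) * packet_im j x| <= #|J|%:R * a.
  exact: (bnd _ (fun j => g1 j _ (sin_max _))).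
have Na : 0 <= #|J|%:R * a by rewrite mulr_ge0.
rewrite packets_norm -[leRHS]ger0_norm ?mulr_ge0// -sqrtr_sqr ler_wsqrtr//.
rewrite -(real_normK (num_real (\sum_j _ * packet_re _ _))).
rewrite -(real_normK (num_real (\sum_j _ * packet_im _ _))).
move: (normr_ge0 (\sum_j sg R (e j) * packet_re j x)) hre.
move: (normr_ge0 (\sum_j sg R (e j) * packet_im j x)) him.
move: (#|J|%:R * a) Na `|_| `|_| => t t0 v u v0 hv u0 hu.
have u2 : u ^+ 2 <= t ^+ 2 by rewrite ler_sqr.
have v2 : v ^+ 2 <= t ^+ 2 by rewrite ler_sqr.
rewrite exprMn; have := sqr_ge0 t; move: (t ^+ 2) u2 v2 => T; lra.
Qed.

Lemma sum_packets_powR q x : 0 < q -> q <= 2 ->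
  \sum_(e : {ffun J -> bool}) Normc.normc (packets e x) `^ q <=
  2 * #|{ffun J -> bool}|%:R * \sum_j (a * gauss (x *m A j)) `^ q.
Proof.
move=> q0 q2; have sq (t : R) : 0 <= t -> Num.sqrt t `^ q = t `^ (q / 2).
  by move=> t0; rewrite -powR12_sqrt// -powRrM mulrC.
have s0 : 0 < q / 2 by rewrite divr_gt0.
have s1 : q / 2 <= 1 by rewrite ler_pdivrMr// mul1r.
under eq_bigr do rewrite packets_norm sq ?addr_ge0 ?sqr_ge0//.
apply: le_trans (sum_sg_powR (packet_re^~ x) (packet_im^~ x) s0 s1) _.
rewrite ler_wpM2l ?mulr_ge0// ler_sum// => j _.
rewrite packet_sqr -sq ?sqr_ge0// sqrtr_sqr ger0_norm//.
by rewrite mulr_ge0// gauss_ge0.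
Qed.

(** Testing the restriction inequality on all sign patterns of the packets and
    averaging: every frequency of [B] is seen by one packet, so no cancellation
    survives on the Fourier side, whereas on the space side the signs cancel
    down to square root size. *)
Lemma p_restriction_packets (E B : set 'rV[R]_n) (sigma : {measure set 'rV[R]_n -> \bar R})
    (p q C lambda d : R) :
  (forall f : 'rV[R]_n -> R[i], schwartz f ->
    (\int[sigma]_(xi in E) (Normc.normc (fourier f xi))%:E <=
     C%:E * Lnorm leb p%:E (fun x => (Normc.normc (f x))%:E))%E) ->
  measurable B -> B `<=` E ->
  (forall j, `|\det (A j)| = d) -> a = d / Num.sqrt pi ^+ n -> 0 < a ->
  (forall xi, B xi -> exists j theta,
    y j - xi = theta *m (A j)^T /\ `|theta| <= osc_const R n) ->
  1 <= q -> q <= 2 -> q <= p -> 2 * (#|J|%:R * a) <= 1 -> 0 < lambda ->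
  ((2^-1)%:E * sigma B <=
    `|C|%:E * (lambda + lambda `^ (1 - p) * (2 * #|J|%:R * a `^ (q - 1)))%:E)%E.
Proof.
move=> hC mB BE detA aE ap Bxi q1 q2 qp Na1 l0.
pose N : R := #|{ffun J -> bool}|%:R.
have N0 : 0 < N by rewrite /N ltr0n card_ffun card_bool expn_gt0.
have q0 : 0 < q := lt_le_trans ltr01 q1.
have p1 : 1 <= p := le_trans q1 qp.
pose normf e x := Normc.normc (packets e x).
have normf0 e x : 0 <= normf e x by exact: sqrtr_ge0.
have mwave (h : R -> R) e : continuous h -> measurable_fun setT (fun x =>
    \sum_j sg R (e j) * (a * (gauss (x *m A j) * h (2 * pi * dotmul x (y j))))).
  move=> ch; apply: measurable_sum => j; apply: measurable_funM => //.
  apply: measurable_funM => //; apply: measurable_funM; first exact: measurable_gaussmx.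
  apply: measurableT_comp; first exact: continuous_measurable_fun.
  by apply: measurable_funM => //; exact: measurable_dotmul.
have mnorm e : measurable_fun setT (normf e).
  have ms := continuous_measurable_fun (@sqrt_continuous R).
  apply: (measurableT_comp ms (_ : measurable_fun setT (fun x =>
    (\sum_j sg R (e j) * packet_re j x) ^+ 2 + (\sum_j sg R (e j) * packet_im j x) ^+ 2))).
  apply: measurable_funD; apply: measurable_funX.
    exact: (mwave _ _ (@continuous_cos R)).
  exact: (mwave _ _ (@continuous_sin R)).
have mnormp e : measurable_fun setT (fun x => (normf e x `^ p)%:E).
  by apply/measurable_EFinP; exact: measurableT_comp (measurable_powR p) (mnorm e).
pose I e : \bar R := (\int[leb]_x (normf e x `^ p)%:E)%E.
have I0 e : (0 <= I e)%E by apply: integral_ge0 => x _; rewrite lee_fin powR_ge0.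
have ag1 j x : a * gauss (x *m A j) <= a by rewrite ler_piMr// gauss_le1.
have powag j x : (a * gauss (x *m A j)) `^ q <= a `^ q * gauss (x *m A j).
  rewrite powRM ?gauss_ge0// ler_wpM2l ?powR_ge0// ge1r_powR//.
  by rewrite gauss_gt0 gauss_le1.
have pointwise x : \sum_(e : {ffun J -> bool}) normf e x `^ p <=
    2 * N * a `^ q * \sum_j gauss (x *m A j).
  apply: (@le_trans _ _ (\sum_(e : {ffun J -> bool}) normf e x `^ q)).
    apply: ler_sum => e _.
    have [->|nz] := eqVneq (normf e x) 0; first by rewrite powR0 ?powR_ge0// gt_eqF// (lt_le_trans q0).
    rewrite ger_powR// lt_def nz normf0 /=.
    exact: le_trans (packets_norm_le _ _) Na1.
  apply: (le_trans (sum_packets_powR x q0 q2)).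
  rewrite -[leRHS]mulrA ler_wpM2l ?mulr_ge0// mulr_sumr.
  by apply: ler_sum.
have sumI : (\sum_(e : {ffun J -> bool}) I e <= (N * (2 * #|J|%:R * a `^ (q - 1)))%:E)%E.
  rewrite -ge0_integral_sum//; last by move=> e x _; rewrite lee_fin powR_ge0.
  apply: (@le_trans _ _ (\int[leb]_x ((2 * N * a `^ q)%:E * \sum_j (gauss (x *m A j))%:E))%E).
    apply: ge0_le_integral => //.
    - by move=> x _; apply: sume_ge0 => e _; rewrite lee_fin powR_ge0.
    - exact: emeasurable_sum.
    - apply: emeasurable_funM => //; apply: emeasurable_sum => j.
      by apply/measurable_EFinP; exact: measurable_gaussmx.
    - by move=> x _; rewrite !sumEFin -EFinM lee_fin pointwise.
  rewrite ge0_integralZl//; first last.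
  - by rewrite lee_fin !mulr_ge0 ?powR_ge0.
  - by move=> x _; apply: sume_ge0 => e _; rewrite lee_fin gauss_ge0.
  - apply: emeasurable_sum => j.
    by apply/measurable_EFinP; exact: measurable_gaussmx.
  rewrite ge0_integral_sum//; first last.
  - by move=> e x _; rewrite lee_fin gauss_ge0.
  - by move=> j; apply/measurable_EFinP; exact: measurable_gaussmx.
  under eq_bigr do rewrite integral_gaussmx// detA.
  rewrite sumEFin -EFinM lee_fin sumr_const.
  rewrite le_eqVlt; apply/orP; left; apply/eqP.
  have -> : a `^ q = a * a `^ (q - 1).
    have aN0 : (1 + (q - 1) == 0) ==> (a != 0) by rewrite (lt0r_neq0 ap) implybT.
    by rewrite -{2}(powRr1 a0) -(powRD aN0) addrC subrK.
  have dE : Num.sqrt pi ^+ n / d = a^-1 by rewrite aE invfM invrK mulrC.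
  rewrite dE.
  rewrite -[X in _ * X]mulr_natl -[#|xpredT|]/(#|J|).
  have a1 : a * a^-1 = 1 by rewrite divff ?gt_eqF.
  move: a1; move: (a `^ (q - 1)) (a^-1) (#|J|%:R : R) => b c J' a1.
  transitivity (N * (2 * J' * b) * (a * c)); first by move: {+}N => N'; ring.
  by rewrite a1 mulr1.
have upper e : (\int[sigma]_(xi in B) (`|\sum_j sg R (e j) * (a * coef j xi)|)%:E <=
   `|C|%:E * (lambda%:E + (lambda `^ (1 - p))%:E * I e))%E.
  apply: (@le_trans _ _ (\int[sigma]_(xi in E) (Normc.normc (fourier (packets e) xi))%:E)%E).
    apply: le_lower_integral => // [xi _|xi _]; last by rewrite lee_fin sqrtr_ge0.
    rewrite !lee_fin normr_ge0 -fourier_packets_re /=.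
    by rewrite -sqrtr_sqr ler_wsqrtr// lerDl sqr_ge0.
  apply: (le_trans (hC _ (packets_schwartz e))).
  apply: (@le_trans _ _ (`|C|%:E * Lnorm leb p%:E (EFin \o normf e))%E).
    by rewrite lee_wpmul2r ?Lnorm_ge0// lee_fin ler_norm.
  rewrite lee_wpmul2l ?lee_fin// Lnorm_le_level//.
  apply: le_lt_trans (ltry (N * (2 * #|J|%:R * a `^ (q - 1)))).
  apply: le_trans sumI; rewrite (bigD1 e)//= leeDl// sume_ge0//.
have lower : ((N / 2)%:E * sigma B <= \sum_(e : {ffun J -> bool})
   \int[sigma]_(xi in B) (`|\sum_j sg R (e j) * (a * coef j xi)|)%:E)%E.
  rewrite -ge0_integral_sum//; last first.
    move=> e; apply: (measurable_funS measurableT) => //.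
    apply/measurable_EFinP; apply: measurableT_comp => //.
    apply: measurable_sum => j; apply: measurable_funM => //; apply: measurable_funM => //.
    exact: measurable_coswave_freq.
  rewrite -integral_cst//; apply: le_lower_integral => // xi Bx; last first.
    by apply: sume_ge0 => e _; rewrite lee_fin.
  have [j [theta [yE th]]] := Bxi _ Bx.
  rewrite lee_fin divr_ge0 ?(ltW N0)//= sumEFin lee_fin.
  apply: le_trans (sum_sg_norm_ge _ j); rewrite ler_wpM2l ?(ltW N0)//.
  apply: le_trans (ler_norm _).
  have := coswave_ge (uA j) yE th; rewrite -/(coef j xi) detA => h.
  have := ler_wpM2l a0 h; apply: le_trans.
  rewrite mulrA [a * _](_ : _ = 1) ?mul1r//.
  have -> : Num.sqrt pi ^+ n / d = a^-1 by rewrite aE invfM invrK mulrC.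
  by rewrite divff ?gt_eqF.
have NE : ((N / 2)%:E * sigma B = N%:E * (2^-1%:E * sigma B))%E by rewrite muleA -EFinM.
have sumE : (\sum_(e : {ffun J -> bool}) `|C|%:E * (lambda%:E + (lambda `^ (1 - p))%:E * I e) =
  `|C|%:E * (N%:E * lambda%:E + (lambda `^ (1 - p))%:E * \sum_(e : {ffun J -> bool}) I e))%E.
  rewrite -ge0_sume_distrr; last first.
    by move=> e _; rewrite adde_ge0 ?mule_ge0 ?lee_fin ?powR_ge0// ltW.
  rewrite big_split/=; congr (_ * (_ + _))%E.
    by rewrite sumEFin -EFinM sumr_const mulr_natl.
  by rewrite -ge0_sume_distrr.
rewrite -(@lee_pmul2l _ N%:E)// ?lte_fin//.
rewrite -NE; apply: (le_trans lower).
apply: (le_trans (lee_sum _ (fun e _ => upper e))).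
rewrite sumE muleCA; apply: lee_wpmul2l => //.
rewrite [leRHS](_ : _ = N%:E * lambda%:E +
  (lambda `^ (1 - p))%:E * (N * (2 * #|J|%:R * a `^ (q - 1)))%:E)%E; last first.
  by rewrite -!EFinM -EFinD mulrDr mulrCA.
by apply: leeD => //; apply: lee_wpmul2l => //; rewrite lee_fin powR_ge0.
Qed.

End test_function.

(** * Balls *)

Section ball.
Variable R : realType.

Lemma ball_rVE n (x0 : 'rV[R]_n) (r : R) : 0 <= r ->
  [set x : 'rV[R]_n | `|x - x0| <= r] = [set x | forall i, `[x0 0 i - r, x0 0 i + r]%classic (x 0 i)].
Proof.
move=> r0; apply/seteqP; split => x /= xr.
  move=> i; rewrite in_itv/= -ler_distl.
  by apply: le_trans xr; have := mx_coord_le (x - x0) 0 i; rewrite !mxE.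
apply: mx_norm_le => // i j; rewrite ord1 !mxE.
by have := xr j; rewrite /= in_itv/= -ler_distl.
Qed.

Lemma compact_ball_rV n (x0 : 'rV[R]_n) (r : R) : 0 <= r ->
  compact [set x : 'rV[R]_n | `|x - x0| <= r].
Proof.
move=> r0; rewrite ball_rVE//.
apply: (@rV_compact R n (fun i => `[x0 0 i - r, x0 0 i + r]%classic)) => i.
exact: segment_compact.
Qed.

Lemma closed_ball_rV n (x0 : 'rV[R]_n) (r : R) : 0 <= r ->
  closed [set x : 'rV[R]_n | `|x - x0| <= r].
Proof.
by move=> r0; exact: compact_closed (@norm_hausdorff R 'rV[R]_n) (compact_ball_rV r0).
Qed.

(** In the sup norm a ball is a box, and splits as a product. *)
Lemma lebesgue_rV_ball_gt0 n (x0 : 'rV[R]_n) (r : R) : 0 < r ->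
  (0 < lebesgue_rV n [set x : 'rV[R]_n | (`|x - x0| <= r)%R])%E.
Proof.
move=> r0; elim: n x0 => [|n IH] x0.
  rewrite /= diracE mem_set//= sub0r.
  by apply: mx_norm_le; [exact: ltW|move=> i []].
have -> : lebesgue_rV n.+1 [set x : 'rV[R]_n.+1 | `|x - x0| <= r] =
  (lebesgue_measure \x lebesgue_rV n)%E (@cons_rV R n @^-1` [set x : 'rV[R]_n.+1 | (`|x - x0| <= r)%R]) by [].
rewrite (cons_rV_surj x0); move: (uncons_rV x0) => [t0 y0].
have m1 : measurable ([set` `[t0 - r, t0 + r]] : set (measurableTypeR R)) by exact: measurable_itv.
have m2 : measurable [set y : 'rV[R]_n | `|y - y0| <= r].
  by apply: closed_measurable_rV; apply: closed_ball_rV; exact: ltW.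
apply: (@lt_le_trans _ _ ((lebesgue_measure \x lebesgue_rV n)%E
    ([set` `[(t0 - r)%R, (t0 + r)%R]] `*` [set y : 'rV[R]_n | (`|y - y0| <= r)%R]))).
  rewrite product_measure1E// mule_gt0//; last exact: IH.
  by rewrite /= lebesgue_measure_itv/= lte_fin ifT -?EFinD ?lte_fin; lra.
apply: le_measure; rewrite ?inE.
- exact: measurableX.
- rewrite -[X in measurable X]setTI; apply: measurable_cons_rV => //.
  by apply: closed_measurable_rV; apply: closed_ball_rV; exact: ltW.
- move=> [t y] /= []; rewrite in_itv/= -ler_distl => ht hy.
  apply: mx_norm_le; first exact: ltW.
  have El (s : R) (z : 'rV[R]_n) i (k : 'I_1) : cons_rV (s, z) i (lshift n k) = s.
    apply: etrans (row_mxEl (s%:M : 'M[R]_1) z i k) _.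
    by rewrite !ord1 mxE eqxx mulr1n.
  have Er (s : R) (z : 'rV[R]_n) i k : cons_rV (s, z) i (rshift 1 k) = z i k.
    exact: (row_mxEr (s%:M : 'M[R]_1) z i k).
  move=> i j; rewrite mxE [X in _ + X]mxE.
  case: (split_ordP (j : 'I_(1 + n))) => k ->; first by rewrite !El.
  rewrite !Er; apply: le_trans hy.
  by have := mx_coord_le (y - y0) i k; rewrite !mxE.
Qed.

End ball.

(** * Patches of the hypersurface *)

Lemma continuous_mulmx (R : realType) n p (M : 'M[R]_(n, p)) :
  continuous (fun z : 'rV[R]_n => z *m M).
Proof.
move=> x; apply/(@cvgrPdist_le _ _ _ (nbhs x) _) => e e0; pose c := n%:R * `|M| + 1.
have c0 : 0 < c by rewrite ltr_wpDl// mulr_ge0.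
apply/nbhs_ballP; exists (e / c) => [|y]; rewrite /= ?divr_gt0//.
rewrite -ball_normE /= => /ltW xy.
rewrite -mulmxBl (le_trans (mulmx_le xy (lexx _)))//.
rewrite mulrCA -[leRHS](divfK (lt0r_neq0 c0)).
rewrite ler_wpM2l ?divr_ge0 ?(ltW e0) ?(ltW c0)//.
by rewrite /c lerDl.
Qed.

Section localization.
Variables (R : realType) (n : nat).
Implicit Types (c : euclidean_coordinates R n) (E : set 'rV[R]_n).

Lemma graph_pt_coord c phi x : (graph_pt c phi x - ec_b c) *m (ec_V c)^T = x.
Proof.
have wV : ec_w c *m (ec_V c)^T = 0.
  by apply: trmx_inj; rewrite trmx_mul trmxK ec_Vw trmx0.
rewrite /graph_pt -(addrA (ec_b c)) (addrC _ (- _)) addKr mulmxDl -mulmxA ec_VV mulmx1.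
by rewrite -scalemxAl wV scaler0 addr0.
Qed.

(** At a boundary point the defining function has a nonzero derivative, so it
    cannot have a local maximum there. *)
Lemma regular_positive m (U : set 'rV[R]_m) (rho : 'rV[R]_m -> R) x1 :
  open U -> smooth_on U rho -> U x1 -> 0 <= rho x1 ->
  (rho x1 = 0 -> exists i, partials [:: i] rho x1 != 0) ->
  exists2 x0, U x0 & 0 < rho x0.
Proof.
move=> oU srho Ux1 rho1 reg; apply: contrapT => noU.
have neg x : U x -> rho x <= 0.
  by move=> Ux; rewrite leNgt; apply/negP => rx; apply: noU; exists x.
have [i ] := reg (le_anti (introT andP (conj (neg _ Ux1) rho1))).
set e : 'rV[R]_m := delta_mx 0 i; move=> /negP; apply; apply/eqP.
have /nbhs_ballP[r /= r0 rU] : nbhs x1 U by apply: open_nbhs_nbhs.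
have e1 : 0 < `|e| + 1 by rewrite ltr_wpDl.
pose d := r / (`|e| + 1); have d0 : 0 < d by rewrite divr_gt0.
have Ut t : t \in `]-d, d[ -> U (x1 + t *: e).
  rewrite in_itv/= -ltr_norml ltr_pdivlMr// => td; apply: rU.
  rewrite -ball_normE /= opprD addNKr normrN normrZ.
  by apply: le_lt_trans td; rewrite ler_wpM2l// lerDl.
have der t : t \in `]-d, d[ ->
    is_derive t 1 (fun s : R => rho (x1 + s *: e)) (partials [:: i] rho (x1 + t *: e)).
  move=> /Ut Ut'; apply: is_derive_line; apply: derivableP.
  exact: (srho [::] _ Ut').2.
have zd : (0 : R) \in `]-d, d[ by rewrite in_itv/= oppr_lt0 d0.
have h0 : is_derive (0 : R) 1 (fun s : R => rho (x1 + s *: e)) 0.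
  apply: (derive1_at_max _ _ zd).
  - by rewrite -subr_ge0 opprK addr_ge0// ltW.
  - by move=> t /der[].
  - by move=> t /Ut /neg; rewrite scale0r addr0 => /le_trans; apply.
have := @derive_val _ _ _ _ _ _ _ (der _ zd).
by rewrite (@derive_val _ _ _ _ _ _ _ h0) scale0r addr0 => /esym.
Qed.

(** Removing the boundary of a chart leaves a patch of the hypersurface cut out
    by an open set, as a localization must be: the projection of
    graph_pt_coord pulls the open condition on the parameter back to the
    ambient space. *)
Lemma interior_localization E : smooth_hypersurface E -> E !=set0 ->
  exists c U phi x0, localization E c U phi /\ U x0.
Proof.
move=> hE [y Ey]; have [c [W [U [phi [rho [[oW Wy] oU [sphi srho] reg EW]]]]]] := hE y Ey.
have [x1 [Ux1 rho1] _] : (graph_pt c phi @` [set x | U x /\ 0 <= rho x]) y by rewrite -EW.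
have [x0 Ux0 rho0] := regular_positive oU srho Ux1 rho1 (reg _ Ux1).
pose U' := [set x | U x /\ 0 < rho x].
have oU' : open U'.
  rewrite openE => x [Ux rx].
  have h1 : nbhs x (rho @^-1` [set t | 0 < t]).
    by apply: (smooth_on_continuous srho Ux); exact: lt_nbhsr.
  have h2 : nbhs x U by exact: open_nbhs_nbhs.
  exact: (filterI h2 h1).
pose pr (z : 'rV[R]_n) := (z - ec_b c) *m (ec_V c)^T.
have prK x : pr (graph_pt c phi x) = x by exact: graph_pt_coord.
pose W' := W `&` pr @^-1` U'.
exists c, U', phi, x0; split=> //; split => //.
  by move=> s x [Ux _]; exact: sphi.
exists W'.
  apply: openI => //; apply: open_comp => // z _.
  have c1 : {for z, continuous (fun v : 'rV[R]_n => v - ec_b c)}.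
    exact: (cvgB (@cvg_id _ _) (cvg_cst _)).
  exact: (continuous_comp c1 (@continuous_mulmx R n _ (ec_V c)^T (z - ec_b c))).
apply/seteqP; split => z.
- move=> [Ez [Wz U'z]].
  have [x [Ux rx] zE] : (graph_pt c phi @` [set x | U x /\ 0 <= rho x]) z by rewrite -EW.
  by exists x => //; move: U'z; rewrite -zE /= prK.
- move=> [x [Ux rx] <-].
  have [Ex Wx] : (E `&` W) (graph_pt c phi x) by rewrite EW; exists x => //; split=> //; exact: ltW.
  by split=> //; split=> //; rewrite /= prK.
Qed.

End localization.

Section graph_cap.
Variables (R : realType) (n : nat) (E : set 'rV[R]_n).
Variables (c : euclidean_coordinates R n) (U : set 'rV[R]_n.-1) (phi : 'rV[R]_n.-1 -> R).
Variables (x0 : 'rV[R]_n.-1) (r : R).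
Hypotheses (lU : localization E c U phi) (r0 : 0 < r).
Local Notation D := [set x : 'rV[R]_n.-1 | `|x - x0| <= r].
Hypothesis DU : forall x : 'rV[R]_n.-1, `|x - x0| <= r -> U x.

Lemma graph_ball_measurable : measurable (graph_pt c phi @` D).
Proof.
have [_ sphi _] := lU; apply: closed_measurable_rV.
suff cD : compact (graph_pt c phi @` D).
  exact: (@compact_closed 'rV[R]_n _ (@norm_hausdorff R 'rV[R]_n) cD).
have cB : compact D by exact: (compact_ball_rV (ltW r0)).
apply: (@continuous_compact 'rV[R]_n.-1 'rV[R]_n (graph_pt c phi) D _ cB).
apply: continuous_in_subspaceT => x; rewrite inE => /= /DU Ux.
have c1 : {for x, continuous (fun z : 'rV[R]_n.-1 => ec_b c + z *m ec_V c)}.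
  exact: (cvgD (cvg_cst _) (@continuous_mulmx R _ _ (ec_V c) x)).
have c2 : {for x, continuous (fun z : 'rV[R]_n.-1 => phi z *: ec_w c)}.
  have cp : {for x, continuous phi} := smooth_on_continuous sphi Ux.
  exact: (@cvgZr_tmp _ _ _ _ _ phi (phi x) (ec_w c) cp).
exact: (cvgD c1 c2).
Qed.

Lemma graph_ball_sub : graph_pt c phi @` D `<=` E `&` (graph_pt c phi @` U).
Proof.
have [_ _ [W oW EW]] := lU => _ [x /DU Ux <-].
have gU : (graph_pt c phi @` U) (graph_pt c phi x) by exists x.
by split=> //; have [] : (E `&` W) (graph_pt c phi x) by rewrite EW.
Qed.

Lemma surface_measure_gt0 (sigma : {measure set 'rV[R]_n -> \bar R}) :
  is_surface_measure E sigma -> (0 < sigma (graph_pt c phi @` D))%E.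
Proof.
have [oU sphi _] := lU.
move=> [_ /(_ c U phi (graph_pt c phi @` D) oU sphi)] sE.
rewrite {}sE; [|exact: graph_ball_measurable|exact: graph_ball_sub].
have mD : measurable D by apply: closed_measurable_rV; apply: (closed_ball_rV (ltW r0)).
apply: lt_le_trans (lebesgue_rV_ball_gt0 x0 r0) _.
rewrite -[leLHS]mul1e -integral_cst//; apply: le_lower_integral.
- by move=> x /= Dx; split; [exact: DU|exists x].
- move=> x _; rewrite lee_fin ler01 lee_fin -[leLHS]sqrtr1 ler_wsqrtr// lerDl.
  by rewrite sumr_ge0// => i _; exact: sqr_ge0.
- by move=> x _; rewrite lee_fin sqrtr_ge0.
Qed.

End graph_cap.

(** * The critical exponent *)

Section numbers.
Variable R : realType.

Lemma powR_inv_small (c al del : R) : 0 < al -> 0 < del ->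
  exists M : nat, forall K, (M <= K)%N -> (0 < K)%N -> c * K%:R `^ (- al) <= del.
Proof.
move=> al0 del0; pose y := (`|c| / del) `^ al^-1.
have cd0 : 0 <= `|c| / del by rewrite divr_ge0// ltW.
exists (Num.truncn y).+1 => K MK K0.
have Kp : 0 < K%:R :> R by rewrite ltr0n.
have yK : y <= K%:R.
  by apply: le_trans (ltW (truncnS_gt y)) _; rewrite ler_nat.
have h : `|c| / del <= K%:R `^ al.
  have -> : `|c| / del = y `^ al by rewrite /y -powRrM mulVf ?gt_eqF// powRr1.
  by apply: ge0_ler_powR; rewrite ?nnegrE ?powR_ge0// ltW.
apply: (@le_trans _ _ (`|c| * K%:R `^ (- al))).
  by rewrite ler_wpM2r ?powR_ge0// ler_norm.
rewrite powRN ler_pdivrMr ?powR_gt0// mulrC.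
by rewrite ler_pdivrMr in h.
Qed.

(** There are (K + 1) ^ k caps, and each packet has amplitude a. The total size
    decreases like K ^ -2. The mean of the q-th powers behaves like
    K ^ (k - (k + 2) * (q - 1)), which tends to 0 exactly above the exponent
    2 * (k + 1) / (k + 2). *)
Lemma knapp_numbers (k : nat) (q D mu : R) :
  2 * k.+1%:R / k.+2%:R < q -> 0 < D -> 0 < mu ->
  exists2 K, (0 < K)%N & let a := D * K%:R^-1 ^+ k.+2 in
    2 * ((K.+1 ^ k)%N%:R * a) <= 1 /\ 2 * (K.+1 ^ k)%N%:R * a `^ (q - 1) <= mu.
Proof.
move=> qk D0 mu0; have k2 : 0 < k.+2%:R :> R by rewrite ltr0n.
pose al := k.+2%:R * (q - 1) - k%:R.
have al0 : 0 < al.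
  move: qk; rewrite ltr_pdivrMr// /al -[k.+2%:R]natr1 -[k.+1%:R]natr1.
  by move: (k%:R : R) => x; lra.
have [M1 H1] := powR_inv_small (2 * 2 ^+ k * D) (ltr0n R 2) ltr01.
have [M2 H2] := powR_inv_small (2 * 2 ^+ k * D `^ (q - 1)) al0 mu0.
pose K := (M1 + M2).+1.
have Kp : 0 < K%:R :> R by rewrite ltr0n.
have cK : (K.+1 ^ k)%N%:R <= 2 ^+ k * K%:R `^ k%:R :> R.
  rewrite powR_mulrn ?(ltW Kp)// -exprMn natrX.
  have h : K.+1%:R <= 2 * K%:R :> R by rewrite -natr1 mulr_natl mulr2n lerD2l ler1n.

  by apply: lerXn2r; rewrite ?nnegrE ?mulr_ge0.
have KE : K%:R^-1 ^+ k.+2 = K%:R `^ (- k.+2%:R) :> R.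
  by rewrite powRN powR_mulrn ?(ltW Kp)// exprVn.
have powD (s t : R) : K%:R `^ s * K%:R `^ t = K%:R `^ (s + t).
  by rewrite powRD// (gt_eqF Kp) implybT.
exists K => //; rewrite KE; split.
  have M1K : (M1 <= K)%N by rewrite /K -addnS leq_addr.
  apply: le_trans (H1 K M1K isT).
  apply: (@le_trans _ _ (2 * ((2 ^+ k * K%:R `^ k%:R) * (D * K%:R `^ (- k.+2%:R))))).
    by rewrite ler_wpM2l// ler_wpM2r// mulr_ge0 ?powR_ge0 ?ltW.
  have -> : - 2 = k%:R + - k.+2%:R :> R by rewrite -[k.+2%:R]natr1 -natr1; ring.
  by rewrite -powD le_eqVlt; apply/orP; left; apply/eqP; ring.
have M2K : (M2 <= K)%N by rewrite /K -addSn leq_addl.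
apply: le_trans (H2 K M2K isT).
rewrite powRM ?powR_ge0 ?(ltW D0)// -powRrM.
apply: (@le_trans _ _ (2 * (2 ^+ k * K%:R `^ k%:R) * (D `^ (q - 1) * K%:R `^ (- k.+2%:R * (q - 1))))).
  by rewrite ler_wpM2r ?mulr_ge0 ?powR_ge0// ler_wpM2l.
have -> : - al = k%:R + - k.+2%:R * (q - 1) by rewrite /al; ring.
by rewrite -powD le_eqVlt; apply/orP; left; apply/eqP; ring.
Qed.

End numbers.

(** * The contradiction *)

Section frame.
Variables (R : realType) (m : nat) (c : euclidean_coordinates R m.+1).

Definition ec_frame : 'M[R]_(1 + m) := col_mx (ec_w c) (ec_V c).

Lemma ec_frame_orthogonal : ec_frame *m ec_frame^T = 1%:M.
Proof.
have wV : ec_w c *m (ec_V c)^T = 0.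
  by apply: trmx_inj; rewrite trmx_mul trmxK ec_Vw trmx0.
have := And4 (ec_ww c) (ec_VV c) (ec_Vw c) wV.
rewrite /ec_frame; move: (ec_w c) (ec_V c) => /= w V [ww VV Vw {}wV].
rewrite (@tr_col_mx _ 1 m (1 + m) w V) (@mul_col_row _ 1 m (1 + m)).
rewrite [w *m w^T]ww [V *m V^T]VV [V *m w^T]Vw [w *m V^T]wV.
by rewrite -scalar_mx_block.
Qed.

Lemma norm_det_ec_frame : `|\det ec_frame| = 1.
Proof.
have : \det (ec_frame *m ec_frame^T) = 1 by rewrite ec_frame_orthogonal det1.
rewrite det_mulmx det_tr => h; apply/eqP.
by rewrite -(@eqrXn2 _ 2)// expr1n real_normK ?num_real// expr2 h.
Qed.

Lemma graph_ptB (phi : 'rV[R]_m -> R) x z :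
  graph_pt c phi x - graph_pt c phi z =
  row_mx (phi x - phi z)%:M (x - z) *m ec_frame.
Proof.
rewrite /ec_frame mul_row_col mul_scalar_mx mulmxBl scalerBl /graph_pt.
by rewrite opprD addrACA (opprD (ec_b c)) (addrACA (ec_b c)) subrr add0r addrC.
Qed.

End frame.

(** The caps over a ball, enlarged by the fixed factor L to fit the frequency
    window of the packets, contradict restriction once their number is large:
    the left side of p_restriction_packets is half the measure of the patch,
    and the right side can be made arbitrarily small. *)
Lemma cap_not_restriction (R : realType) (m k : nat) (E : set 'rV[R]_m.+1)
    (c : euclidean_coordinates R m.+1) (U : set 'rV[R]_m) (phi : 'rV[R]_m -> R) x0
    (sigma : {measure set 'rV[R]_m.+1 -> \bar R}) (p : R) :
  is_surface_measure E sigma -> @localization R m.+1 E c U phi -> U x0 -> (k <= m)%N ->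
  (forall x, U x -> \rank (hessian phi x) = k) ->
  2 * k.+1%:R / k.+2%:R < p -> ~ p_restriction E sigma p.
Proof.
move=> hsigma lU Ux0 km rankH hp [C hC].
have [oU sphi _] := lU.
have [r [C0 [d0 [[r0 C00 d00] [DU cover]]]]] := cap_cover km oU sphi rankH Ux0.
pose B := graph_pt c phi @` [set x : 'rV[R]_m | `|x - x0| <= r].
have mB : measurable B := graph_ball_measurable lU r0 DU.
have BE : B `<=` E by move=> z /(graph_ball_sub lU DU) [].
have sB : (0 < sigma B)%E := surface_measure_gt0 lU r0 DU hsigma.
have [t t0 tB] : exists2 t, 0 < t & (t%:E <= sigma B)%E.
  case: (sigma B) sB => [s||//]; first by rewrite lte_fin => s0; exists s.
  by exists 1; rewrite ?leey.
(* random signs gain square root cancellation only for exponents up to 2 *)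
pose q := Num.min p 2.
have qk : 2 * k.+1%:R / k.+2%:R < q.
  rewrite lt_min hp /= ltr_pdivrMr ?ltr0n//.
  by rewrite -[k.+2%:R]natr1; lra.
have q1 : 1 <= q.
  apply: le_trans (ltW qk); rewrite ler_pdivlMr ?ltr0n// mul1r -[k.+2%:R]natr1 -[k.+1%:R]natr1.
  by have : 0 <= k%:R :> R by []; lra.
have qp : q <= p by rewrite ge_min lexx.
have q2 : q <= 2 by rewrite ge_min lexx orbT.
pose kap : R := Num.sqrt pi ^+ m.+1.
have kap0 : 0 < kap by rewrite exprn_gt0// sqrtr_gt0 pi_gt0.
pose L := C0 / osc_const R m.+1.
have osc0 := osc_const_gt0 R m.+1.
have L0 : 0 < L by rewrite divr_gt0.
pose D := L ^+ m.+1 * `|d0| / kap.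
have D0 : 0 < D by rewrite divr_gt0// mulr_gt0 ?exprn_gt0 ?normr_gt0.
(* small enough for 2 * |C| * lam to stay below half the measure of the patch *)
pose lam := t / (8 * (`|C| + 1)).
have C1 : 0 < `|C| + 1 by rewrite ltr_wpDl.
have lam0 : 0 < lam by rewrite divr_gt0// mulr_gt0.
have mu0 : 0 < lam / lam `^ (1 - p) by rewrite divr_gt0 ?powR_gt0.
have [K K0 /= [Na1 Namu]] := knapp_numbers qk D0 mu0.
have [F [Q [detQ cov]]] := cover K K0.
pose a := D * K%:R^-1 ^+ k.+2.
pose d := L ^+ m.+1 * (`|d0| * K%:R^-1 ^+ k.+2).
have K1 : 0 < K%:R^-1 :> R by rewrite invr_gt0 ltr0n.
have a0 : 0 < a by rewrite mulr_gt0 ?exprn_gt0.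
have aE : a = d / kap by rewrite /a /d /D; ring.
pose A j : 'M[R]_m.+1 := (L *: (Q j *m ec_frame c))^T.
have detA j : `|\det (A j)| = d.
  rewrite /A det_tr detZ normrM ger0_norm ?exprn_ge0 ?(ltW L0)//.
  rewrite det_mulmx normrM norm_det_ec_frame mulr1 detQ normrM.
  by rewrite [`|_ ^+ _|]ger0_norm ?exprn_ge0 ?(ltW K1).
have uA j : A j \in unitmx.
  rewrite unitmxE unitfE -normr_eq0 detA gt_eqF//.
  by rewrite /d mulr_gt0 ?exprn_gt0// mulr_gt0 ?exprn_gt0 ?normr_gt0.
have JE : #|{ffun 'I_k -> 'I_K.+1}| = (K.+1 ^ k)%N by rewrite card_ffun !card_ord.
have capB xi : B xi -> exists j theta,
    graph_pt c phi (F j) - xi = theta *m (A j)^T /\ `|theta| <= osc_const R m.+1.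
  move=> [x /cov[j [theta [th xE]]] <-]; exists j, (- L^-1 *: theta).
  have L1 : L != 0 by rewrite gt_eqF.
  split.
    rewrite -opprB graph_ptB xE /A trmxK -scalemxAr -!scalemxAl scalerA mulmxA.
    by rewrite mulrN divff// scaleN1r.
  rewrite normrZ normrN ger0_norm ?invr_ge0 ?(ltW L0)// ler_pdivrMl//.
  by rewrite /L divfK ?gt_eqF.
have := p_restriction_packets uA (ltW a0) hC mB BE detA aE a0 capB q1 q2 qp.
rewrite JE => /(_ lam Na1 lam0) main.
have small : lam `^ (1 - p) * (2 * (K.+1 ^ k)%:R * a `^ (q - 1)) <= lam.
  by rewrite mulrC -ler_pdivlMr ?powR_gt0.
have : (2^-1 * t <= `|C| * (lam + lam)).
  rewrite -lee_fin; apply: (@le_trans _ _ ((2^-1)%:E * sigma B)%E).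
    by rewrite EFinM; apply: lee_wpmul2l => //; rewrite lee_fin.
  apply: (le_trans main); rewrite -EFinM lee_fin ler_wpM2l//.
  by rewrite lerD2l.
apply/negP; rewrite -ltNge.
have lamE : lam * (8 * (`|C| + 1)) = t by rewrite divfK// gt_eqF// mulr_gt0.
rewrite -lamE; have := normr_ge0 C; move: (`|C|) => x x0'.
have : 0 <= lam * x by rewrite mulr_ge0// ltW.
by clear -lam0 x0'; move=> *; lra.
Qed.

Theorem theorem1p2 (R : realType) (n : nat) (hn : (2 <= n)%N)
  (E : set 'rV[R]_n) (hE0 : E !=set0) (hEc : compact E)
  (hE : smooth_hypersurface E)
  (nu : nat) (hnu : (nu <= n - 2)%N) (hEnu : constant_relative_nullity E nu)
  (sigma : {measure set 'rV[R]_n -> \bar R}) (hsigma : is_surface_measure E sigma)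
  (p : R) (hp : 2 * (n%:R - nu%:R) / (n%:R - nu%:R + 1) < p) :
  ~ p_restriction E sigma p.
Proof.
have [c [U [phi [x0 [lU Ux0]]]]] := interior_localization hE hE0.
have rankH := hEnu c U phi lU.
case: n hn E hE0 hEc hE hnu hEnu sigma hsigma hp c U phi x0 lU Ux0 rankH => // m _.
move=> E _ _ _ hnu _ sigma hsigma hp c U phi x0 lU Ux0 rankH.
have num : (nu <= m)%N by rewrite (leq_trans hnu)// subSS leq_subr.
have kE : m.+1%:R - nu%:R = (m - nu).+1%:R :> R.
  by rewrite -natr1 -[in RHS]natr1 natrB// addrAC.
apply: (cap_not_restriction hsigma lU Ux0 (leq_subr nu m) rankH).
by move: hp; rewrite kE natr1.
Qed.
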